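(* Let $X$ be a one-dimensional stable process with index $\alpha\in(1,2)$ and positivity parameter $\rho$, with $\alpha\rho,\alpha\hat\rho\in(0,1)$ where $\hat\rho=1-\rho$, and let $\tau^{\{0\}}=\inf\{t>0:X_t=0\}$. Then for $x\in\mathbb{R}\setminus\{0\}$ the potential measure $U^{\{0\}}(x,dy)=\int_0^\infty\mathbb{P}_x(X_t\in dy,\,t<\tau^{\{0\}})dt$ is absolutely continuous with density satisfying, for $x,y\in\mathbb{R}\setminus\{0\}$, \[ u^{\{0\}}(x,y)=-\frac1\pi\Gamma(1-\alpha)\Big(|y|^{\alpha-1}s(y)-|y-x|^{\alpha-1}s(y-x)+|x|^{\alpha-1}s(-x)\Big), \] where $s(z)=\sin(\pi\alpha\rho)\mathbf{1}_{(z\ge0)}+\sin(\pi\alpha\hat\rho)\mathbf{1}_{(z<0)}$.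
   Context: A one-dimensional (strictly) stable process with index $\alpha$ and positivity parameter $\rho=\mathbb{P}(X_1\ge0)$ is the Lévy process with $\mathbb{E}[e^{i\theta X_t}]=e^{-t\Psi(\theta)}$, $\Psi(\theta)=|\theta|^\alpha\big(e^{\pi i\alpha(\frac12-\rho)}\mathbf{1}_{(\theta>0)}+e^{-\pi i\alpha(\frac12-\rho)}\mathbf{1}_{(\theta<0)}\big)$; $\mathbb{P}_x$ is its law issued from $x$. *)

(* Defs.v *)
From HB Require Import structures.
From mathcomp Require Import all_boot all_order all_algebra.
From mathcomp Require Import all_classical all_reals all_analysis.
Set Implicit Arguments. Unset Strict Implicit. Unset Printing Implicit Defensive.
Import Order.TTheory GRing.Theory Num.Theory.
Import numFieldNormedType.Exports.
Local Open Scope classical_set_scope.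
Local Open Scope ring_scope.

Definition GammaPos {R : realType} (s : R) : R :=
  Rintegral (@lebesgue_measure R) `]0, +oo[%classic
            (fun t => t `^ (s - 1) * expR (- t)).

(* Gamma(1 - a) for a in (1,2), via the analytic continuation
   Gamma(z) = Gamma(z+1)/z with z = 1 - a in (-1,0). *)
Definition Gamma1m {R : realType} (a : R) : R := GammaPos (2 - a) / (1 - a).

(* Characteristic exponent of the strictly stable law, split into real/imag
   parts:  Psi(th) = |th|^a (cos c + i sgn(th) sin c),  c = pi a (1/2 - rho). *)
Definition stable_c {R : realType} (a rho : R) : R := pi * a * (2^-1 - rho).

(* Real part of exp(-t Psi(th)) *)
Definition stable_cf_re {R : realType} (a rho t th : R) : R :=
  expR (- t * `|th| `^ a * cos (stable_c a rho)) *
  cos (t * `|th| `^ a * sin (stable_c a rho) * Num.sg th).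
(* Imaginary part of exp(-t Psi(th)) *)
Definition stable_cf_im {R : realType} (a rho t th : R) : R :=
  - (expR (- t * `|th| `^ a * cos (stable_c a rho)) *
     sin (t * `|th| `^ a * sin (stable_c a rho) * Num.sg th)).

Definition has_left_limit {R : realType} (f : R -> R) (t : R) : Prop :=
  exists l : R, f @ at_left t --> l.

Definition is_stable_process {d} {T : measurableType d} {R : realType}
  (P : probability T R) (a rho : R) (Y : R -> T -> R) : Prop :=
  [/\ (forall w, Y 0 w = 0),
      (forall t, 0 <= t -> measurable_fun setT (Y t)),
      (forall w t, 0 <= t -> (Y^~ w) @ at_right t --> Y t w) /\
      (forall w t, 0 < t -> has_left_limit (Y^~ w) t),
      (forall (n : nat) (tt : nat -> R) (B : nat -> set R),
          0 <= tt 0%N -> (forall i, tt i <= tt i.+1) ->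
          (forall i, measurable (B i)) ->
          P (\bigcap_(i in `I_n) [set w | B i (Y (tt i.+1) w - Y (tt i) w)])
          = \big[*%E/1%E]_(i < n)
              P [set w | B i (Y (tt i.+1) w - Y (tt i) w)]) &
      (forall s t th, 0 <= s -> s <= t ->
          Rintegral P setT (fun w => cos (th * (Y t w - Y s w)))
            = stable_cf_re a rho (t - s) th /\
          Rintegral P setT (fun w => sin (th * (Y t w - Y s w)))
            = stable_cf_im a rho (t - s) th)].

(* Under P_x the process is x + Y.  First hitting time of 0 (inf of empty
   set = +oo):  tau^{0} = inf { t > 0 : x + Y_t = 0 }. *)
Definition hit0 {T : Type} {R : realType} (Y : R -> T -> R) (x : R) (w : T)
  : \bar R :=
  ereal_inf [set t%:E | t in [set t | 0 < t /\ x + Y t w = 0]].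

Definition pot0 {d} {T : measurableType d} {R : realType}
  (P : probability T R) (Y : R -> T -> R) (x : R) (A : set R) : \bar R :=
  (\int[@lebesgue_measure R]_(t in (`[0%R, +oo[%classic : set R))
     P [set w | A (x + Y t w)%R /\ (t%:E < hit0 Y x w)%E])%E.

Definition sfun {R : realType} (a rho z : R) : R :=
  if 0 <= z then sin (pi * a * rho) else sin (pi * a * (1 - rho)).

Definition u0 {R : realType} (a rho x y : R) : R :=
  - (pi^-1) * Gamma1m a *
  (`|y| `^ (a - 1) * sfun a rho y - `|y - x| `^ (a - 1) * sfun a rho (y - x)
   + `|x| `^ (a - 1) * sfun a rho (- x)).

(* Main.v *)
(** On (0, oo) write the characteristic exponent as r + i m, and let T be the limit of the
    hitting times of the balls of radius 1/(n+1) around 0. The strong Markov property is needed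
    only for trigonometric functions,
      E[1_{S<=t} cos(th X_t + b)] = E[1_{S<=t} e^{-(t-S) r} cos(th X_S + b - (t-S) m)],
    which follows by discretising S. Integrated against an exponential time of rate q it shows
    that X_T = 0, so that T is the hitting time of 0, and it gives the Fourier transform of the
    law of X killed at T and observed at that exponential time. Inversion with the Poisson
    kernel yields its density U(y - x) - E[e^{-qT}] U(y), where U is the inverse transform of
    q / (q + r + i m); since the law killed at the ball of radius 1/(n+1) has no mass near 0,
    the same formula at y = 0 gives E[e^{-qT}] = U(-x) / U(0). As q decreases to 0 the density
    divided by q increases to the potential density, while U(0)/q tends to infinity and
    (U(0) - U(z))/q tends to h(z) = pi^{-1} int Re ((1 - e^{-i t z}) / (r + i m)) dt, whence
    u(x, y) = h(-x) + h(y) - h(y - x). Finally K(z) = int (1 - e^{-zt}) t^{-a} dt equals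
    z^{a-1} K(1), by solving a linear differential equation along a spiral from 1 to i|z|. *)

Require Import Defs.
From HB Require Import structures.
From mathcomp Require Import all_boot all_order all_algebra.
From mathcomp Require Import all_classical all_reals all_analysis.
From mathcomp Require Import real_interval measurable_realfun.
From mathcomp Require Import ring lra.
Import Order.TTheory GRing.Theory Num.Theory.
Import numFieldNormedType.Exports.
Local Open Scope classical_set_scope.
Local Open Scope ring_scope.
Set Implicit Arguments. Unset Strict Implicit. Unset Printing Implicit Defensive.

(** * Integration tools *)

(** The process is given by two facts only: the product formula for increments along finite time
    sequences, and the characteristic function. There is no filtration at hand, so belonging to the
    past of time t is reduced to the identity in [past_event], stated for cosines with an arbitrary
    phase b. The phase also performs every multiplication by i, which keeps the argument real, with
    frequencies th > 0. The identity is linear in the indicator of the event; hitting events are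
    therefore built from grid events by monotone limits. Two obstacles shape the rest. The infimum
    in [hit0] is not visibly measurable, hence the substitute [hit_zero], the almost sure equality
    and the use of completeness at the end. And the value at [hit_zero] concerns a limit along
    increasing times, about which right continuity is silent; it is recovered by comparing two
    expressions of the same resolvent. The Poisson kernel is chosen for inversion because it is
    positive: sign and monotonicity in q, invisible in oscillating integrals, pass through it to the
    densities. *)

Lemma measurable_cos {R : realType} : measurable_fun setT (@cos R).
Proof. by apply: continuous_measurable_fun => x; exact: continuous_cos. Qed.

Lemma measurable_sin {R : realType} : measurable_fun setT (@sin R).
Proof. by apply: continuous_measurable_fun => x; exact: continuous_sin. Qed.

Section tools.
Context {d} {T : measurableType d} {R : realType}.

Lemma bounded_integrable (mu : {finite_measure set T -> \bar R}) (D : set T) (f : T -> R) (K : R) :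
  measurable D -> measurable_fun D f -> (forall x, D x -> `|f x| <= K) ->
  mu.-integrable D (EFin \o f).
Proof.
move=> mD mf fK; apply: measurable_bounded_integrable => //.
  by rewrite (le_lt_trans _ (fin_num_fun_lty (fin_num_measure mu))) ?le_measure ?inE.
exists K; split; first exact: num_real.
by move=> M KM x Dx /=; apply: (le_trans (fK _ Dx)); exact: ltW.
Qed.

Lemma le_integrableR (mu : {measure set T -> \bar R}) (D : set T) (f g : T -> R) :
  measurable D -> measurable_fun D f -> (forall x, D x -> `|f x| <= g x) ->
  mu.-integrable D (EFin \o g) -> mu.-integrable D (EFin \o f).
Proof.
move=> mD mf fg ig; apply: (le_integrable mD _ _ ig); first exact/measurable_EFinP.
by move=> x Dx /=; rewrite lee_fin (le_trans (fg _ Dx))// ler_norm.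
Qed.

Lemma Rdominated_cvg (mu : {measure set T -> \bar R}) (D : set T)
   (f_ : nat -> T -> R) (f g : T -> R) :
  measurable D -> (forall n, measurable_fun D (f_ n)) ->
  (forall x, D x -> f_ n x @[n --> \oo] --> f x) ->
  mu.-integrable D (EFin \o g) -> (forall n x, D x -> `|f_ n x| <= g x) ->
  (\int[mu]_(x in D) f_ n x) @[n --> \oo] --> \int[mu]_(x in D) f x.
Proof.
move=> mD mf cf ig fg.
have mfl : measurable_fun D f by apply: (measurable_fun_cvg (h:=f_)).
have fg' x : D x -> `|f x| <= g x.
  move=> Dx; apply: (closed_cvg (fun y => y <= g x) _ _ _ (cvg_norm (cf x Dx))).
    exact: closed_le.
  by apply: nearW => n; exact: fg.
have [] := @dominated_convergence _ _ _ mu D mD (fun n => EFin \o f_ n) (EFin \o f) (EFin \o g).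
- by move=> n; exact/measurable_EFinP.
- exact/measurable_EFinP.
- by apply: aeW => x Dx; apply: cvg_EFin; [exact: nearW|exact: cf].
- exact: ig.
- by apply: aeW => x n Dx; rewrite /= lee_fin fg.
move=> fi _ c; apply: fine_cvg.
by rewrite fineK//; exact: integrable_fin_num.
Qed.
End tools.

Section fubini.
Context {d1 d2} {T1 : measurableType d1} {T2 : measurableType d2} {R : realType}.
Variables (m1 : {sigma_finite_measure set T1 -> \bar R})
          (m2 : {sigma_finite_measure set T2 -> \bar R}).
Variables (D1 : set T1) (D2 : set T2) (f : T1 -> T2 -> R) (g1 : T1 -> R) (g2 : T2 -> R).
Hypotheses (mD1 : measurable D1) (mD2 : measurable D2).
Hypothesis mf : measurable_fun (D1 `*` D2) (fun p : T1 * T2 => f p.1 p.2).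
Hypothesis ig1 : m1.-integrable D1 (EFin \o g1).
Hypothesis ig2 : m2.-integrable D2 (EFin \o g2).
Hypothesis fg : forall x y, D1 x -> D2 y -> `|f x y| <= g1 x * g2 y.

Let F := (fun p : T1 * T2 => (f p.1 p.2)%:E) \_ (D1 `*` D2).

Let mF : measurable_fun setT F.
Proof.
apply/(measurable_restrictT _ _).1; first exact: measurableX.
exact/measurable_EFinP.
Qed.

Let slice1 x : D1 x -> m2.-integrable D2 (fun y => (f x y)%:E).
Proof.
move=> Dx.
have ig : m2.-integrable D2 (fun y => (`|g1 x|%R)%:E * (EFin \o g2) y)%E.
  exact: integrableZl.
apply: (le_integrable mD2 _ _ ig).
  apply/measurable_EFinP.
  have -> : f x = (fun p : T1 * T2 => f p.1 p.2) \o (fun y => (x, y)) by [].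
  apply: (measurable_comp (F:=D1 `*` D2)) => //.
  - exact: measurableX.
  - by move=> _ [y Dy <-].
  - exact: measurable_funTS (pair1_measurable x).
move=> y Dy; rewrite /comp -EFinM lee_fin (le_trans (fg Dx Dy))//.
by rewrite (le_trans (ler_norm _))// !normrM normr_id.
Qed.

Let F1 x : fubini_F m2 F x = ((fun x => \int[m2]_(y in D2) f x y) \_ D1 x)%:E.
Proof.
rewrite /fubini_F /patch; case: ifPn => [/[!inE] Dx|].
  rewrite fineK; last by apply: integrable_fin_num => //; exact: slice1.
  rewrite [RHS]integral_mkcond; apply: eq_integral => y _.
  rewrite /F /patch /=; congr (if _ then _ else _).
  by apply/idP/idP; rewrite !inE => //; case.
rewrite notin_setE => nDx; rewrite integral0_eq// => y _.
by rewrite /F /patch /= memNset// => -[].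
Qed.

Let iF : (m1 \x m2)%E.-integrable setT F.
Proof.
apply/(integrable12ltyP _ _ mF).
set c := (\int[m2]_(y in D2) `|(g2 y)%:E|)%E.
have cfin : (c < +oo)%E by case/integrableP : ig2.
have c0 : (0 <= c)%E by exact: integral_ge0.
have mg1 : measurable_fun D1 g1 by apply/measurable_EFinP; case/integrableP : ig1.
apply: (@le_lt_trans _ _ (\int[m1]_(x in D1) (c * `|(g1 x)%:E|))%E); last first.
  rewrite ge0_integralZl//; last first.
    by apply: measurableT_comp => //; exact/measurable_EFinP.
  by rewrite lte_mul_pinfty// ?ge0_fin_numE//; case/integrableP : ig1.
rewrite [leRHS]integral_mkcond; apply: ge0_le_integral => //.
- by move=> x _; exact: integral_ge0.
- by apply: (measurable_fun_fubini_tonelli_F (abse \o F)) => //=; exact: measurableT_comp.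
- apply/(measurable_restrictT _ mD1).1/measurable_funeM.
  by apply: measurableT_comp => //; exact/measurable_EFinP.
move=> x _; rewrite /patch; case: ifPn => [/[!inE] Dx|]; last first.
  rewrite notin_setE => nDx; rewrite integral0_eq// => y _.
  by rewrite /F /patch /= memNset ?abse0// => -[].
rewrite /c muleC -ge0_integralZl//; last first.
  by apply: measurableT_comp => //; case/integrableP : ig2.
rewrite [leRHS]integral_mkcond; apply: ge0_le_integral => //.
- apply: measurableT_comp => //; have -> : (fun y => F (x, y)) = F \o (pair x) by [].
  by apply: measurableT_comp mF _; exact: pair1_measurable.
- apply/(measurable_restrictT _ mD2).1/measurable_funeM.
  by apply: measurableT_comp => //; case/integrableP : ig2.
move=> y _; rewrite /F /patch/=; case: ifPn => [|_]; last first.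
  by rewrite abse0; case: ifP => // _; rewrite mule_ge0.
rewrite inE => -[/= _ Dy]; rewrite mem_set// -EFinM lee_fin -normrM.
by rewrite (le_trans (fg _ _))// ler_norm.
Qed.

(** The product bound [g1 x * g2 y] makes the extension of f by zero integrable for the product
    measure, so every slice has a finite integral and the real-valued partial integral agrees
    everywhere with the one of Fubini's theorem. *)
Lemma Rfubini_measurable : measurable_fun D1 (fun x => \int[m2]_(y in D2) f x y).
Proof.
apply/(measurable_restrictT _ mD1).2; apply/measurable_EFinP.
rewrite (_ : _ \o _ = fubini_F m2 F); last by apply/funext => x; rewrite F1.
exact: measurable_fubini_F iF.
Qed.

Let F2 : \int[m1]_(x in D1) \int[m2]_(y in D2) f x y = fine (\int[m1]_x \int[m2]_y F (x, y))%E.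
Proof.
congr fine; rewrite integral_mkcond; apply: eq_integral => x _.
by have := F1 x; rewrite /fubini_F => ->; rewrite restrict_EFin.
Qed.

Lemma Rfubini_iter : \int[m1]_(x in D1) \int[m2]_(y in D2) f x y =
    fine (\int[m1]_x \int[m2]_y F (x, y))%E /\ (m1 \x m2)%E.-integrable setT F.
Proof. by split; [exact: F2|exact: iF]. Qed.

End fubini.

Section fubini_swap.
Context {d1 d2} {T1 : measurableType d1} {T2 : measurableType d2} {R : realType}.
Variables (m1 : {sigma_finite_measure set T1 -> \bar R})
          (m2 : {sigma_finite_measure set T2 -> \bar R}).

Lemma Rfubini (D1 : set T1) (D2 : set T2) (f : T1 -> T2 -> R) (g1 : T1 -> R) (g2 : T2 -> R) :
  measurable D1 -> measurable D2 ->
  measurable_fun (D1 `*` D2) (fun p : T1 * T2 => f p.1 p.2) ->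
  m1.-integrable D1 (EFin \o g1) -> m2.-integrable D2 (EFin \o g2) ->
  (forall x y, D1 x -> D2 y -> `|f x y| <= g1 x * g2 y) ->
  \int[m1]_(x in D1) \int[m2]_(y in D2) f x y = \int[m2]_(y in D2) \int[m1]_(x in D1) f x y.
Proof.
move=> mD1 mD2 mf i1 i2 fg.
have [-> iF] := Rfubini_iter mD1 mD2 mf i1 i2 fg.
have mf' : measurable_fun (D2 `*` D1) (fun p : T2 * T1 => f p.2 p.1).
  have -> : (fun p : T2 * T1 => f p.2 p.1) = (fun p : T1 * T2 => f p.1 p.2) \o (fun p : T2 * T1 => (p.2, p.1)) by [].
  apply: (measurable_comp (F:=D1 `*` D2)) => //.
  - exact: measurableX.
  - by move=> _ [[x y] [/= ? ?] <-].
  - by apply: measurable_funTS; exact: measurable_fun_pair.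
have fg' y x : D2 y -> D1 x -> `|f x y| <= g2 y * g1 x.
  by move=> Dy Dx; rewrite mulrC fg.
have [-> _] := Rfubini_iter mD2 mD1 mf' i2 i1 fg'.
rewrite Fubini; last exact: iF.
congr fine; apply: eq_integral => y _; apply: eq_integral => x _.
rewrite /patch /=; congr (if _ then _ else _).
by apply/idP/idP; rewrite !inE => -[].
Qed.

End fubini_swap.

(** * Laplace integrals of cosines *)

Section laplace_cos.
Context {R : realType}.
Notation mu := (@lebesgue_measure R).

(** The antiderivative is the real part of e^(ib) e^((-a + im)u) / (-a + im). The quotient of a^2 +
    m^2 by itself is left standing so that the identity is pure ring algebra, valid even when a and
    m vanish. *)
Lemma is_derive_expcos (a m b x : R) :
  is_derive x 1 (fun u => expR (- a * u) * (m * sin (m * u + b) - a * cos (m * u + b)) / (a ^+ 2 + m ^+ 2))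
   (expR (- a * x) * cos (m * x + b) * ((a ^+ 2 + m ^+ 2) / (a ^+ 2 + m ^+ 2))).
Proof.
apply: is_derive_eq.
rewrite /GRing.scale /=.
set e := expR _; set s := sin _; set c := cos _; set D := (_ ^-1).
ring.
Qed.

Lemma integrable_expR (a : R) : 0 < a ->
  mu.-integrable `[0, +oo[ (fun u => (expR (- a * u))%:E).
Proof.
move=> a0.
have : mu.-integrable `[0, +oo[ (EFin \o exponential_pdf a).
  by apply: integrableS (integrable_exponential_pdf a0).
have ia : mu.-integrable `[0, +oo[ (fun u => (a^-1)%:E * (EFin \o exponential_pdf a) u)%E.
  apply: integrableZl => //.
  by apply: integrableS (integrable_exponential_pdf a0).
move=> _; apply: eq_integrable ia => // u; rewrite inE/= in_itv/= andbT => u0.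
by rewrite exponential_pdfE//= -EFinM mulrA mulVf ?mul1r ?gt_eqF.
Qed.

Lemma integral_expR_cos (a m b s : R) : 0 < a -> 0 <= s ->
  \int[mu]_(u in `[s, +oo[) (expR (- a * u) * cos (m * u + b)) =
  expR (- a * s) * (a * cos (m * s + b) - m * sin (m * s + b)) / (a ^+ 2 + m ^+ 2).
Proof.
move=> a0 s0.
pose f (u : R) : R := expR (- a * u) * cos (m * u + b).
pose F (u : R) : R := expR (- a * u) * (m * sin (m * u + b) - a * cos (m * u + b)) / (a ^+ 2 + m ^+ 2).
have D0 : a ^+ 2 + m ^+ 2 != 0.
  by rewrite gt_eqF// ltr_wpDr ?sqr_ge0// exprn_gt0.
have dF (x : R) : is_derive x 1 F (f x).
  have := is_derive_expcos a m b x; rewrite divff// mulr1; exact.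
have cf : continuous f.
  move=> x; apply: differentiable_continuous; apply/derivable1_diffP.
  by rewrite /f; apply: derivableM.
have cF : continuous F.
  by move=> x; apply: differentiable_continuous; apply/derivable1_diffP; case: (dF x).
have mf : measurable_fun setT f by exact: continuous_measurable_fun.
have fb u : `|f u| <= expR (- a * u).
  by rewrite /f normrM ger0_norm ?expR_ge0// ler_piMr ?expR_ge0// ler_norml cos_geN1 cos_le1.
pose fn (n : nat) := f \_ `[s, s + n.+1%:R].
have E n : \int[mu]_(u in `[s, +oo[) fn n u = F (s + n.+1%:R) - F s.
  rewrite -[RHS]/(fine ((F (s + n.+1%:R))%:E - (F s)%:E)%E) -(@continuous_FTC2 _ f)//.
  - rewrite /fn -Rintegral_mkcondr (_ : _ `&` _ = `[s, s + n.+1%:R]%classic)//.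
    by rewrite setIidr// => x/=; rewrite !in_itv/= => /andP[->].
  - by rewrite ltrDl.
  - exact: continuous_subspaceT.
  - split=> [x _||]; first by case: (dF x).
      exact: cvg_at_right_filter (cF s).
    exact: cvg_at_left_filter (cF _).
  - by move=> x _; rewrite derive1E; case: (dF x).
have c1 : \int[mu]_(u in `[s, +oo[) fn n u @[n --> \oo] --> \int[mu]_(u in `[s, +oo[) f u.
  apply: (@Rdominated_cvg _ _ _ mu `[s, +oo[%classic fn f (fun u => expR (- a * u))).
  - exact: measurable_itv.
  - move=> n; rewrite /fn; apply: measurable_funTS.
    by apply/(measurable_restrictT _ _).1 => //; exact: measurable_funTS.
  - move=> x /=; rewrite in_itv/= andbT => sx.
    apply: cvg_near_cst; near=> n; rewrite /fn patchE ifT// inE/= in_itv/= sx/= -lerBlDl.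
    rewrite (@le_trans _ _ n%:R)// ?ler_nat//.
    by near: n; exact: nbhs_infty_ger.
  - apply: integrableS (integrable_expR a0) => //.
    by move=> x/=; rewrite !in_itv/= !andbT; exact: le_trans.
  - move=> n x _; rewrite /fn patchE; case: ifP => _ //.
    by rewrite normr0 expR_ge0.
have c2 : (F (s + n.+1%:R) - F s) @[n --> \oo] --> 0 - F s.
  apply: cvgB; last exact: cvg_cst.
  (* The constant bounds the trigonometric factor of [F]. Since s >= 0, the exponential at s + n + 1
     is at most its value at n + 1, a power of e^(-a) < 1. *)
  have c3 : (fun n => expR (- a * n.+1%:R) * ((`|m| + a) / (a ^+ 2 + m ^+ 2))) @ \oo --> 0.
    rewrite -[X in _ --> X](mul0r ((`|m| + a) / (a ^+ 2 + m ^+ 2))).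
    apply: cvgMl.
    have -> : (fun n => expR (- a * n.+1%:R)) = (fun n => expR (- a) ^+ n.+1).
      by apply/funext => n; rewrite -expRM_natr mulr_natr.
    rewrite cvg_shiftS; apply: cvg_expr.
    by rewrite ger0_norm ?expR_ge0// expR_lt1 oppr_lt0.
  apply/cvgr0Pnorm_lt => e e0.
  move/cvgr0Pnorm_lt : c3 => /(_ _ e0); apply: filterS => n; apply: le_lt_trans.
  rewrite /F -mulrA normrM [leRHS]normrM ler_pM//.
    rewrite !ger0_norm ?expR_ge0// ler_expR ler_wnM2l ?oppr_le0 ?(ltW a0)//.
    by rewrite lerDr.
  rewrite !normrM ler_wpM2r// [leRHS]ger0_norm ?addr_ge0 ?(ltW a0)//.
  rewrite (le_trans (ler_normB _ _))// !normrM lerD//.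
    by rewrite ler_piMr// ler_norml sin_geN1 sin_le1.
  by rewrite (ger0_norm (ltW a0)) ler_piMr ?(ltW a0)// ler_norml cos_geN1 cos_le1.
have c3 : \int[mu]_(u in `[s, +oo[) fn n u @[n --> \oo] --> 0 - F s.
  by under eq_cvg do rewrite E.
have -> := cvg_unique (@Rhausdorff R) c1 c3.
by rewrite /F add0r -mulNr -mulrN opprB.
Unshelve. all: by end_near. Qed.
End laplace_cos.

(** * Strong Markov property for trigonometric functions *)

Section indep.
Context {d d1 d2} {T : measurableType d} {T1 : measurableType d1} {T2 : measurableType d2} {R : realType}.
Variable P : probability T R.

(** The joint law of (V, Z) and the product of the two laws agree on rectangles, hence everywhere,
    and Fubini separates the variables. The result is pulled back to T, so both variables range over
    the same probability space. *)
Lemma indep_Rintegral (V : {mfun T >-> T1}) (Z : {mfun T >-> T2}) (h : T1 -> T2 -> R) (K : R) :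
  (forall A C, measurable A -> measurable C ->
     P (V @^-1` A `&` Z @^-1` C) = (P (V @^-1` A) * P (Z @^-1` C))%E) ->
  measurable_fun setT (fun p : T1 * T2 => h p.1 p.2) ->
  (forall x y, `|h x y| <= K) ->
  \int[P]_w h (V w) (Z w) = \int[P]_w \int[P]_w' h (V w) (Z w').
Proof.
move=> indep mh hK.
have mVZ : measurable_fun setT (fun w => (V w, Z w)) by exact: measurable_fun_pair.
pose VZ : {mfun T >-> (T1 * T2)%type} := mfun_Sub (mem_set mVZ).
pose h' (p : T1 * T2) := h p.1 p.2.
have fb (d' : measure_display) (T' : measurableType d') (mu : probability T' R) (f : T' -> R) :
    measurable_fun setT f -> (forall x, `|f x| <= K) -> mu.-integrable setT (EFin \o f).
  by move=> mf fK; apply: (@bounded_integrable _ _ _ _ _ _ K).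
have E1 : \int[P]_w h (V w) (Z w) = \int[distribution P VZ]_p h' p.
  congr fine; rewrite integral_distribution//; first exact/measurable_EFinP.
  by apply: (fb _ _ P) => [|w]; [exact: measurableT_comp mh mVZ|exact: hK].
have E2 (X : set (T1 * T2)) : measurable X ->
    (distribution P V \x distribution P Z)%E X = distribution P VZ X.
  move=> mX; apply: product_measure_unique => // A C mA mC.
have E3 : \int[distribution P VZ]_p h' p =
          \int[distribution P V]_x \int[distribution P Z]_y h x y.
  have ih : (distribution P V \x distribution P Z)%E.-integrable setT (EFin \o h').
    apply/integrableP; split; first exact/measurable_EFinP.
    rewrite (eq_measure_integral (distribution P VZ)); last first.
      by move=> A mA _; exact: E2.
    by have /integrableP[] := fb _ _ (distribution P VZ) h' mh (fun p => hK p.1 p.2).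
  rewrite /Rintegral (eq_measure_integral (distribution P V \x distribution P Z)%E); last first.
    by move=> A mA _; apply/esym; exact: E2.
  rewrite -integral12_prod_meas1//; congr fine; apply: eq_integral => x _.
  rewrite /fubini_F fineK//; apply: integrable_fin_num => //.
  apply: fb => //; exact: measurableT_comp mh (pair1_measurable x).
rewrite E1 E3 [LHS]/Rintegral integral_distribution//=.
- congr fine; apply: eq_integral => w _ /=; congr (_%:E).
  rewrite /Rintegral integral_distribution//.
  + by apply/measurable_EFinP; exact: measurableT_comp mh (pair1_measurable _).
  + apply: fb => [|w']; last exact: hK.
    exact: measurableT_comp (measurableT_comp mh (pair1_measurable _)) _.
- apply/measurable_EFinP.
  apply: (@Rfubini_measurable _ _ _ _ _ (distribution P V) (distribution P Z) setT setT _ (cst K) (cst 1)) => //.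
  + by rewrite setXTT.
  + exact: finite_measure_integrable_cst.
  + exact: finite_measure_integrable_cst.
  + by move=> x y _ _ /=; rewrite mulr1.
- have mJ : measurable_fun setT (fun x => \int[distribution P Z]_y h x y).
    apply: (@Rfubini_measurable _ _ _ _ _ (distribution P V) (distribution P Z) setT setT _ (cst K) (cst 1)) => //.
    + by rewrite setXTT.
    + exact: finite_measure_integrable_cst.
    + exact: finite_measure_integrable_cst.
    + by move=> x y _ _ /=; rewrite mulr1.
  apply: (fb _ _ P (fun w => \int[distribution P Z]_y h (V w) y)) => [|w].
    exact: (measurableT_comp mJ).
  have ih1 : (distribution P Z).-integrable setT (EFin \o h (V w)).
    apply: fb => [|w']; last exact: hK.
    exact: measurableT_comp mh (pair1_measurable _).
  rewrite (le_trans (le_normr_Rintegral _ _))//.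
  rewrite (@le_trans _ _ (\int[distribution P Z]_y K))//.
    apply: le_Rintegral => //; last by exact: finite_measure_integrable_cst.
    exact: integrable_norm.
  have P1 : distribution P Z setT = 1%E := probability_setT (distribution P Z).
  have E := @Rintegral_cst _ _ _ (distribution P Z) setT measurableT K.
  rewrite E (_ : fine _ = 1) ?mulr1//.
  exact: (congr1 fine P1).
Qed.
End indep.

(** * Rounding times up to a grid *)

Section grid.
Context {R : realType}.
Implicit Types e s : R.

(* the least multiple of e lying strictly above s, for s >= 0 *)
Definition grid_up (e s : R) : R := e * (Num.truncn (s / e)).+1%:R.

Lemma grid_up_gt e s : 0 < e -> s < grid_up e s.
Proof. by move=> e0; rewrite /grid_up mulrC -ltr_pdivrMr// truncnS_gt. Qed.

Lemma grid_up_le e s : 0 < e -> 0 <= s -> grid_up e s <= s + e.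
Proof.
move=> e0 s0; rewrite /grid_up -natr1 mulrDr mulr1 lerD2r mulrC -ler_pdivlMr//.
by rewrite truncn_le// divr_ge0// ltW.
Qed.

Lemma grid_up_eq e s k : 0 < e -> e * k%:R <= s -> s < e * k.+1%:R -> grid_up e s = e * k.+1%:R.
Proof.
move=> e0 ks sk; rewrite /grid_up; congr (_ * _.+1%:R).
by apply: truncn_def; rewrite ler_pdivlMr// ltr_pdivrMr// ![_ * e]mulrC ks.
Qed.

Lemma grid_up_lec e s k : 0 < e -> 0 <= s -> s < e * k%:R -> grid_up e s <= e * k%:R.
Proof.
move=> e0 s0 sk; rewrite /grid_up ler_pM2l// ler_nat -(@ltr_nat R).
have : (Num.truncn (s / e))%:R <= s / e by rewrite truncn_le divr_ge0// ltW.
by move=> /le_lt_trans; apply; rewrite ltr_pdivrMr// mulrC.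
Qed.

Lemma grid_up_cvg (e_ : nat -> R) s : 0 <= s -> (forall n, 0 < e_ n) -> e_ @ \oo --> 0 ->
  grid_up (e_ n) s @[n --> \oo] --> s.
Proof.
move=> s0 e0 ce.
apply: (squeeze_cvgr (f:=cst s) (h:=fun n => s + e_ n)).
- by apply: nearW => n; rewrite grid_up_le// ltW// grid_up_gt.
- exact: cvg_cst.
- by rewrite -[X in _ --> X]addr0; apply: cvgD => //; exact: cvg_cst.
Qed.

(** Because [grid_up] lies strictly above s, the convergence takes place in right neighbourhoods,
    the form in which right continuity of the paths can be applied. *)
Lemma grid_up_cvg_right (e_ : nat -> R) s : 0 <= s -> (forall n, 0 < e_ n) -> e_ @ \oo --> 0 ->
  grid_up (e_ n) s @[n --> \oo] --> s^'+.
Proof.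
move=> s0 e0 ce U [d0 /= d00 sU].
have /cvgr_dist_lt /(_ _ d00) := grid_up_cvg s0 e0 ce.
by apply: filterS => n dn; apply: sU => //=; exact: grid_up_gt.
Qed.

End grid.

(** * Events of the past and optional times *)

Section optional.
Context {d} {T : measurableType d} {R : realType}.
Variables (P : probability T R) (X : R -> T -> R) (r m : R -> R).

(* The only consequence of B belonging to the past of X at time t that the proof needs: the
   increments after t, with characteristic function exp (- u (r th + i m th)), are independent
   of B. The phase b covers sines and cosines at once. *)
Definition past_event (t : R) (B : set T) := measurable B /\
  forall (th b t' : R), 0 < th -> t <= t' ->
   \int[P]_(w in B) cos (th * X t' w + b) =
   expR (- (t' - t) * r th) * \int[P]_(w in B) cos (th * X t w + b - (t' - t) * m th).

Hypothesis mX : forall t, measurable_fun setT (X t).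

Lemma measurable_cosX th b t D : measurable_fun D (fun w => cos (th * X t w + b)).
Proof.
apply: measurable_funTS; apply: (measurableT_comp (f:=cos)).
  exact: measurable_cos.
by apply: measurable_funD => //; exact: measurable_funM.
Qed.

Lemma norm_cos_le1 (x : R) : `|cos x| <= 1.
Proof. by rewrite ler_norml cos_geN1 cos_le1. Qed.

Lemma integrable_cosX th b t D : measurable D ->
  P.-integrable D (EFin \o (fun w => cos (th * X t w + b))).
Proof.
move=> mD; apply: (@bounded_integrable _ _ _ _ _ _ 1) => //; first exact: measurable_cosX.
by move=> w _; exact: norm_cos_le1.
Qed.

Lemma cvg_Rintegral_sets (B_ : nat -> set T) (B : set T) (f : T -> R) (K : R) :
  (forall n, measurable (B_ n)) -> measurable_fun setT f -> (forall w, `|f w| <= K) ->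
  (forall w, \forall n \near \oo, B_ n w = B w) ->
  \int[P]_(w in B_ n) f w @[n --> \oo] --> \int[P]_(w in B) f w.
Proof.
move=> mB mf fK cB; rewrite Rintegral_mkcond.
under eq_cvg do rewrite Rintegral_mkcond.
have K0 : 0 <= K by rewrite (le_trans _ (fK point)).
apply: (@Rdominated_cvg _ _ _ P setT _ _ (cst K)) => //.
- by move=> n; apply/(measurable_restrictT _ (mB n)).1; exact: measurable_funTS.
- move=> w _; apply: cvg_near_cst; move: (cB w); apply: filterS => n e.
  rewrite !patchE; congr (if _ then _ else _).
  by rewrite /in_mem /= /in_set e.
- exact: finite_measure_integrable_cst.
- by move=> n w _; rewrite patchE; case: ifP => _; rewrite ?normr0.
Qed.

(** The exponent is additive in time: the identity from s to t' and the one from s to t, the latter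
    with its phase already turned by (t' - t) m, combine into the identity from t to t'. *)
Lemma past_eventS s t B : s <= t -> past_event s B -> past_event t B.
Proof.
move=> st [mB eB]; split=> // th b t' th0 tt'.
rewrite (eB _ _ _ th0 (le_trans st tt')).
have -> : (fun w => cos (th * X t w + b - (t' - t) * m th)) =
          (fun w => cos (th * X t w + (b - (t' - t) * m th))).
  by apply/funext => w; rewrite addrA.
rewrite (eB _ _ _ th0 st) mulrA -expRD; congr (expR _ * _); first by ring.
by apply: eq_Rintegral => w _; congr cos; ring.
Qed.

(** Both sides are integrals of bounded functions over the event, so dominated convergence passes
    the identity to pointwise limits of events. *)
Lemma past_event_lim t (B_ : nat -> set T) (B : set T) : measurable B ->
  (forall n, past_event t (B_ n)) -> (forall w, \forall n \near \oo, B_ n w = B w) ->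
  past_event t B.
Proof.
move=> mB eB cB; split=> // th b t' th0 tt'.
have mBn n : measurable (B_ n) by case: (eB n).
have c1 : \int[P]_(w in B_ n) cos (th * X t' w + b) @[n --> \oo] -->
          \int[P]_(w in B) cos (th * X t' w + b).
  by apply: (@cvg_Rintegral_sets _ _ _ 1) => // [|w]; [exact: measurable_cosX|exact: norm_cos_le1].
have c2 : expR (- (t' - t) * r th) * \int[P]_(w in B_ n) cos (th * X t w + b - (t' - t) * m th)
   @[n --> \oo] -->
   expR (- (t' - t) * r th) * \int[P]_(w in B) cos (th * X t w + b - (t' - t) * m th).
  apply: cvgMr; apply: (@cvg_Rintegral_sets _ _ _ 1) => // [|w]; last exact: norm_cos_le1.
  by under eq_fun do rewrite -addrA; exact: measurable_cosX.
have e : (fun n => \int[P]_(w in B_ n) cos (th * X t' w + b)) = (fun n => expR (- (t' - t) * r th) *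
   \int[P]_(w in B_ n) cos (th * X t w + b - (t' - t) * m th)).
  by apply/funext => n; rewrite (eB n).2.
by rewrite e in c1; exact: (cvg_unique (@Rhausdorff R) c1 c2).
Qed.

Lemma past_event_bigcup t (B_ : nat -> set T) :
  (forall n, past_event t (B_ n)) -> (forall n, B_ n `<=` B_ n.+1) ->
  past_event t (\bigcup_n B_ n).
Proof.
move=> eB ndB; apply: (@past_event_lim _ B_) => //.
  by apply: bigcupT_measurable => n; case: (eB n).
move=> w; have [[N _ BN]|nB] := pselect ((\bigcup_n B_ n) w).
  near=> n; apply/propext; split=> [|_]; first by exists n.
  have H k : B_ (N + k)%N w by elim: k => [|k ih]; rewrite ?addn0// addnS; exact: ndB.
  have -> : n = (N + (n - N))%N; last exact: H.
  by rewrite subnKC//; near: n; exists N.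
by near=> n; apply/propext; split=> [Bn|//]; case: nB; exists n.
Unshelve. all: by end_near. Qed.

(** The identity is linear in the indicator of the event. As in a Dynkin class, it survives proper
    differences and monotone limits but says nothing about the intersection of two unrelated events;
    hence the inclusion here and the monotonicity in the neighbouring lemmas. *)
Lemma past_event_setD t B C : B `<=` C -> past_event t B -> past_event t C -> past_event t (C `\` B).
Proof.
move=> BC [mB eB] [mC eC]; split; first exact: measurableD.
move=> th b t' th0 tt'.
have S c s : \int[P]_(w in C `\` B) cos (th * X s w + c) =
    \int[P]_(w in C) cos (th * X s w + c) - \int[P]_(w in B) cos (th * X s w + c).
  apply/eqP; rewrite -subr_eq opprK eq_sym; apply/eqP.
  rewrite -{1}(setDUK BC) setUC Rintegral_setU//; first exact: measurableD.
  - by rewrite setUC setDUK//; exact: integrable_cosX.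
  - by rewrite disj_set2E setDKI.
have S' c s c' : \int[P]_(w in C `\` B) cos (th * X s w + c - c') =
    \int[P]_(w in C) cos (th * X s w + c - c') - \int[P]_(w in B) cos (th * X s w + c - c').
  by move: (S (c - c') s); under eq_Rintegral do rewrite addrA;
     under [in X in _ = X -> _]eq_Rintegral do rewrite addrA;
     under [in X in _ = _ - X -> _]eq_Rintegral do rewrite addrA.
by rewrite S S' mulrBr eB// eC.
Qed.

Lemma past_event_bigcap t (B_ : nat -> set T) : past_event t setT ->
  (forall n, past_event t (B_ n)) -> (forall n, B_ n.+1 `<=` B_ n) ->
  past_event t (\bigcap_n B_ n).
Proof.
move=> eT eB niB.
have -> : \bigcap_n B_ n = setT `\` \bigcup_n (setT `\` B_ n).
  by rewrite setTD setC_bigcup; apply: eq_bigcapr => n _; rewrite setTD setCK.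
apply: past_event_setD => //; apply: past_event_bigcup => n.
  exact: past_event_setD.
exact: setDS.
Qed.


Hypothesis rcX : forall w t, X s w @[s --> t^'+] --> X t w.
Hypothesis r0 : forall th, 0 <= r th.
Variable S : T -> \bar R.
Hypothesis S0 : forall w, (0 <= S w)%E.
Hypothesis pS : forall t, 0 <= t -> past_event t [set w | (S w < t%:E)%E].

Let G (th b t e : R) (w : T) : R :=
  let s := grid_up e (fine (S w)) in
  expR (- (t - s) * r th) * cos (th * X s w + b - (t - s) * m th).

Let mS t : 0 <= t -> measurable [set w | (S w < t%:E)%E].
Proof. by move=> t0; case: (pS t0). Qed.

(** Induction on the number of grid cells. On the cell e k <= S < e (k + 1) the rounded time is the
    constant e (k + 1). The cell is a difference of two events of the form S < s and belongs to the
    past of that constant, so the identity for deterministic times applies on it. *)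
Let optional_grid_up (th b t e : R) (n k : nat) : 0 < th -> 0 < e -> t = e * n%:R -> (k <= n)%N ->
  measurable_fun [set w | (S w < (e * k%:R)%:E)%E] (G th b t e) /\
  \int[P]_(w in [set w | (S w < (e * k%:R)%:E)%E]) cos (th * X t w + b) =
  \int[P]_(w in [set w | (S w < (e * k%:R)%:E)%E]) G th b t e w.
Proof.
move=> th0 e0 te; elim: k => [|k IH] kn.
  rewrite mulr0 (_ : [set w | _] = set0); last first.
    by apply/seteqP; split=> w //=; rewrite ltNge S0.
  by split; [exact: measurable_fun_set0|rewrite !Rintegral_set0].
have [mG IHE] := IH (ltnW kn).
have ek0 j : 0 <= e * j%:R by rewrite mulr_ge0// ltW.
set A := [set w | (S w < (e * k%:R)%:E)%E].
set B := [set w | (S w < (e * k.+1%:R)%:E)%E].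
have AB : A `<=` B.
  by move=> w /= /lt_trans; apply; rewrite lte_fin ltr_pM2l// ltr_nat.
have mA : measurable A by exact: mS.
have mB : measurable B by exact: mS.
have pD : past_event (e * k.+1%:R) (B `\` A).
  apply: past_event_setD => //; last exact: pS.
  by apply: (@past_eventS (e * k%:R)); rewrite ?ler_pM2l ?ler_nat//; exact: pS.
have mD : measurable (B `\` A) by case: pD.
have GE w : (B `\` A) w -> G th b t e w = expR (- (t - e * k.+1%:R) * r th) *
     cos (th * X (e * k.+1%:R) w + (b - (t - e * k.+1%:R) * m th)).
  move=> [/= Bw /negP]; rewrite -leNgt => Aw.
  have Sf : S w = (fine (S w))%:E.
    by rewrite fineK// ge0_fin_numE//; apply: lt_trans Bw _; rewrite ltry.
  have Aw' : e * k%:R <= fine (S w) by rewrite -lee_fin -Sf.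
  have Bw' : fine (S w) < e * k.+1%:R by rewrite -lte_fin -Sf.
  by rewrite /G (grid_up_eq e0 Aw' Bw') addrA.
have mGD : measurable_fun (B `\` A) (G th b t e).
  apply: (eq_measurable_fun (fun w => expR (- (t - e * k.+1%:R) * r th) *
     cos (th * X (e * k.+1%:R) w + (b - (t - e * k.+1%:R) * m th)))).
    by move=> w /set_mem Dw; rewrite GE.
  by apply: measurable_funM => //; exact: measurable_cosX.
have BE : B = A `|` (B `\` A) by rewrite setDUK.
have dAB : [disjoint A & B `\` A] by apply/disj_setPS => w [Aw []].
have mGB : measurable_fun B (G th b t e) by rewrite BE; exact/measurable_funU.
split=> //; rewrite BE Rintegral_setU//; last by rewrite -BE; exact: integrable_cosX.
rewrite Rintegral_setU//; last first.
  rewrite -BE; apply: (@bounded_integrable _ _ _ _ _ _ 1) => // w /= Bw.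
  rewrite normrM -[leRHS]mulr1 ler_pM// ?norm_cos_le1//.
  rewrite ger0_norm ?expR_ge0// expR_le1 mulNr oppr_le0 mulr_ge0// subr_ge0 te.
  apply: grid_up_lec => //; first exact: fine_ge0.
  have Sf : S w = (fine (S w))%:E.
    by rewrite fineK// ge0_fin_numE//; apply: lt_trans Bw _; rewrite ltry.
  have Bw' : fine (S w) < e * k.+1%:R by rewrite -lte_fin -Sf.
  by apply: lt_le_trans Bw' _; rewrite ler_pM2l// ler_nat.
congr (_ + _); first exact: IHE.
rewrite pD.2//; last by rewrite te ler_pM2l// ler_nat.
rewrite -RintegralZl//; last first.
  under eq_fun do rewrite -addrA; exact: integrable_cosX.
by apply: eq_Rintegral => w /set_mem Dw; rewrite GE// addrA.
Qed.

Let H (th b t : R) (w : T) : R :=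
  expR (- (t - fine (S w)) * r th) * cos (th * X (fine (S w)) w + b - (t - fine (S w)) * m th).

Let strong_markov_lt th b t : 0 < th -> 0 <= t ->
  measurable_fun [set w | (S w < t%:E)%E] (H th b t) /\
  \int[P]_(w in [set w | (S w < t%:E)%E]) cos (th * X t w + b) =
  \int[P]_(w in [set w | (S w < t%:E)%E]) H th b t w.
Proof.
move=> th0; rewrite le_eqVlt => /predU1P[<-|t0].
  rewrite (_ : [set w | _] = set0); last first.
    by apply/seteqP; split=> w //=; rewrite ltNge S0.
  by split; [exact: measurable_fun_set0|rewrite !Rintegral_set0].
set D := [set w | _].
(* The mesh divides t, so a time below t is never rounded beyond t and the damping factor stays at
   most 1. *)
pose e_ n : R := t / n.+1%:R.
have e0 n : 0 < e_ n by rewrite divr_gt0.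
have ce : e_ @ \oo --> 0.
  rewrite /e_ -[X in _ --> X](mulr0 t); apply: cvgMr.
  exact: cvg_harmonic.
have te n : t = e_ n * n.+1%:R by rewrite /e_ divfK.
have K n := optional_grid_up b th0 (e0 n) (te n) (leqnn _).
have DE n : [set w | (S w < (e_ n * n.+1%:R)%:E)%E] = D by rewrite -te.
have mD : measurable D by exact/mS/ltW.
have cG w : D w -> G th b t (e_ n) w @[n --> \oo] --> H th b t w.
  move=> Dw; have Sw0 : 0 <= fine (S w) by exact: fine_ge0.
  have c1 := grid_up_cvg Sw0 e0 ce.
  have c2 : X (grid_up (e_ n) (fine (S w))) w @[n --> \oo] --> X (fine (S w)) w.
    have c3 := grid_up_cvg_right Sw0 e0 ce.
    have c4 := @rcX w (fine (S w)).
    move=> U /c4 U1; exact: (c3 _ U1).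
  rewrite /G /H; apply: cvgM.
    apply: continuous_cvg; first exact: continuous_expR.
    by apply: cvgMl; apply: cvgN; apply: cvgB => //; exact: cvg_cst.
  apply: continuous_cvg; first exact: continuous_cos.
  apply: cvgB; last by apply: cvgMl; apply: cvgB => //; exact: cvg_cst.
  by apply: cvgD; [exact: cvgMr|exact: cvg_cst].
have mG n : measurable_fun D (G th b t (e_ n)) by rewrite -(DE n); case: (K n).
have mH : measurable_fun D (H th b t) by apply: (measurable_fun_cvg mG).
split=> //.
have c1 : \int[P]_(w in D) G th b t (e_ n) w @[n --> \oo] --> \int[P]_(w in D) H th b t w.
  apply: (@Rdominated_cvg _ _ _ P D _ _ (cst 1)) => //.
    exact: finite_measure_integrable_cst.
  move=> n w /= Dw.
  rewrite normrM -[leRHS]mulr1 ler_pM// ?norm_cos_le1//.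
  rewrite ger0_norm ?expR_ge0// expR_le1 mulNr oppr_le0 mulr_ge0// subr_ge0 [leRHS](te n).
  apply: grid_up_lec => //; first exact: fine_ge0.
  have Sf : S w = (fine (S w))%:E.
    by rewrite fineK// ge0_fin_numE//; apply: lt_trans Dw _; rewrite ltry.
  by rewrite -te -lte_fin -Sf.
apply/esym/(cvg_unique (@Rhausdorff R) c1).
apply: cvg_near_cst; apply: nearW => n.
by have [_] := K n; rewrite DE => ->.
Qed.

(** The event S = t is added separately: optional times give access to S < t, while killing at S
    leads to S <= t. On S = t the two integrands coincide. *)
Lemma strong_markov th b t : 0 < th -> 0 <= t -> measurable [set w | S w = t%:E] ->
  \int[P]_(w in [set w | (S w <= t%:E)%E]) cos (th * X t w + b) =
  \int[P]_(w in [set w | (S w <= t%:E)%E]) (expR (- (t - fine (S w)) * r th) *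
    cos (th * X (fine (S w)) w + b - (t - fine (S w)) * m th)).
Proof.
move=> th0 t0 mE.
have [mH EH] := strong_markov_lt b th0 t0.
have -> : [set w | (S w <= t%:E)%E] = [set w | (S w < t%:E)%E] `|` [set w | S w = t%:E].
  apply/seteqP; split=> w /=; first by rewrite le_eqVlt => /predU1P[|]; [right|left].
  by move=> [/ltW//|->].
have dj : [disjoint [set w | (S w < t%:E)%E] & [set w | S w = t%:E]].
  by apply/disj_setPS => w [/= Slt Sw]; rewrite Sw ltxx in Slt.
have mL := mS t0.
have HE w : S w = t%:E -> H th b t w = cos (th * X t w + b).
  by rewrite /H => -> /=; rewrite subrr oppr0 !mul0r expR0 mul1r subr0.
rewrite Rintegral_setU//; last by apply: integrable_cosX; exact: measurableU.
rewrite Rintegral_setU//; last first.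
  apply: (@bounded_integrable _ _ _ _ _ _ 1) => //; first exact: measurableU.
    apply/measurable_funU => //; split=> //.
    apply: (eq_measurable_fun (fun w => cos (th * X t w + b))).
      by move=> w /set_mem /= Sw; rewrite -HE.
    exact: measurable_cosX.
  move=> w St; rewrite normrM -[leRHS]mulr1 ler_pM// ?norm_cos_le1//.
  rewrite ger0_norm ?expR_ge0// expR_le1 mulNr oppr_le0 mulr_ge0// subr_ge0.
  by case: St => [/= Sw|/= ->//]; rewrite -lee_fin fineK ?(ltW Sw)// ge0_fin_numE// (lt_trans Sw)// ltry.
congr (_ + _) => //.
by apply: eq_Rintegral => w /set_mem /= Sw; rewrite -HE.
Qed.

End optional.

Lemma integrable_cstM d (T : measurableType d) (R : realType) (mu : {measure set T -> \bar R})
  (D : set T) (k : R) (f : T -> R) : measurable D ->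
  mu.-integrable D (EFin \o f) -> mu.-integrable D (EFin \o (fun x => k * f x)).
Proof. by move=> mD /(integrableZl mD k). Qed.

(** * Measures with a density and the exponential time *)

Section density.
Context {d} {T : measurableType d} {R : realType}.
Variables (mu nu : {measure set T -> \bar R}) (p : T -> R).
Hypotheses (p0 : forall x, 0 <= p x) (mp : measurable_fun setT p).
Hypothesis nuE : forall A, measurable A -> nu A = (\int[mu]_(x in A) (p x)%:E)%E.
Import HBNNSimple.

Let indicE E : measurable E ->
  (\int[nu]_x (\1_E x)%:E = \int[mu]_x ((\1_E x)%:E * (p x)%:E))%E.
Proof.
move=> mE; rewrite integral_indic// setIT nuE// integral_mkcond.
apply: eq_integral => x _; rewrite patchE indicE.
by case: ifP => xE; rewrite ?mul1e ?mul0e.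
Qed.

Let nnsfunE (f : {nnsfun T >-> R}) :
  (\int[nu]_x (f x)%:E = \int[mu]_x ((f x)%:E * (p x)%:E))%E.
Proof.
under [LHS]eq_integral do rewrite fimfunE -fsumEFin//.
rewrite [LHS]ge0_integral_fsum//; last 2 first.
  - by move=> r; exact/measurable_EFinP/measurableT_comp.
  - by move=> n x _; rewrite EFinM nnfun_muleindic_ge0.
under [RHS]eq_integral.
  move=> x xD; rewrite muleC fimfunE -fsumEFin// ge0_mule_fsumr; last first.
    by move=> r; rewrite EFinM nnfun_muleindic_ge0.
  over.
rewrite [RHS]ge0_integral_fsum//; last 2 first.
  - move=> r; apply: emeasurable_funM; first exact/measurable_EFinP.
    by apply/measurable_EFinP; do 2 apply/measurableT_comp => //.
  - move=> n x _; rewrite EFinM mule_ge0//; last by rewrite nnfun_muleindic_ge0.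
    by rewrite lee_fin.
apply: eq_fsbigr => r _.
have [r0|r0] := leP 0 r; last first.
  rewrite preimage_nnfun0//.
  by rewrite !integral0_eq// => x _; rewrite indic0 !(mulr0, mule0).
rewrite integralZl_indic_nnsfun// indicE// -ge0_integralZl//; last 2 first.
- by apply: emeasurable_funM; apply/measurable_EFinP => //.
- by move=> x _; rewrite mule_ge0// lee_fin.
by apply: eq_integral => x _; rewrite EFinM muleA muleC.
Qed.

Lemma ge0_integral_density (f : T -> \bar R) :
  measurable_fun setT f -> (forall x, 0 <= f x)%E ->
  (\int[nu]_x f x = \int[mu]_x (f x * (p x)%:E))%E.
Proof.
move=> mf f0.
pose f_ := nnsfun_approx measurableT mf.
transitivity (lim (\int[nu]_x (f_ n x)%:E @[n --> \oo])%E).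
  rewrite -monotone_convergence//=.
  - apply: eq_integral => ? /[!inE] xD; apply/esym/cvg_lim => //=.
    exact: cvg_nnsfun_approx.
  - by move=> n; exact/measurable_EFinP/measurable_funTS.
  - by move=> n ? _; rewrite lee_fin.
  - by move=> ? _ ? ? mn; rewrite lee_fin; exact/lefP/nd_nnsfun_approx.
transitivity (lim (\int[mu]_x ((f_ n x)%:E * (p x)%:E) @[n --> \oo])%E).
  by apply: congr_lim; apply/funext => n; exact: nnsfunE.
rewrite -monotone_convergence//=.
- apply: eq_integral => x _; apply/cvg_lim => //.
  by apply: cvgeZr => //; exact: cvg_nnsfun_approx.
- by move=> n; apply: emeasurable_funM; apply/measurable_EFinP => //; exact/measurable_funTS.
- by move=> n x _; rewrite -EFinM lee_fin mulr_ge0.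
- by move=> x _ i j ij; rewrite -!EFinM lee_fin ler_wpM2r//; exact/lefP/nd_nnsfun_approx.
Qed.
End density.

Section exp_time.
Context {R : realType}.
Notation mu := (@lebesgue_measure R).

Definition exp_law (q : R) (q0 : 0 < q) : probability (measurableTypeR R) R :=
  exponential_distribution_exponential_prob__canonical__probability_measure_Probability q0.

Lemma ge0_integral_exp_law (q : R) (q0 : 0 < q) (f : R -> \bar R) :
  measurable_fun setT f -> (forall x, 0 <= f x)%E ->
  (\int[exp_law q0]_x f x = \int[mu]_(x in `[0%R, +oo[) (f x * (q * expR (- q * x))%:E))%E.
Proof.
move=> mf f0.
rewrite (@ge0_integral_density _ _ _ mu (exp_law q0) (exponential_pdf q))//; last 2 first.
- by move=> x; rewrite exponential_pdf_ge0// ltW.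
- exact: measurable_exponential_pdf.
rewrite [RHS]integral_mkcond; apply: eq_integral => x _.
rewrite patchE /exponential_pdf patchE; case: ifP => //.
by rewrite mule0.
Qed.

Lemma Rintegral_exp_law (q : R) (q0 : 0 < q) (f : R -> R) (K : R) :
  measurable_fun setT f -> (forall x, `|f x| <= K) ->
  \int[exp_law q0]_x f x = \int[mu]_(x in `[0%R, +oo[) (q * expR (- q * x) * f x).
Proof.
move=> mf fK.
have mexp : measurable_fun setT (fun x : R => q * expR (- q * x)).
  by apply: measurable_funM => //; apply: measurableT_comp => //.
have ie : mu.-integrable `[0, +oo[ (EFin \o (fun x => q * expR (- q * x))).
  by apply: integrable_cstM => //; exact: integrable_expR.
(* For nonnegative integrands this is the formula for extended reals. A bounded f is brought to this
   case by adding K, which contributes K to both sides because the exponential law has mass 1. *)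
have main (g : R -> R) M : measurable_fun setT g -> (forall x, 0 <= g x) -> (forall x, `|g x| <= M) ->
    \int[exp_law q0]_x g x = \int[mu]_(x in `[0%R, +oo[) (q * expR (- q * x) * g x).
  move=> mg g0 gM; rewrite /Rintegral ge0_integral_exp_law//; last exact/measurable_EFinP.
  by congr fine; apply: eq_integral => x _; rewrite -EFinM mulrC.
have K0 : 0 <= K by rewrite (le_trans _ (fK 0)).
have fKb x : `|f x + K| <= K + K by rewrite (le_trans (ler_normD _ _))// lerD// ger0_norm.
have E1 : \int[exp_law q0]_x (f x + K) = \int[exp_law q0]_x f x + K.
  rewrite RintegralD//; last 2 first.
  - exact: (@bounded_integrable _ _ _ _ _ _ K).
  - exact: finite_measure_integrable_cst.
  by rewrite Rintegral_cst// [X in fine X](@probability_setT _ _ _ (exp_law q0)) mulr1.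
have ib (g : R -> R) M : measurable_fun setT g -> (forall x, `|g x| <= M) ->
   mu.-integrable `[0, +oo[ (EFin \o (fun x => q * expR (- q * x) * g x)).
  move=> mg gM.
  apply: (@le_integrableR _ _ _ mu _ _ (fun x => M * (q * expR (- q * x)))) => //.
  - by apply: measurable_funTS; exact: measurable_funM.
  - move=> x _; rewrite normrM mulrC ler_pM//.
    by rewrite ger0_norm// mulr_ge0 ?expR_ge0// ltW.
  - exact: integrable_cstM.
have E2 : \int[mu]_(x in `[0%R, +oo[) (q * expR (- q * x) * (f x + K)) =
   \int[mu]_(x in `[0%R, +oo[) (q * expR (- q * x) * f x) + K.
  under eq_Rintegral do rewrite mulrDr.
  rewrite RintegralD//; last 2 first.
  - exact: (ib _ K).
  - by apply: (ib (cst K) K) => // x; rewrite /= ger0_norm.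
  congr (_ + _).
  rewrite -(main (cst K) K)//; last by move=> x /=; rewrite ger0_norm.
  by rewrite Rintegral_cst// [X in fine X](@probability_setT _ _ _ (exp_law q0)) mulr1.
apply: (addIr K); rewrite -E1 -E2; apply: (main _ (K + K)) => //.
- exact: measurable_funD.
- by move=> x; rewrite -lerBlDr sub0r lerNl (le_trans (ler_norm _))// normrN.
Qed.
End exp_time.

(** * Joint measurability and the strong Markov property at an exponential time *)

Section joint.
Context {d} {T : measurableType d} {R : realType}.
Variable X : R -> T -> R.
Hypothesis mX : forall t, measurable_fun setT (X t).
Hypothesis rcX : forall w t, X s w @[s --> t^'+] --> X t w.
Hypothesis X0 : forall t w, t <= 0 -> X t w = X 0 w.

(** Rounding the time up to a grid leaves countably many times, so the approximations are measurable
    cell by cell; right continuity identifies their limit. *)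
Lemma measurable_joint : measurable_fun setT (fun p : R * T => X p.1 p.2).
Proof.
pose h (n : nat) (p : R * T) := X (grid_up n.+1%:R^-1 p.1) p.2.
apply: (measurable_fun_cvg (h:=h)) => //.
  move=> n _ A mA; rewrite setTI.
  set e : R := n.+1%:R^-1.
  have -> : h n @^-1` A = \bigcup_(k in setT)
     ([set s : R | Num.truncn (s / e) = k] `*` (X (e * k.+1%:R) @^-1` A)).
    apply/seteqP; split=> [[s w] /= Asw|[s w] [k _ [/= sk]]].
      by exists (Num.truncn (s / e)).
    by rewrite /h /grid_up /= -/e sk.
  apply: bigcupT_measurable => k; apply: measurableX; last first.
    by rewrite -[X in measurable X]setTI; exact: mX.
  have -> : [set s : R | Num.truncn (s / e) = k] =
     [set s | s / e < k.+1%:R] `\` [set s | (Num.truncn (s / e) < k)%N].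
    apply/seteqP; split=> [s /= sk|s /= []]; rewrite -truncn_le_nat.
      by rewrite -sk leqnn ltnn.
    by move=> sk /negP; rewrite -leqNgt => ks; apply/eqP; rewrite eqn_leq sk.
  have mlt (c : R) : measurable [set s | s / e < c].
    have -> : [set s | s / e < c] = `]-oo, c * e[%classic.
      by apply/seteqP; split=> s /=; rewrite in_itv/= ltr_pdivrMr// invr_gt0.
    exact: measurable_itv.
  apply: measurableD => //; case: k => [|k].
    by rewrite (_ : [set _ | _] = set0)//; apply/seteqP; split.
  rewrite (_ : [set _ | _] = [set s | s / e < k.+1%:R])//.
  by apply/seteqP; split=> s /=; rewrite ltnS truncn_le_nat.
move=> [t w] _ /=; rewrite /h /=.
pose e_ n : R := n.+1%:R^-1.
have e0 n : 0 < e_ n by rewrite invr_gt0.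
have ce : e_ @ \oo --> 0 by exact: cvg_harmonic.
have [t0|t0] := leP 0 t.
  have c3 := grid_up_cvg_right t0 e0 ce.
  by move=> U /(@rcX w t) U1; exact: (c3 _ U1).
have t00 : 0 <= (0 : R) by [].
have c3 := grid_up_cvg_right t00 e0 ce.
rewrite (X0 _ (ltW t0)).
(* [truncn] is 0 on negative numbers, so for t < 0 the rounded times decrease to 0 and not to t;
   this is where constancy on negative times enters. *)
have E n : grid_up (e_ n) t = grid_up (e_ n) 0.
  rewrite /grid_up mul0r truncn0; congr (_ * _.+1%:R); apply/eqP.
  rewrite -leqn0 truncn_le_nat (@lt_le_trans _ _ 0)//.
  by rewrite pmulr_llt0// invr_gt0.
under eq_cvg do rewrite -/(e_ _) E.
by move=> U /(@rcX w 0) U1; exact: (c3 _ U1).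
Qed.
End joint.

Section optional_exp.
Context {d} {T : measurableType d} {R : realType}.
Variables (P : probability T R) (X : R -> T -> R) (r m : R -> R).
Hypothesis mX : forall t, measurable_fun setT (X t).
Hypothesis rcX : forall w t, X s w @[s --> t^'+] --> X t w.
Hypothesis X0 : forall t w, t <= 0 -> X t w = X 0 w.
Hypothesis r0 : forall th, 0 <= r th.

(* q times the q-resolvent of y |-> cos (th * y + b), at a point y where th * y + b = z *)
Definition resolvent_cos (q : R) (th z : R) : R :=
  q * ((q + r th) * cos z + m th * sin z) / ((q + r th) ^+ 2 + m th ^+ 2).

Variable S : T -> \bar R.
Hypothesis S0 : forall w, (0 <= S w)%E.
Hypothesis pS : forall t, 0 <= t -> past_event P X r m t [set w | (S w < t%:E)%E].

Lemma optional_measurable : measurable_fun setT S.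
Proof.
apply: (measurability _ (@ErealGenInftyO.measurableE R)) => _ [_ [t ->] <-].
rewrite setTI (_ : _ @^-1` _ = [set w | (S w < t%:E)%E]); last first.
  by apply/seteqP; split=> w /=; rewrite in_itv.
have [t0|t0] := leP 0 t; first by case: (pS t0).
rewrite (_ : [set _ | _] = set0)//; apply/seteqP; split=> w //= Sw.
have : (S w < 0%:E)%E by rewrite (lt_trans Sw)// lte_fin.
by rewrite ltNge S0.
Qed.

Lemma optional_value_measurable : measurable_fun setT (fun w => X (fine (S w)) w).
Proof.
apply: (measurableT_comp (measurable_joint mX rcX X0) (f:= fun p : R * T => X p.1 p.2)
    (g := fun w => (fine (S w), w))).
apply: measurable_fun_pair => //.
by apply: measurableT_comp; [exact: fine_measurable|exact: optional_measurable].
Qed.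

Let f (q th b t : R) (w : T) : R :=
  if (S w <= t%:E)%E then q * expR (- q * t) *
   (expR (- (t - fine (S w)) * r th) *
    cos (th * X (fine (S w)) w + b - (t - fine (S w)) * m th)) else 0.

Let mf q th b : measurable_fun setT (fun p : R * T => f q th b p.1 p.2).
Proof.
have mS2 : measurable_fun setT (fun p : R * T => S p.2).
  by apply: measurableT_comp => //; exact: optional_measurable.
have mfS2 : measurable_fun setT (fun p : R * T => fine (S p.2)).
  by apply: measurableT_comp => //; exact: fine_measurable.
have mX2 : measurable_fun setT (fun p : R * T => X (fine (S p.2)) p.2).
  apply: (measurableT_comp (measurable_joint mX rcX X0) (f:= fun p : R * T => X p.1 p.2)
    (g := fun p : R * T => (fine (S p.2), p.2))).
  by apply: measurable_fun_pair.
have mcos := @measurable_cos R.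
apply: measurable_fun_ifT => //.
  by apply: measurable_fun_lee => //; apply/measurable_EFinP.
apply: measurable_funM.
  by apply: measurable_funM => //; apply: measurableT_comp => //; exact: measurable_funM.
apply: measurable_funM.
  apply: measurableT_comp => //; apply: measurable_funM => //; apply: measurableT_comp => //.
  exact: measurable_funB.
apply: (measurableT_comp mcos).
apply: measurable_funB; last by apply: measurable_funM => //; exact: measurable_funB.
by apply: measurable_funD => //; exact: measurable_funM.
Qed.

Let f_le q th b t w : 0 < q -> `|f q th b t w| <= q * expR (- q * t) * 1.
Proof.
move=> q0; rewrite /f; case: ifPn => [St|_]; last first.
  by rewrite normr0 mulr1 mulr_ge0 ?expR_ge0// ltW.
have qe : 0 <= q * expR (- q * t) by rewrite mulr_ge0 ?expR_ge0// ltW.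
rewrite normrM ger0_norm// ler_wpM2l//.
rewrite normrM -[leRHS]mulr1 ler_pM// ?norm_cos_le1//.
rewrite ger0_norm ?expR_ge0// expR_le1 mulNr oppr_le0 mulr_ge0// subr_ge0.
by rewrite -lee_fin fineK// ge0_fin_numE// (le_lt_trans St)// ltry.
Qed.

Notation mu := (@lebesgue_measure R).

(** Here s stands for the optional time and z for th times the value there plus the phase. The rate
    q and the exponent merge into a Laplace integral at q + r, and e^(-qs) is left over from
    starting at s. *)
Lemma integral_optional_slice (q th s z : R) : 0 < q -> 0 <= s ->
  \int[mu]_(t in `[s, +oo[) (q * expR (- q * t) *
     (expR (- (t - s) * r th) * cos (z - (t - s) * m th))) =
  expR (- q * s) * resolvent_cos q th z.
Proof.
move=> q0 s0.
have a0 : 0 < q + r th by rewrite ltr_wpDr.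
transitivity (\int[mu]_(t in `[s, +oo[) (q * expR (s * r th) *
     (expR (- (q + r th) * t) * cos (- m th * t + (z + s * m th))))).
  apply: eq_Rintegral => t _.
  have -> : z - (t - s) * m th = - m th * t + (z + s * m th) by ring.
  have -> : expR (- (t - s) * r th) = expR (s * r th) * expR (- r th * t).
    by rewrite -expRD; congr expR; ring.
  have -> : - (q + r th) * t = - q * t + - r th * t by ring.
  by rewrite expRD; ring.
rewrite RintegralZl//; last first.
  apply: (@le_integrableR _ _ _ mu _ _ (fun t => expR (- (q + r th) * t))) => //.
  - apply: measurable_funTS; apply: measurable_funM.
      by apply: measurableT_comp => //; exact: measurable_funM.
    apply: measurableT_comp; first exact: measurable_cos.
    by apply: measurable_funD => //; exact: measurable_funM.
  - move=> t _; rewrite normrM ger0_norm ?expR_ge0//.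
    by rewrite ler_piMr ?expR_ge0// norm_cos_le1.
  - apply: integrableS (integrable_expR a0) => //.
    by move=> x/=; rewrite !in_itv/= !andbT; exact: le_trans.
rewrite integral_expR_cos//.
have -> : - m th * s + (z + s * m th) = z by ring.
have -> : expR (- (q + r th) * s) = expR (- q * s) / expR (s * r th).
  by rewrite -expRN -expRD; congr expR; ring.
rewrite /resolvent_cos sqrrN.
have := expR_gt0 (s * r th); set E := expR (s * r th) => E0.
have D0 : (q + r th) ^+ 2 + m th ^+ 2 != 0.
  by rewrite gt_eqF// ltr_wpDr ?sqr_ge0// exprn_gt0.
field.
by rewrite D0 gt_eqF.
Qed.

(** The strong Markov identity at each t is followed by Fubini: for fixed w the constraint S <= t
    becomes integration over t >= S w, which yields the resolvent at the value reached, discounted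
    by e^(-qS). Where S is infinite the slice is 0. *)
Lemma optional_resolvent (q th b : R) : 0 < q -> 0 < th ->
  \int[mu]_(t in `[0, +oo[) (q * expR (- q * t) *
    \int[P]_(w in [set w | (S w <= t%:E)%E]) cos (th * X t w + b)) =
  \int[P]_(w in [set w | (S w < +oo)%E])
    (expR (- q * fine (S w)) * resolvent_cos q th (th * X (fine (S w)) w + b)).
Proof.
move=> q0 th0.
have mSt t : measurable [set w | (S w <= t%:E)%E].
  rewrite -[X in measurable X]setTI.
  by apply: measurable_lee => //; exact: optional_measurable.
transitivity (\int[mu]_(t in `[0, +oo[) \int[P]_w f q th b t w).
  apply: eq_Rintegral => t; rewrite inE /= in_itv /= andbT => t0.
  rewrite (strong_markov mX rcX r0 S0 pS)//; last first.
    rewrite -[X in measurable X]setTI.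
    by apply: measurable_eqe => //; exact: optional_measurable.
  rewrite -RintegralZl//; last first.
    apply: (@bounded_integrable _ _ _ _ _ _ 1) => //.
      have mfS : measurable_fun setT (fun w => fine (S w)).
        by apply: measurableT_comp; [exact: fine_measurable|exact: optional_measurable].
      apply: measurable_funTS; apply: measurable_funM.
        apply: measurableT_comp => //; apply: measurable_funM => //; apply: measurableT_comp => //.
        exact: measurable_funB.
      apply: measurableT_comp; first exact: measurable_cos.
      apply: measurable_funB; last by apply: measurable_funM => //; exact: measurable_funB.
      apply: measurable_funD => //; apply: measurable_funM => //.
      exact: optional_value_measurable.
    move=> w /= St; rewrite normrM -[leRHS]mulr1 ler_pM// ?norm_cos_le1//.
    rewrite ger0_norm ?expR_ge0// expR_le1 mulNr oppr_le0 mulr_ge0// subr_ge0.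
    by rewrite -lee_fin fineK// ge0_fin_numE// (le_lt_trans St)// ltry.
  rewrite Rintegral_mkcond; apply: eq_Rintegral => w _.
  by rewrite /f patchE; case: ifPn => [/[!inE]/= ->//|]; rewrite notin_setE /= => /negP/negbTE ->.
rewrite (@Rfubini _ _ _ _ _ mu P _ setT _ (fun t => q * expR (- q * t)) (cst 1))//; last 4 first.
- by apply: measurable_funTS; exact: mf.
- by apply: integrable_cstM => //; exact: integrable_expR.
- exact: finite_measure_integrable_cst.
- by move=> t w _ _; exact: f_le.
rewrite [RHS]Rintegral_mkcond; apply: eq_Rintegral => w _.
rewrite patchE; case: ifPn => [/[!inE]/= Sw|].
  have Sf : S w = (fine (S w))%:E by rewrite fineK// ge0_fin_numE.
  have Sw0 : 0 <= fine (S w) by exact: fine_ge0.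
  rewrite -integral_optional_slice//.
  have -> : `[fine (S w), +oo[%classic = `[0, +oo[ `&` `[fine (S w), +oo[%classic.
    rewrite setIidr// => x /=; rewrite !in_itv/= !andbT; exact: le_trans.
  rewrite Rintegral_mkcondr; apply: eq_Rintegral => t _.
  rewrite patchE.
  have -> : (t \in `[fine (S w), +oo[%classic) = (fine (S w) <= t).
    by apply/idP/idP; rewrite inE /= in_itv /= andbT.
  by rewrite /f {1}Sf lee_fin.
rewrite notin_setE /= => /negP; rewrite -leNgt leye_eq => /eqP Sy.
transitivity (\int[mu]_(t in `[0, +oo[) (0 : R)); last by rewrite Rintegral_cst ?mul0r.
by apply: eq_Rintegral => t _; rewrite /f Sy.
Qed.

End optional_exp.

(** * From independent increments to events of the past *)

Section indep_past.
Context {d} {T : measurableType d} {R : realType}.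
Variables (P : probability T R) (X : R -> T -> R) (r m : R -> R).
Hypothesis mX : forall t, measurable_fun setT (X t).
Hypothesis cf_cos : forall s t th, 0 < th -> 0 <= s -> s <= t ->
  \int[P]_w cos (th * (X t w - X s w)) = expR (- (t - s) * r th) * cos ((t - s) * m th).
Hypothesis cf_sin : forall s t th, 0 < th -> 0 <= s -> s <= t ->
  \int[P]_w sin (th * (X t w - X s w)) = - (expR (- (t - s) * r th) * sin ((t - s) * m th)).

Variables (G : set (set T)) (t : R).
Hypothesis t0 : 0 <= t.
Hypotheses (GI : setI_closed G) (GT : G setT) (Gm : G `<=` measurable).
Hypothesis GX : forall A, measurable A -> <<s G >> (X t @^-1` A).
Hypothesis Gindep : forall t' A C, t <= t' -> G A -> measurable C ->
  P (A `&` [set w | C (X t' w - X t w)]) = (P A * P [set w | C (X t' w - X t w)%R])%E.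

Let mZ t' : measurable_fun setT (fun w => X t' w - X t w).
Proof. exact: measurable_funB. Qed.

Let mZC t' C : measurable C -> measurable [set w | C (X t' w - X t w)].
Proof. by move=> mC; rewrite -[X in measurable X]setTI; exact: mZ. Qed.

(** With Z the event about the increment, the probability of E and Z together, and P Z times P E,
    are finite measures in E that agree on [G]. As [G] is stable under intersection and contains the
    whole space, they agree on the generated sigma-algebra. *)
Let sG_indep t' E C : t <= t' -> <<s G >> E -> measurable C ->
  P (E `&` [set w | C (X t' w - X t w)]) = (P E * P [set w | C (X t' w - X t w)%R])%E.
Proof.
move=> tt' sE mC.
set Z := [set w | _].
have mZ' : measurable Z by exact: mZC.
have p0 : 0 <= fine (P Z) by rewrite fine_ge0.
pose m1 : {measure set T -> \bar R} := mrestr P mZ'.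
pose m2 : {measure set T -> \bar R} := mscale (NngNum p0) P.
have fP : P Z = (fine (P Z))%:E by rewrite fineK// fin_num_measure.
have := @g_sigma_algebra_measure_unique _ R T G Gm (fun=> setT) (fun=> GT) _ m1 m2 GI _ _ E sE.
rewrite /= /mrestr /mscale /= muleC -fP; apply.
- by apply/seteqP; split=> // w _; exists 0%N.
- by move=> A GA; rewrite Gindep// muleC.
- by move=> _; rewrite setTI (le_lt_trans (probability_le1 _ _))// ltry.
Qed.

(** The pair formed by the indicator of E and X t is independent of the increment after t, so the
    pair can be frozen while a cosine of the increment is averaged. The addition formulas bring in
    the two parts of the characteristic function and fold them back into one cosine with shifted
    phase. *)
Lemma indep_past_event E : <<s G >> E -> past_event P X r m t E.
Proof.
move=> sE.
have mE : measurable E by apply: (smallest_sub _ Gm) sE; exact: sigma_algebra_measurable.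
split=> // th b t' th0 tt'.
pose V := fun w => (\1_E w : R, X t w).
have mV : measurable_fun setT V.
  by apply: measurable_fun_pair => //; exact: measurable_indic.
pose Vf : {mfun T >-> (R * R)%type} := mfun_Sub (mem_set mV).
pose Zf : {mfun T >-> R} := mfun_Sub (mem_set (mZ t')).
have mVG : @measurable_fun _ _ (g_sigma_algebraType G) (R * R)%type setT V.
  apply: measurable_fun_pair.
    by apply: measurable_indic.
  by move=> _ A mA; rewrite setTI; exact: GX.
(* indep_Rintegral requires a bounded integrand *)
pose clip (x : R) := Num.max 0 (Num.min x 1).
pose h' (v : R * R) (z : R) := clip v.1 * cos (th * v.2 + th * z + b).
have clipE w : clip (\1_E w) = \1_E w.
  by rewrite /clip indicE; case: (_ \in _); rewrite ?minxx ?(max_idPr ler01)// /Num.min ltr01 maxxx.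
have mclip : measurable_fun setT clip.
  by apply: measurable_maxr => //; exact: measurable_minr.
have clip01 x : 0 <= clip x <= 1.
  by rewrite /clip le_max lexx/= ge_max ler01 ge_min lexx orbT.
have mcos := @measurable_cos R.
have E0 : \int[P]_w h' (Vf w) (Zf w) = \int[P]_w \int[P]_w' h' (Vf w) (Zf w').
  apply: (@indep_Rintegral _ _ _ _ _ _ _ P Vf Zf h' 1).
  - move=> A C mA mC; apply: sG_indep => //.
    by have := mVG measurableT A mA; rewrite setTI.
  - apply: measurable_funM.
      by apply: measurableT_comp => //; exact: measurableT_comp.
    apply: measurableT_comp => //; apply: measurable_funD => //.
    apply: measurable_funD; apply: measurable_funM => //.
    exact: measurableT_comp.
  - move=> v z; rewrite normrM -[leRHS]mulr1 ler_pM// ?norm_cos_le1//.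
    by have /andP[? ?] := clip01 v.1; rewrite ger0_norm.
have inner w : \int[P]_w' h' (Vf w) (Zf w') = \1_E w * (expR (- (t' - t) * r th) *
     cos (th * X t w + b - (t' - t) * m th)).
  rewrite /h' /=; under eq_Rintegral do rewrite clipE.
  rewrite RintegralZl//; last first.
    apply: (@bounded_integrable _ _ _ _ _ _ 1) => // [|w' _]; last exact: norm_cos_le1.
    apply: measurableT_comp => //; apply: measurable_funD => //.
    by apply: measurable_funD => //; exact: measurable_funM.
  congr (_ * _).
  transitivity (\int[P]_w' (cos (th * X t w + b) * cos (th * (X t' w' - X t w')) -
                    sin (th * X t w + b) * sin (th * (X t' w' - X t w')))).
    by apply: eq_Rintegral => w' _; rewrite -cosD; congr cos; ring.
  have ic : P.-integrable setT (EFin \o (fun w' => cos (th * (X t' w' - X t w')))).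
    apply: (@bounded_integrable _ _ _ _ _ _ 1) => // [|w' _]; last exact: norm_cos_le1.
    by apply: measurableT_comp => //; exact: measurable_funM.
  have is_ : P.-integrable setT (EFin \o (fun w' => sin (th * (X t' w' - X t w')))).
    apply: (@bounded_integrable _ _ _ _ _ _ 1) => // [|w' _]; last first.
      by rewrite ler_norml sin_geN1 sin_le1.
    apply: measurableT_comp; first exact: measurable_sin.
    exact: measurable_funM.
  rewrite RintegralB//; [|exact: integrable_cstM|exact: integrable_cstM].
  rewrite !RintegralZl// cf_cos// cf_sin// cosB.
  ring.
have E1 : \int[P]_w (\1_E w * cos (th * X t w + th * (X t' w - X t w) + b)) =
   \int[P]_w (\1_E w * (expR (- (t' - t) * r th) * cos (th * X t w + b - (t' - t) * m th))).
  transitivity (\int[P]_w h' (Vf w) (Zf w)).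
    by apply: eq_Rintegral => w _; rewrite /h' /= clipE.
  by rewrite E0; apply: eq_Rintegral => w _; rewrite inner.
transitivity (\int[P]_w (\1_E w * cos (th * X t w + th * (X t' w - X t w) + b))).
  rewrite Rintegral_mkcond; apply: eq_Rintegral => w _; rewrite patchE indicE.
  case: ifP => _; last by rewrite mul0r.
  by rewrite mul1r; congr cos; ring.
rewrite E1 -RintegralZl//; last first.
  by under eq_fun do rewrite -addrA; exact: integrable_cosX.
rewrite [RHS]Rintegral_mkcond; apply: eq_Rintegral => w _; rewrite patchE indicE.
by case: ifP => _; rewrite ?mul1r ?mul0r.
Qed.
End indep_past.

(** * The process on a finite time grid *)

Section hit_grid.
Context {d} {T : measurableType d} {R : realType}.
Variables (P : probability T R) (a rho : R) (Y : R -> T -> R).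
Hypothesis HY : is_stable_process P a rho Y.
Variable x : R.

(* the process issued from x, extended by its initial value to negative times *)
Definition shifted (t : R) (w : T) : R := x + Y (Num.max 0 t) w.
(** With [psi_im], the exponent r + i m. The sign of th in front of the imaginary part is left out,
    which is correct for the positive frequencies to which the argument keeps. *)
Definition psi_re (th : R) : R := `|th| `^ a * cos (stable_c a rho).
Definition psi_im (th : R) : R := `|th| `^ a * sin (stable_c a rho).

Let Y00 w : Y 0 w = 0. Proof. by case: HY. Qed.
Let mY t : 0 <= t -> measurable_fun setT (Y t).
Proof. by have [_ mY _ _ _] := HY; exact: mY. Qed.

Lemma shifted0 w : shifted 0 w = x.
Proof. by rewrite /shifted maxxx Y00 addr0. Qed.

Lemma shifted_ge0 t w : 0 <= t -> shifted t w = x + Y t w.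
Proof. by move=> t0; rewrite /shifted (max_idPr t0). Qed.

Lemma measurable_shifted t : measurable_fun setT (shifted t).
Proof. by apply: measurable_funD => //; apply: mY; rewrite le_max lexx. Qed.

Lemma shifted_const t w : t <= 0 -> shifted t w = shifted 0 w.
Proof. by move=> t0; rewrite /shifted (max_idPl t0) maxxx. Qed.

Lemma shifted_rc w t : shifted s w @[s --> t^'+] --> shifted t w.
Proof.
have [_ _ [rc _] _ _] := HY.
have [t0|t0] := leP 0 t.
  rewrite shifted_ge0//; apply: cvg_trans (cvgD (cvg_cst x) (rc w t t0)).
  apply: near_eq_cvg; near=> s; rewrite shifted_ge0//.
  by rewrite (le_trans t0).
rewrite (shifted_const _ (ltW t0)).
apply: cvg_near_cst; near=> s; apply: shifted_const.
by near: s; apply: nbhs_right_le.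
Unshelve. all: by end_near. Qed.

Lemma shifted_cf s t th : 0 < th -> 0 <= s -> s <= t ->
  \int[P]_w cos (th * (shifted t w - shifted s w)) = expR (- (t - s) * psi_re th) * cos ((t - s) * psi_im th) /\
  \int[P]_w sin (th * (shifted t w - shifted s w)) = - (expR (- (t - s) * psi_re th) * sin ((t - s) * psi_im th)).
Proof.
move=> th0 s0 st; have [_ _ _ _ cf] := HY.
have [cfc cfs] := cf s t th s0 st.
have E w : shifted t w - shifted s w = Y t w - Y s w.
  by rewrite !shifted_ge0// ?(le_trans s0 st)//; ring.
under eq_Rintegral do rewrite E.
under [in X in _ /\ X]eq_Rintegral do rewrite E.
rewrite cfc cfs /stable_cf_re /stable_cf_im /psi_re /psi_im (gtr0_sg th0) !mulr1 !mulrA.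
by [].
Qed.

Variables (t : R) (N : nat).
Hypothesis t0 : 0 <= t.

(** The grid of [0, t] with N steps, continued by the constant t'. The increment of index N runs
    from t to t', and those of smaller index describe the past. *)
Let tt t' i : R := if (i <= N)%N then t * i%:R / N%:R else t'.
Let B_ev (B : nat -> set R) := \bigcap_(i in `I_N) [set w | B i (Y (t * i.+1%:R / N%:R) w - Y (t * i%:R / N%:R) w)].
Let G := [set A | exists B : nat -> set R, (forall i, measurable (B i)) /\ A = B_ev B].

Let tN0 i : 0 <= t * i%:R / N%:R. Proof. by rewrite !mulr_ge0// invr_ge0. Qed.

Let mIncr i C : measurable C -> measurable [set w | C (Y (t * i.+1%:R / N%:R) w - Y (t * i%:R / N%:R) w)].
Proof.
by move=> mC; rewrite -[X in measurable X]setTI; apply: measurable_funB => //; exact: mY.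
Qed.

Let Gm : G `<=` measurable.
Proof.
move=> A [B [mB ->]]; apply: bigcap_measurableType => i _; exact: mIncr.
Qed.

Let GI : setI_closed G.
Proof.
move=> A A' [B [mB ->]] [B' [mB' ->]]; exists (fun i => B i `&` B' i); split.
  by move=> i; exact: measurableI.
rewrite /B_ev -bigcapI; apply: eq_bigcapr => i _.
by apply/seteqP; split.
Qed.

Let GT : G setT.
Proof.
by exists (fun=> setT); split=> //; rewrite /B_ev; apply/seteqP; split.
Qed.

Let G_incr i C : (i < N)%N -> measurable C -> G [set w | C (Y (t * i.+1%:R / N%:R) w - Y (t * i%:R / N%:R) w)].
Proof.
move=> iN mC; exists (fun j => if j == i then C else setT); split.
  by move=> j; case: ifP.
apply/seteqP; split=> w /=.
  by move=> Cw j _ /=; case: ifP => // /eqP ->.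
by move=> /(_ i iN) /=; rewrite eqxx.
Qed.

(** A value at a grid time is x plus the preceding increments, each measurable for the sigma-algebra
    generated by [G]. *)
Let G_value i A : (i <= N)%N -> measurable A -> <<s G >> (shifted (t * i%:R / N%:R) @^-1` A).
Proof.
have H j : (j <= N)%N -> @measurable_fun _ _ (g_sigma_algebraType G) R setT (shifted (t * j%:R / N%:R)).
  elim: j => [|j IH] jN.
    have -> : shifted (t * 0%:R / N%:R) = cst x.
      by apply/funext => w; rewrite mulr0 mul0r shifted0.
    exact: measurable_cst.
  have -> : shifted (t * j.+1%:R / N%:R) = (fun w => shifted (t * j%:R / N%:R) w +
      (Y (t * j.+1%:R / N%:R) w - Y (t * j%:R / N%:R) w)).
    by apply/funext => w; rewrite !shifted_ge0//; ring.
  apply: measurable_funD; first by apply: IH; exact: ltnW.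
  by move=> _ C mC; rewrite setTI; apply: sub_sigma_algebra; exact: G_incr.
move=> iN mA; have := H i iN measurableT A mA.
by rewrite setTI.
Qed.

Hypothesis N0 : (0 < N)%N.

Let tNN : t * N%:R / N%:R = t.
Proof. by rewrite -mulrA divff ?mulr1// pnatr_eq0 -lt0n. Qed.

(** The product formula is applied twice, to the first N increments and to these together with the
    one from t to t'; the two products differ by the last factor. *)
Let Gindep t' A C : t <= t' -> G A -> measurable C ->
  P (A `&` [set w | C (shifted t' w - shifted t w)]) = (P A * P [set w | C (shifted t' w - shifted t w)%R])%E.
Proof.
move=> tt' [B [mB ->]] mC.
have [_ _ _ ind _] := HY.
pose B' i := if (i < N)%N then B i else C.
have mB' i : measurable (B' i) by rewrite /B'; case: ifP.
have tt0 : 0 <= tt t' 0 by rewrite /tt leq0n.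
have ttS i : tt t' i <= tt t' i.+1.
  rewrite /tt; case: ifPn => [iN|].
    case: ifPn => [_|].
      by rewrite ler_pM2r ?invr_gt0 ?ltr0n// ler_wpM2l// ler_nat.
    rewrite -ltnNge ltnS => Ni; rewrite (_ : i = N) ?tNN//.
    by apply/eqP; rewrite eqn_leq iN.
  by rewrite -ltnNge => Ni; rewrite leqNgt ltnS (ltnW Ni).
have E1 := ind N (tt t') B' tt0 ttS mB'.
have E2 := ind N.+1 (tt t') B' tt0 ttS mB'.
have e1 : \bigcap_(i in `I_N) [set w | B' i (Y (tt t' i.+1) w - Y (tt t' i) w)] = B_ev B.
  apply: eq_bigcapr => i /= iN; rewrite /B' /tt iN (ltnW iN)//.
have eC : [set w | C (shifted t' w - shifted t w)] = [set w | B' N (Y (tt t' N.+1) w - Y (tt t' N) w)].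
  rewrite /B' ltnn /tt ltnn leqnn tNN; apply/seteqP; split=> w /=;
    by rewrite !shifted_ge0// ?(le_trans t0 tt')// opprD addrACA subrr add0r.
have e2 : \bigcap_(i in `I_N.+1) [set w | B' i (Y (tt t' i.+1) w - Y (tt t' i) w)] =
  B_ev B `&` [set w | C (shifted t' w - shifted t w)].
  rewrite eC -e1; apply/seteqP; split=> w /=.
    move=> H; split; last by apply: H => /=; rewrite ltnS.
    by move=> i /= iN; apply: H => /=; exact: (ltn_trans iN).
  move=> [H1 H2] i /=; rewrite ltnS leq_eqVlt => /predU1P[->//|iN]; exact: H1.
by rewrite -e2 E2 big_ord_recr/= -E1 e1 -eC.
Qed.

Lemma past_event_grid e : 0 < e ->
  past_event P shifted psi_re psi_im t
    [set w | exists2 j, (j < N)%N & `|shifted (t * j%:R / N%:R) w| < e].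
Proof.
move=> e0.
apply: (@indep_past_event _ _ _ P shifted psi_re psi_im measurable_shifted _ _ G t) => //.
- by move=> s t' th th0 s0 st; have [] := shifted_cf th0 s0 st.
- by move=> s t' th th0 s0 st; have [] := shifted_cf th0 s0 st.
- by move=> A mA; have := G_value (leqnn N) mA; rewrite tNN.
have -> : [set w | exists2 j, (j < N)%N & `|shifted (t * j%:R / N%:R) w| < e] =
   \bigcup_(j in `I_N) (shifted (t * j%:R / N%:R) @^-1` `]-e, e[).
  by apply/seteqP; split=> w [j jN H]; exists j => //; move: H; rewrite /= ?in_itv /= ltr_norml.
apply: (@fin_bigcup_measurable _ (g_sigma_algebraType G)) => // j /= jN.
by apply: G_value => //; exact: ltnW.
Qed.

End hit_grid.

(** * Hitting times *)

Section hitting.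
Context {d} {T : measurableType d} {R : realType}.
Variables (P : probability T R) (a rho : R) (Y : R -> T -> R).
Hypothesis HY : is_stable_process P a rho Y.
Variable x : R.
Notation X := (shifted Y x).
Notation r := (psi_re a rho).
Notation m := (psi_im a rho).

(** The ball is open: by right continuity a visit lasts for a short while, so a fine enough grid
    sees it. At the infimum itself the path may lie on the boundary. *)
Definition hit_ball (e : R) (w : T) : \bar R :=
  ereal_inf [set s%:E | s in [set s | 0 <= s /\ `|X s w| < e]].

Lemma hit_ball_ge0 e w : (0 <= hit_ball e w)%E.
Proof. by apply: le_ereal_inf_tmp => _ [s [s0 _] <-]; rewrite lee_fin. Qed.

Lemma hit_ball_lt e w t : (hit_ball e w < t%:E)%E <-> exists s, [/\ 0 <= s, s < t & `|X s w| < e].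
Proof.
split=> [/ereal_inf_lt[_ [s [s0 Xs] <-]]|[s [s0 st Xs]]].
  by rewrite lte_fin => st; exists s.
by apply: (@le_lt_trans _ _ s%:E); [apply: ereal_inf_lbound; exists s|rewrite lte_fin].
Qed.

Lemma hit_ball_le e w s : 0 <= s -> `|X s w| < e -> (hit_ball e w <= s%:E)%E.
Proof. by move=> s0 Xs; apply: ereal_inf_lbound; exists s. Qed.

Lemma le_hit_ball e e' w : e <= e' -> (hit_ball e' w <= hit_ball e w)%E.
Proof.
move=> ee'; apply: ereal_inf_le_tmp => _ [s [s0 Xs] <-]; exists s => //; split=> //.
exact: lt_le_trans ee'.
Qed.

Lemma right_nbhs_le w s c : (forall e, 0 < e -> exists u, [/\ s <= u, u < s + e & `|X u w| < c]) ->
  `|X s w| <= c.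
Proof.
move=> H; rewrite leNgt; apply/negP => cX.
have /cvg_norm c1 := @shifted_rc _ _ _ _ _ _ _ HY x w s.
have : \forall u \near s^'+, c < `|X u w| by apply: (cvgr_gt _ c1).
move=> [e /= e0 He].
have [u [su ue Xu]] := H _ e0.
move: su; rewrite le_eqVlt => /predU1P[E|su].
  by move: (lt_trans Xu cX); rewrite E ltxx.
have := He u; rewrite /ball /= ltr0_norm ?subr_lt0// opprB ltrBlDl => /(_ ue su) cu.
by have := lt_trans Xu cu; rewrite ltxx.
Qed.

Lemma hit_ball_value e w : (hit_ball e w < +oo)%E -> `|X (fine (hit_ball e w)) w| <= e.
Proof.
move=> hy; have hf : hit_ball e w = (fine (hit_ball e w))%:E.
  by rewrite fineK// ge0_fin_numE// hit_ball_ge0.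
apply: right_nbhs_le => c c0.
have : (hit_ball e w < (fine (hit_ball e w) + c)%:E)%E by rewrite {1}hf lte_fin ltrDl.
move=> /hit_ball_lt[s [s0 sc Xs]]; exists s; split=> //.
by rewrite -lee_fin -hf; exact: hit_ball_le.
Qed.

Lemma past_event_set0 t : past_event P X r m t set0.
Proof. by split=> // th b t' _ _; rewrite !Rintegral_set0 mulr0. Qed.

Lemma past_event_setT t : 0 <= t -> past_event P X r m t setT.
Proof.
move=> t0; have := @past_event_grid _ _ _ P a rho Y HY x t 1 t0 isT (`|x| + 1).
rewrite (_ : [set w | _] = setT); first by apply; rewrite ltr_wpDl.
apply/seteqP; split=> // w _; exists 0%N => //.
by rewrite mulr0 mul0r (shifted0 HY) ltrDl.
Qed.

Lemma hit_ball_past e t : 0 < e -> 0 <= t -> past_event P X r m t [set w | (hit_ball e w < t%:E)%E].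
Proof.
move=> e0; rewrite le_eqVlt => /predU1P[<-|t0].
  rewrite (_ : [set _ | _] = set0); first exact: past_event_set0.
  by apply/seteqP; split=> w //=; rewrite ltNge hit_ball_ge0.
pose A n := [set w | exists2 j, (j < 2 ^ n)%N & `|X (t * j%:R / (2 ^ n)%:R) w| < e].
have -> : [set w | (hit_ball e w < t%:E)%E] = \bigcup_n A n.
  apply/seteqP; split=> w.
    move=> /hit_ball_lt[s [s0 st Xs]].
    have /cvg_norm c1 := @shifted_rc _ _ _ _ _ _ _ HY x w s.
    have [c /= c0 Hc] : \forall u \near s^'+, `|X u w| < e by apply: (cvgr_lt _ c1).
    (* The mesh must be smaller than c, so that the grid point following s falls where the path is
       still in the ball, and smaller than t - s, so that this point precedes t. *)
    have [n Hn] : exists n, t / (2 ^ n)%:R < Num.min c (t - s).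
      have m0 : 0 < Num.min c (t - s) by rewrite lt_min c0 subr_gt0.
      pose k := Num.truncn (t / Num.min c (t - s)).
      exists k.+1; rewrite ltr_pdivrMr ?ltr0n ?expn_gt0// mulrC -ltr_pdivrMr//.
      rewrite (lt_le_trans (truncnS_gt _))// ler_nat.
      by rewrite -/k (ltn_trans (ltn_expl k (leqnn 2)))// ltn_exp2l.
    move: Hn; rewrite lt_min => /andP[nc nt].
    set h := t / (2 ^ n)%:R in nc nt.
    have h0 : 0 < h by rewrite divr_gt0// ltr0n expn_gt0.
    have u1 := grid_up_gt s h0.
    have u2 := grid_up_le h0 s0.
    exists n => //; exists (Num.truncn (s / h)).+1.
      rewrite -(@ltr_nat R) -(ltr_pM2l h0) -/(grid_up h s) (le_lt_trans u2)//.
      rewrite /h -mulrA mulVf ?mulr1 ?gt_eqF ?ltr0n ?expn_gt0// -/h.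
      by move: nt; rewrite -/h ltrBrDl.
    rewrite (_ : t * _ / _ = grid_up h s); last by rewrite /grid_up /h mulrAC.
    apply: Hc => //; rewrite /ball /= ltr0_norm ?subr_lt0// opprB ltrBlDl.
    by rewrite (le_lt_trans u2)// ltrD2l.
  move=> [n _ [j jn Xj]]; apply/hit_ball_lt.
  exists (t * j%:R / (2 ^ n)%:R); split=> //.
    by rewrite !mulr_ge0 ?invr_ge0// ltW.
  by rewrite ltr_pdivrMr ?ltr0n ?expn_gt0// ltr_pM2l// ltr_nat.
apply: (past_event_bigcup (measurable_shifted HY x)) => n.
  by apply: past_event_grid => //; [exact: ltW|rewrite expn_gt0].
(* The grids are dyadic so that the events increase: point j of one grid is point 2j of the next. *)
move=> w [j jn Xj]; exists (2 * j)%N; first by rewrite expnS ltn_pmul2l.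
rewrite expnS !natrM (_ : t * _ / _ = t * j%:R / (2 ^ n)%:R)//.
have := @ltr0n R (2 ^ n); rewrite expn_gt0 /= => n0.
field.
by rewrite gt_eqF.
Qed.

(* Unlike hit0, this is optional by construction; the two agree almost surely (hit0_ae). *)
Definition hit_zero (w : T) : \bar R := ereal_sup (range (fun n : nat => hit_ball n.+1%:R^-1 w)).

Lemma hit_zero_ge n w : (hit_ball n.+1%:R^-1 w <= hit_zero w)%E.
Proof. by apply: ereal_sup_ubound; exists n. Qed.

Lemma hit_zero_ge0 w : (0 <= hit_zero w)%E.
Proof. exact: le_trans (hit_ball_ge0 _ _) (hit_zero_ge 0 w). Qed.

Lemma hit_ball_nd w : {homo (fun n => hit_ball n.+1%:R^-1 w) : n k / (n <= k)%N >-> (n <= k)%E}.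
Proof. by move=> n k nk; apply: le_hit_ball; rewrite lef_pV2 ?posrE// ler_nat. Qed.

Lemma hit_ball_cvg w : hit_ball n.+1%:R^-1 w @[n --> \oo] --> hit_zero w.
Proof. exact/ereal_nondecreasing_cvgn/hit_ball_nd. Qed.

Lemma hit_zero_past t : 0 <= t -> past_event P X r m t [set w | (hit_zero w < t%:E)%E].
Proof.
rewrite le_eqVlt => /predU1P[<-|t0].
  rewrite (_ : [set _ | _] = set0); first exact: past_event_set0.
  by apply/seteqP; split=> w //=; rewrite ltNge hit_zero_ge0.
(* These times increase to t strictly from below. A supremum of times below t can equal t, so all
   hitting times are required to lie below one common [s k]; this writes the event as a countable
   union of decreasing intersections. *)
pose s k : R := t * (k%:R / k.+1%:R).
have s0 k : 0 <= s k by rewrite !mulr_ge0// ?invr_ge0// ltW.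
have st k : s k < t by rewrite /s gtr_pMr// ltr_pdivrMr// mul1r ltr_nat.
have ss k : s k <= s k.+1.
  rewrite /s ler_pM2l// ler_pdivrMr// mulrAC ler_pdivlMr// -!natrM ler_nat.
  by rewrite (_ : k.+1 * k.+1 = (k * k.+2).+1)%N//; ring.
have mX := measurable_shifted HY x.
have -> : [set w | (hit_zero w < t%:E)%E] =
    \bigcup_k \bigcap_n [set w | (hit_ball n.+1%:R^-1 w < (s k)%:E)%E].
  apply/seteqP; split=> w /=.
    move=> Tt; have Tf : hit_zero w = (fine (hit_zero w))%:E.
      by rewrite fineK// ge0_fin_numE ?hit_zero_ge0// (lt_trans Tt)// ltry.
    have fT : fine (hit_zero w) < t by rewrite -lte_fin -Tf.
    have [k Hk] : exists k, fine (hit_zero w) < s k.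
      have d0 : 0 < t - fine (hit_zero w) by rewrite subr_gt0.
      pose k := Num.truncn (t / (t - fine (hit_zero w))).
      exists k; rewrite /s (_ : k%:R / k.+1%:R = 1 - k.+1%:R^-1); last first.
        by rewrite -[X in X - _](@divff _ (k.+1%:R : R))// -[X in _ - X]mul1r -mulrBl -natr1 addrK.
      rewrite mulrBr mulr1 ltrBrDl -ltrBrDr ltr_pdivrMr// mulrC -ltr_pdivrMr//.
      exact: truncnS_gt.
    exists k => // n _ /=; apply: le_lt_trans (hit_zero_ge n w) _.
    by rewrite Tf lte_fin.
  move=> [k _ H]; apply: (@le_lt_trans _ _ (s k)%:E); last by rewrite lte_fin.
  by apply: ge_ereal_sup => _ [n _ <-]; apply: ltW; exact: (H n I).
apply: (past_event_bigcup mX) => k.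
  apply: (past_eventS (ltW (st k))); apply: (past_event_bigcap mX).
  - exact: past_event_setT.
  - by move=> n; apply: hit_ball_past => //; rewrite invr_gt0.
  - move=> n w /=; apply: le_lt_trans; exact: hit_ball_nd.
move=> w H n _ /=; apply: lt_le_trans (H n I) _; by rewrite lee_fin.
Qed.

Lemma hit0_ge w : (hit_zero w <= hit0 Y x w)%E.
Proof.
apply: le_ereal_inf_tmp => _ [t [t0 Xt] <-]; apply: ge_ereal_sup => _ [n _ <-].
apply: hit_ball_le; first exact: ltW.
by rewrite shifted_ge0 ?(ltW t0)// Xt normr0 invr_gt0.
Qed.

Lemma hit0E w : x != 0 -> ((hit_zero w < +oo)%E -> X (fine (hit_zero w)) w = 0) ->
  hit0 Y x w = hit_zero w.
Proof.
move=> x0 H; apply/eqP; rewrite eq_le hit0_ge andbT.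
have [Ty|] := ltP (hit_zero w) +oo%E; last by rewrite leye_eq => /eqP ->; exact: leey.
have XT := H Ty.
have Tf : hit_zero w = (fine (hit_zero w))%:E by rewrite fineK// ge0_fin_numE// hit_zero_ge0.
have T0 : 0 <= fine (hit_zero w) by rewrite fine_ge0// hit_zero_ge0.
(* [hit0] admits only t > 0; time 0 is excluded because the path starts at x, which is nonzero. *)
rewrite Tf; apply: ereal_inf_lbound; exists (fine (hit_zero w)) => //; split.
  rewrite lt_neqAle T0 andbT; apply/negP => /eqP E.
  by move: XT; rewrite -E (shifted0 HY) => /eqP; rewrite (negbTE x0).
by rewrite -shifted_ge0.
Qed.

End hitting.

(** * Discount factors and the resolvent of a cosine *)

Section discount.
Context {R : realType}.

(** The test gives the value 0 at infinity; [fine] sends infinity to 0 and would give the discount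
    1. *)
Definition exp_discount (q : R) (s : \bar R) : R :=
  if (s < +oo)%E then expR (- q * fine s) else 0.

Lemma exp_discount_ge0 q s : 0 <= exp_discount q s.
Proof. by rewrite /exp_discount; case: ifP => // _; exact: expR_ge0. Qed.

Lemma exp_discount_le1 q s : 0 <= q -> (0 <= s)%E -> exp_discount q s <= 1.
Proof.
move=> q0 s0; rewrite /exp_discount; case: ifP => // _.
by rewrite expR_le1 mulNr oppr_le0 mulr_ge0// fine_ge0.
Qed.

Lemma exp_discount_cvg (q : R) (u : nat -> \bar R) (l : \bar R) : 0 < q ->
  (forall n, 0 <= u n)%E -> (forall n, u n <= l)%E -> u @ \oo --> l ->
  exp_discount q (u n) @[n --> \oo] --> exp_discount q l.
Proof.
move=> q0 u0 ul cu.
have l0 : (0 <= l)%E by exact: le_trans (u0 0%N) (ul 0%N).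
have [ly|] := ltP l +oo%E; last first.
  rewrite leye_eq => /eqP ly; rewrite ly {2}/exp_discount ltxx.
  apply/cvgr0Pnorm_lt => e e0.
  pose A := - ln e / q + 1.
  rewrite ly in cu; move/cvgeyPgt : cu => /(_ A).
  apply: filterS => n An.
  rewrite ger0_norm ?exp_discount_ge0// /exp_discount; case: ifP => // uy.
  rewrite -[ltRHS](lnK (_ : e \in Num.pos))// ltr_expR.
  have uf : u n = (fine (u n))%:E by rewrite fineK// ge0_fin_numE.
  have : A < fine (u n) by rewrite -lte_fin -uf.
  rewrite /A => H; have : - ln e / q < fine (u n) by rewrite (lt_trans _ H)// ltrDl.
  by rewrite ltr_pdivrMr// mulNr ltrNl mulrC.
have lf : l = (fine l)%:E by rewrite fineK// ge0_fin_numE.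
rewrite lf in cu; move/fine_cvgP : cu => [_ cu].
have E n : exp_discount q (u n) = expR (- q * fine (u n)).
  by rewrite /exp_discount (le_lt_trans (ul n) ly).
under eq_cvg do rewrite E.
rewrite /exp_discount ly; apply: continuous_cvg; first exact: continuous_expR.
exact: cvgMr.
Qed.
End discount.

Section resolvent_cos.
Context {R : realType}.
Variables (r m : R -> R).
Hypothesis r0 : forall th, 0 <= r th.

Lemma resolvent_cos_bound q th z : 0 < q ->
  `|resolvent_cos r m q th z| <= q * (q + r th + `|m th|) / ((q + r th) ^+ 2 + m th ^+ 2).
Proof.
move=> q0; have D0 : 0 < (q + r th) ^+ 2 + m th ^+ 2.
  by rewrite ltr_wpDr ?sqr_ge0// exprn_gt0// ltr_wpDr.
have qr : 0 <= q + r th by rewrite addr_ge0// ltW.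
rewrite /resolvent_cos normrM normfV (gtr0_norm D0) ler_pM2r ?invr_gt0//.
rewrite normrM gtr0_norm// ler_pM2l// (le_trans (ler_normD _ _))// !normrM (ger0_norm qr) lerD//.
  by rewrite ler_piMr// norm_cos_le1.
by rewrite ler_piMr// ler_norml sin_geN1 sin_le1.
Qed.

Lemma continuous_resolvent_cos q th : continuous (resolvent_cos r m q th).
Proof.
move=> z; rewrite /resolvent_cos; apply: cvgMl; apply: cvgMr; apply: cvgD; apply: cvgMr.
  exact: continuous_cos.
exact: continuous_sin.
Qed.

(** With W = q e^(iz) / (q + r + im), [resolvent_cos] is Re W at z and Re (iW) at z + pi/2. The
    identity is the real part of (q + r + im) W = q e^(iz). *)
Lemma resolvent_cos_shift q th z : 0 < q ->
  (q + r th) * resolvent_cos r m q th z + m th * resolvent_cos r m q th (z + pi / 2) = q * cos z.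
Proof.
move=> q0; have D0 : 0 < (q + r th) ^+ 2 + m th ^+ 2.
  by rewrite ltr_wpDr ?sqr_ge0// exprn_gt0// ltr_wpDr.
rewrite /resolvent_cos cosD sinD cos_pihalf sin_pihalf.
by field; rewrite gt_eqF.
Qed.

End resolvent_cos.

Section optional_slice.
Context {d} {T : measurableType d} {R : realType}.
Variables (P : probability T R) (X : R -> T -> R).
Hypothesis mX : forall t, measurable_fun setT (X t).
Hypothesis rcX : forall w t, X s w @[s --> t^'+] --> X t w.
Hypothesis X0 : forall t w, t <= 0 -> X t w = X 0 w.
Variable S : T -> \bar R.
Hypothesis mS : measurable_fun setT S.

Lemma measurable_optional_slice (th b : R) :
  measurable_fun setT (fun t : R => \int[P]_(w in [set w | (S w <= t%:E)%E]) cos (th * X t w + b)).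
Proof.
pose f (t : R) (w : T) : R := if (S w <= t%:E)%E then cos (th * X t w + b) else 0.
have mf : measurable_fun setT (fun p : R * T => f p.1 p.2).
  apply: measurable_fun_ifT => //.
    apply: measurable_fun_lee; last exact/measurable_EFinP.
    exact: measurableT_comp.
  apply: measurableT_comp; first exact: measurable_cos.
  apply: measurable_funD => //; apply: measurable_funM => //.
  exact: measurable_joint.
have : measurable_fun setT (fun t : R => \int[P]_w f t w).
  (* Only measurability in t is sought, so the measure on the line is arbitrary; a Dirac mass makes
     the constant bound integrable. *)
  apply: (@Rfubini_measurable _ _ _ _ _ (\d_ (0 : R)) P setT setT f (cst 1) (cst 1)) => //.
  - by rewrite setXTT.
  - exact: finite_measure_integrable_cst.
  - exact: finite_measure_integrable_cst.
  - move=> t w _ _; rewrite mulr1 /f; case: ifP => _; last by rewrite normr0.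
    exact: norm_cos_le1.
apply: eq_measurable_fun => t _.
rewrite [RHS]Rintegral_mkcond; apply: eq_Rintegral => w _.
by rewrite /f patchE; case: ifPn => [H|/negP H]; [rewrite mem_set|rewrite memNset].
Qed.

Lemma optional_slice_le1 (th b t : R) :
  `|\int[P]_(w in [set w | (S w <= t%:E)%E]) cos (th * X t w + b)| <= 1.
Proof.
have mSt : measurable [set w | (S w <= t%:E)%E].
  by rewrite -[X in measurable X]setTI; apply: measurable_lee.
apply: (le_trans (le_normr_Rintegral _ _)) => //; first exact: integrable_cosX.
apply: (@le_trans _ _ (\int[P]_(w in [set w | (S w <= t%:E)%E]) 1)).
  apply: le_Rintegral => //.
  - by apply: integrable_norm; exact: integrable_cosX.
  - exact: finite_measure_integrable_cst.
  - by move=> w _; exact: norm_cos_le1.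
rewrite Rintegral_cst// mul1r -lee_fin fineK ?fin_num_measure//.
exact: probability_le1.
Qed.

End optional_slice.

(** * The value at the limit of the hitting times *)

Section zero_hit.
Context {d} {T : measurableType d} {R : realType}.
Variables (P : probability T R) (a rho : R) (Y : R -> T -> R).
Hypothesis HY : is_stable_process P a rho Y.
Hypothesis cosc : 0 <= cos (stable_c a rho).
Variable x : R.
Notation X := (shifted Y x).
Notation r := (psi_re a rho).
Notation m := (psi_im a rho).
Notation mu := (@lebesgue_measure R).
Notation L := (resolvent_cos r m).
Notation Tn := (fun n : nat => hit_ball Y x n.+1%:R^-1).
Notation T0 := (hit_zero Y x).

Lemma psi_re_ge0 th : 0 <= r th.
Proof. by rewrite mulr_ge0// powR_ge0. Qed.

Let mX := measurable_shifted HY x.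
Let rcX w t : X s w @[s --> t^'+] --> X t w. Proof. exact: (@shifted_rc _ _ _ _ _ _ _ HY). Qed.
Let Xneg t w : t <= 0 -> X t w = X 0 w. Proof. exact: shifted_const. Qed.

Let Tn0 n w : (0 <= Tn n w)%E. Proof. exact: hit_ball_ge0. Qed.
Let Tn_past n t : 0 <= t -> past_event P X r m t [set w | (Tn n w < t%:E)%E].
Proof. by move=> t0; apply: (hit_ball_past HY) => //; rewrite invr_gt0. Qed.

Lemma measurable_hit_ball n : measurable_fun setT (Tn n).
Proof. exact: optional_measurable (Tn0 n) (Tn_past n). Qed.

Lemma measurable_hit_zero : measurable_fun setT T0.
Proof. exact: optional_measurable (hit_zero_ge0 _ _) (hit_zero_past HY x). Qed.

Lemma optional_resolvent_discount (S : T -> \bar R) q th b : 0 < q -> 0 < th ->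
  (forall w, 0 <= S w)%E -> (forall t, 0 <= t -> past_event P X r m t [set w | (S w < t%:E)%E]) ->
  \int[mu]_(t in `[0, +oo[) (q * expR (- q * t) *
    \int[P]_(w in [set w | (S w <= t%:E)%E]) cos (th * X t w + b)) =
  \int[P]_w (exp_discount q (S w) * L q th (th * X (fine (S w)) w + b)).
Proof.
move=> q0 th0 S0 pS.
rewrite (optional_resolvent mX rcX Xneg psi_re_ge0 S0 pS)// Rintegral_mkcond.
apply: eq_Rintegral => w _; rewrite patchE /exp_discount.
by case: ifPn => [/[!inE]/= ->//|]; rewrite notin_setE/= => /negP/negbTE ->; rewrite mul0r.
Qed.

Lemma measurable_discount_value (S : T -> \bar R) q th b : measurable_fun setT S ->
  measurable_fun setT (fun w => exp_discount q (S w) * L q th (th * X (fine (S w)) w + b)).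
Proof.
move=> mS.
have mfS : measurable_fun setT (fun w => fine (S w)).
  by apply: measurableT_comp => //; exact: fine_measurable.
apply: measurable_funM.
  apply: measurable_fun_ifT => //.
    by apply: measurable_fun_lte => //; exact: measurable_cst.
  by apply: measurableT_comp => //; exact: measurable_funM.
apply: measurableT_comp.
  by apply: continuous_measurable_fun; exact: continuous_resolvent_cos.
apply: measurable_funD => //; apply: measurable_funM => //.
apply: (measurableT_comp (measurable_joint mX rcX Xneg) (f:= fun p : R * T => X p.1 p.2)
    (g := fun w => (fine (S w), w))).
exact: measurable_fun_pair.
Qed.

Lemma measurable_exp_discount (S : T -> \bar R) q : measurable_fun setT S ->
  measurable_fun setT (fun w => exp_discount q (S w)).
Proof.
move=> mS; apply: measurable_fun_ifT => //.
  by apply: measurable_fun_lte => //; exact: measurable_cst.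
apply: measurableT_comp => //; apply: measurable_funM => //.
by apply: measurableT_comp => //; exact: fine_measurable.
Qed.

Definition hit_zero_laplace (q : R) : R := \int[P]_w exp_discount q (T0 w).

(** At the n-th hitting time the path is within 1/(n+1) of 0, so the argument of [resolvent_cos]
    tends to b whatever the path does at the limit time. Where the limit time is infinite the
    discount tends to 0, and the bound K controls the other factor. *)
Lemma hit_ball_resolvent_cvg q th b : 0 < q -> 0 < th ->
  \int[P]_w (exp_discount q (Tn n w) * L q th (th * X (fine (Tn n w)) w + b)) @[n --> \oo] -->
  hit_zero_laplace q * L q th b.
Proof.
move=> q0 th0.
set K := q * (q + r th + `|m th|) / ((q + r th) ^+ 2 + m th ^+ 2).
have LK z : `|L q th z| <= K by exact: resolvent_cos_bound psi_re_ge0 _ _ _ q0.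
rewrite /hit_zero_laplace -RintegralZr//; last first.
  apply: (@bounded_integrable _ _ _ _ _ _ 1) => //.
    exact/measurable_exp_discount/measurable_hit_zero.
  move=> w _; rewrite ger0_norm ?exp_discount_ge0// exp_discount_le1 ?(ltW q0)//.
  exact: hit_zero_ge0.
apply: (@Rdominated_cvg _ _ _ P setT _ _ (cst K)) => //.
- by move=> n; apply: measurable_discount_value; exact: measurable_hit_ball.
- move=> w _.
  have ce : exp_discount q (Tn n w) @[n --> \oo] --> exp_discount q (T0 w).
    apply: exp_discount_cvg => //; [by move=> n; exact: hit_zero_ge|exact: hit_ball_cvg].
  have [Ty|] := ltP (T0 w) +oo%E; last first.
    rewrite leye_eq => /eqP Ty.
    have e0 : exp_discount q (T0 w) = 0 by rewrite /exp_discount Ty ltxx.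
    rewrite e0 mul0r; rewrite e0 in ce.
    apply/cvgr0Pnorm_lt => e ep.
    have K0 : 0 <= K by rewrite (le_trans _ (LK 0)).
    have eK : 0 < e / (K + 1) by rewrite divr_gt0// ltr_wpDl.
    move/cvgr0Pnorm_lt : ce => /(_ _ eK); apply: filterS => n He.
    rewrite normrM (@le_lt_trans _ _ (`|exp_discount q (Tn n w)| * (K + 1)))//.
      by rewrite ler_wpM2l// (le_trans (LK _))// lerDl.
    by rewrite -ltr_pdivlMr// ltr_wpDl.
  apply: cvgM => //.
  apply: continuous_cvg; first exact: continuous_resolvent_cos.
  rewrite -[X in _ --> X]add0r; apply: cvgD; last exact: cvg_cst.
  rewrite -[X in _ --> X](mulr0 th); apply: cvgMr.
  apply/cvgr0Pnorm_le => e e0.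
  near=> n.
  rewrite (le_trans (hit_ball_value HY _))//.
    by rewrite (le_lt_trans (hit_zero_ge _ _ _ _))//.
  rewrite invf_ple ?posrE// (@le_trans _ _ n%:R)// ?ler_nat//.
  by near: n; exact: nbhs_infty_ger.
- exact: finite_measure_integrable_cst.
- move=> n w _; rewrite normrM -[leRHS]mul1r ler_pM//.
  rewrite ger0_norm ?exp_discount_ge0// exp_discount_le1 ?(ltW q0)//.
Unshelve. all: by end_near. Qed.

(** The events [Tn n w <= t] decrease to [T0 w <= t], so the left sides for the balls converge as
    well. The outcome is the formula that a zero of the path at [T0] would give, reached before that
    zero is known. *)
Lemma hit_zero_resolvent q th b : 0 < q -> 0 < th ->
  \int[mu]_(t in `[0, +oo[) (q * expR (- q * t) *
    \int[P]_(w in [set w | (T0 w <= t%:E)%E]) cos (th * X t w + b)) =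
  hit_zero_laplace q * L q th b.
Proof.
move=> q0 th0.
have c2 := @hit_ball_resolvent_cvg q th b q0 th0.
have E n := optional_resolvent_discount b q0 th0 (Tn0 n) (Tn_past n).
rewrite (funext (fun n => esym (E n))) in c2.
apply/esym/(cvg_unique (@Rhausdorff R) c2).
apply: (@Rdominated_cvg _ _ _ mu _ _ _ (fun t => q * expR (- q * t))) => //.
- move=> n; apply: measurable_funTS; apply: measurable_funM.
    by apply: measurable_funM => //; apply: measurableT_comp => //.
  exact: (measurable_optional_slice P mX rcX Xneg (measurable_hit_ball n)).
- move=> t _; apply: cvgMr.
  apply: (@cvg_Rintegral_sets _ _ _ P _ _ _ 1).
  + by move=> n; rewrite -[X in measurable X]setTI; apply: measurable_lee => //; exact: measurable_hit_ball.
  + exact: measurable_cosX.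
  + by move=> w; exact: norm_cos_le1.
  + move=> w; have [Tt|tT] := leP (T0 w) t%:E.
      apply: nearW => n; apply/propext; split=> // _ /=.
      exact: le_trans (hit_zero_ge _ _ _ _) Tt.
    move: (tT) => /ereal_sup_gt[_ [N _ <-] tN].
    near=> n; apply/propext; split => /=; last by move=> /(lt_le_trans tT); rewrite ltxx.
    have Nn : (N <= n)%N by near: n; exists N.
    by move=> Tn_t; have := lt_le_trans tN (le_trans (hit_ball_nd Y x w Nn) Tn_t); rewrite ltxx.
- by apply: integrable_cstM => //; exact: integrable_expR.
- move=> n t _; rewrite normrM ger0_norm ?mulr_ge0 ?expR_ge0 ?(ltW q0)//.
  rewrite ler_piMr ?mulr_ge0 ?expR_ge0 ?(ltW q0)//.
  exact: (optional_slice_le1 P mX (measurable_hit_ball n)).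
Unshelve. all: by end_near. Qed.

(* resolvent_cos_shift recovers the cosine of X at hit_zero from its two resolvents. *)
Lemma hit_zero_value_cos th : 0 < th ->
  \int[P]_w (exp_discount 1 (T0 w) * (1 - cos (th * X (fine (T0 w)) w))) = 0.
Proof.
move=> th0.
have q0 : 0 < (1 : R) by [].
have E b : \int[P]_w (exp_discount 1 (T0 w) * L 1 th (th * X (fine (T0 w)) w + b)) =
    hit_zero_laplace 1 * L 1 th b.
  rewrite -hit_zero_resolvent//; apply/esym.
  by apply: optional_resolvent_discount => //; [exact: hit_zero_ge0|exact: (hit_zero_past HY x)].
set K := 1 * (1 + r th + `|m th|) / ((1 + r th) ^+ 2 + m th ^+ 2).
have LK z : `|L 1 th z| <= K by exact: resolvent_cos_bound psi_re_ge0 _ _ _ q0.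
have iL b : P.-integrable setT (EFin \o (fun w => exp_discount 1 (T0 w) * L 1 th (th * X (fine (T0 w)) w + b))).
  apply: (@bounded_integrable _ _ _ _ _ _ K) => //.
    exact/measurable_discount_value/measurable_hit_zero.
  move=> w _; rewrite normrM -[leRHS]mul1r ler_pM//.
  by rewrite ger0_norm ?exp_discount_ge0// exp_discount_le1// hit_zero_ge0.
have ie : P.-integrable setT (EFin \o (fun w => exp_discount 1 (T0 w))).
  apply: (@bounded_integrable _ _ _ _ _ _ 1) => //.
    exact/measurable_exp_discount/measurable_hit_zero.
  by move=> w _; rewrite ger0_norm ?exp_discount_ge0// exp_discount_le1// hit_zero_ge0.
transitivity (\int[P]_w (exp_discount 1 (T0 w) -
   ((1 + r th) * (exp_discount 1 (T0 w) * L 1 th (th * X (fine (T0 w)) w + 0)) +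
    m th * (exp_discount 1 (T0 w) * L 1 th (th * X (fine (T0 w)) w + pi / 2))))).
  apply: eq_Rintegral => w _.
  have := @resolvent_cos_shift _ r m psi_re_ge0 1 th (th * X (fine (T0 w)) w) q0.
  rewrite addr0 mul1r => H.
  by rewrite -H; ring.
have i1 := integrable_cstM (1 + r th) measurableT (iL 0).
have i2 := integrable_cstM (m th) measurableT (iL (pi / 2)).
rewrite RintegralB//; last first.
  have := integrableD measurableT i1 i2.
  by apply: eq_integrable.
rewrite RintegralD// !RintegralZl// !E.
have := @resolvent_cos_shift _ r m psi_re_ge0 1 th 0 q0.
rewrite add0r cos0 /hit_zero_laplace => H.
set phi := Rintegral _ _ _.
transitivity (phi * (1 - ((1 + r th) * L 1 th 0 + m th * L 1 th (pi / 2)))); first by ring.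
by rewrite H mulr1 subrr mulr0.
Qed.

(** The frequencies 2^(-n) are countably many, so one null set serves them all. The value z then
    satisfies cos (2^(-n) z) = 1 for every n; once |z| < 2^n the angle has absolute value in
    [0, pi], where the cosine is injective, and z = 0. *)
Lemma hit_zero_value : {ae P, forall w, (T0 w < +oo)%E -> X (fine (T0 w)) w = 0}.
Proof.
have H n : {ae P, forall w, exp_discount 1 (T0 w) * (1 - cos (2^-1 ^+ n * X (fine (T0 w)) w)) = 0}.
  pose f w := exp_discount 1 (T0 w) * (1 - cos (2^-1 ^+ n * X (fine (T0 w)) w)).
  have f0 w : 0 <= f w by rewrite mulr_ge0 ?exp_discount_ge0// subr_ge0 cos_le1.
  have mf : measurable_fun setT f.
    apply: measurable_funM; first exact/measurable_exp_discount/measurable_hit_zero.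
    apply: measurable_funB => //; apply: measurableT_comp.
      exact: measurable_cos.
    apply: measurable_funM => //.
    exact: (optional_value_measurable mX rcX Xneg (hit_zero_ge0 _ _) (hit_zero_past HY x)).
  have fi : P.-integrable setT (EFin \o f).
    apply: (@bounded_integrable _ _ _ _ _ _ 2) => // w _.
    rewrite ger0_norm// -[leRHS]mul1r ler_pM ?exp_discount_ge0 ?subr_ge0 ?cos_le1//.
      by rewrite exp_discount_le1// hit_zero_ge0.
    by rewrite lerBlDl -lerBlDr (le_trans _ (cos_geN1 _))//; lra.
  have i0 : (\int[P]_w `|(f w)%:E| = 0)%E.
    under eq_integral do rewrite gee0_abs ?lee_fin//.
    rewrite -[LHS]fineK; last by apply: integrable_fin_num.
    by congr EFin; exact: hit_zero_value_cos.
  have /ae_eq_integral_abs : measurable_fun setT (EFin \o f) by exact/measurable_EFinP.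
  move=> /(_ P measurableT) [/(_ i0) ae _].
  by move: ae; apply: filterS => w /(_ I) [].
have : {ae P, forall w n, exp_discount 1 (T0 w) * (1 - cos (2^-1 ^+ n * X (fine (T0 w)) w)) = 0}.
  exact/ae_foralln.
apply: filterS => w Hw Ty.
set z := X _ _ in Hw *.
have cz n : cos (2^-1 ^+ n * z) = 1.
  have := Hw n; rewrite /exp_discount Ty => /eqP; rewrite mulf_eq0 gt_eqF ?expR_gt0//=.
  by rewrite subr_eq0 => /eqP.
have [n Hn] : exists n, `|z| < 2 ^+ n.
  exists (Num.truncn `|z|).+1; rewrite (lt_le_trans (truncnS_gt _))//.
  by rewrite -natrX ler_nat ltnW// ltn_expl.
have zn : `|2^-1 ^+ n * z| = 0.
  apply: cos_inj.
  - rewrite in_itv/= normr_ge0/= normrM normrX ger0_norm ?invr_ge0// exprVn mulrC.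
    rewrite ler_pdivrMr ?exprn_gt0// (le_trans (ltW Hn))// ler_peMl ?exprn_ge0//.
    by rewrite (le_trans _ (pi_ge2 R))// ler1n.
  - by rewrite in_itv/= lexx pi_ge0.
  - rewrite cos0; have := cz n; have [_|_] := ger0P (2^-1 ^+ n * z) => //.
    by rewrite cosN.
by move/eqP : zn; rewrite normr_eq0 mulf_eq0 expf_eq0 invr_eq0 pnatr_eq0 andbF/= => /eqP.
Qed.

Lemma hit0_ae : x != 0 -> {ae P, forall w, hit0 Y x w = T0 w}.
Proof.
move=> x0; have := hit_zero_value; apply: filterS => w Hw.
exact: (hit0E HY).
Qed.

End zero_hit.

(** * Inversion with the Poisson kernel *)

Section density_measure.
Context {d} {T : measurableType d} {R : realType}.
Variables (mu : {measure set T -> \bar R}) (f : T -> R).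
Hypotheses (f0 : forall x, 0 <= f x) (mf : measurable_fun setT f).

Let dens (A : set T) : \bar R := (\int[mu]_(x in A) (f x)%:E)%E.

Let dens0 : dens set0 = 0%E.
Proof. by rewrite /dens integral_set0. Qed.

Let dens_ge0 A : (0 <= dens A)%E.
Proof. by apply: integral_ge0 => x _; rewrite lee_fin. Qed.

Let dens_sigma_additive : semi_sigma_additive dens.
Proof.
move=> /= F mF tF mUF; rewrite /dens; apply: cvg_toP.
  apply: ereal_nondecreasing_is_cvgn => m n mn.
  apply: lee_sum_nneg_natr => // k _ _; apply: integral_ge0 => /= x Fkx.
  by rewrite lee_fin.
rewrite ge0_integral_bigcup//=.
- by apply/measurable_EFinP; exact: measurable_funTS.
- by move=> x _; rewrite lee_fin.
Qed.

Definition density_measure : {measure set T -> \bar R} :=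
  HB.pack dens (isMeasure.Build _ _ _ dens dens0 dens_ge0 dens_sigma_additive).

Lemma density_measureE A : density_measure A = (\int[mu]_(x in A) (f x)%:E)%E.
Proof. by []. Qed.
End density_measure.

Section poisson.
Context {R : realType}.
Notation mu := (@lebesgue_measure R).

Definition poisson_kernel (e z : R) : R := (pi^-1) * (e / (e ^+ 2 + z ^+ 2)).

Lemma integral_expR_cos0 (e z : R) : 0 < e ->
  \int[mu]_(u in `]0, +oo[) (expR (- e * u) * cos (u * z)) = e / (e ^+ 2 + z ^+ 2).
Proof.
move=> e0.
rewrite Rintegral_itv_obnd_cbnd; last first.
  apply: (@le_integrableR _ _ _ mu _ _ (fun t => expR (- e * t))) => //.
  - apply: measurable_funTS; apply: measurable_funM.
      by apply: measurableT_comp => //; exact: measurable_funM.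
    apply: measurableT_comp; first exact: measurable_cos.
    exact: measurable_funM.
  - move=> t _; rewrite normrM ger0_norm ?expR_ge0//.
    by rewrite ler_piMr ?expR_ge0// norm_cos_le1.
  - apply: integrableS (integrable_expR e0) => //.
    by move=> x/=; rewrite !in_itv/= !andbT; exact: ltW.
have := @integral_expR_cos R e z 0 0 e0 (lexx 0).
rewrite !mulr0 expR0 !addr0 cos0 sin0 mulr1 mulr0 subr0 mul1r => <-.
by apply: eq_Rintegral => u _; rewrite addr0 [u * z]mulrC.
Qed.

Lemma poisson_kernel_ge0 e z : 0 < e -> 0 <= poisson_kernel e z.
Proof.
move=> e0; rewrite /poisson_kernel mulr_ge0 ?invr_ge0 ?pi_ge0// divr_ge0 ?ltW//.
by rewrite ltr_wpDr ?sqr_ge0// exprn_gt0.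
Qed.

Lemma poisson_kernel_le e z : 0 < e -> poisson_kernel e z <= (pi * e)^-1.
Proof.
move=> e0; rewrite /poisson_kernel invfM ler_wpM2l ?invr_ge0 ?pi_ge0//.
rewrite ler_pdivrMr; last by rewrite ltr_wpDr ?sqr_ge0// exprn_gt0.
by rewrite mulrDr expr2 mulrA mulVf ?gt_eqF// mul1r lerDl mulr_ge0 ?invr_ge0 ?sqr_ge0 ?ltW.
Qed.

Lemma poisson_kernel0 e : 0 < e -> poisson_kernel e 0 = (pi * e)^-1.
Proof.
move=> e0; have p0 : (pi : R) != 0 by rewrite gt_eqF// pi_gt0.
have e1 : e != 0 by rewrite gt_eqF.
rewrite /poisson_kernel; move: (@pi R) p0 => c c0.
by field; rewrite c0 e1.
Qed.

Lemma continuous_poisson_kernel e : 0 < e -> continuous (poisson_kernel e).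
Proof.
move=> e0 z; rewrite /poisson_kernel; apply: cvgMr; apply: cvgMr; apply: cvgV.
  by rewrite gt_eqF// ltr_wpDr ?sqr_ge0// exprn_gt0.
apply: cvgD; first exact: cvg_cst.
exact: exprn_continuous.
Qed.

Lemma measurable_poisson_kernel e : 0 < e -> measurable_fun setT (poisson_kernel e).
Proof. by move=> e0; apply: continuous_measurable_fun; exact: continuous_poisson_kernel. Qed.

Lemma integral_poisson_kernel e a b z : 0 < e -> a < b ->
  \int[mu]_(y in `[a, b]) poisson_kernel e (z - y) =
  pi^-1 * (atan ((b - z) / e) - atan ((a - z) / e)).
Proof.
move=> e0 ab.
pose F (y : R) : R := pi^-1 * atan ((y - z) / e).
have e1 : e != 0 by rewrite gt_eqF.
have dF (y : R) : is_derive y 1 F (poisson_kernel e (z - y)).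
  have datan (u : R) : is_derive u 1 (@atan R) ((1 + u ^+ 2)^-1).
    by apply: DeriveDef; [exact: derivable_atan|rewrite -derive1E derive1_atan].
  have dg : is_derive y 1 (fun y : R => (y - z) / e) (e^-1).
    by apply: is_derive_eq; rewrite /GRing.scale/=; field.
  have := @is_derive1_comp _ (@atan R) (fun y : R => (y - z) / e) y _ _ (datan _) dg.
  move=> dc; rewrite /F; apply: is_derive_eq.
  rewrite /poisson_kernel /GRing.scale /=.
  have D1 : e ^+ 2 + (z - y) ^+ 2 != 0 by rewrite gt_eqF// ltr_wpDr ?sqr_ge0// exprn_gt0.
  set c := pi^-1.
  by field; rewrite D1 e1.
rewrite /Rintegral (@continuous_FTC2 _ _ F)//.
- by rewrite /F /= mulrBr.
- have cpk : continuous (fun y : R => poisson_kernel e (z - y)).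
    move=> y; apply: (@continuous_comp _ _ _ (fun y : R => z - y) (poisson_kernel e)).
      by apply: cvgB; [exact: cvg_cst|exact: cvg_id].
    exact: continuous_poisson_kernel.
  exact: continuous_subspaceT.
- have cF : continuous F.
    by move=> y; apply: differentiable_continuous; apply/derivable1_diffP; case: (dF y).
  split=> [y _||]; first by case: (dF y).
    exact: cvg_at_right_filter (cF _).
  exact: cvg_at_left_filter (cF _).
- by move=> y _; rewrite derive1E; case: (dF y).
Qed.

Lemma atan_scale_cvg (u : R) : atan (u / n.+1%:R^-1) @[n --> \oo] --> Num.sg u * (pi / 2).
Proof.
have pos (v : R) : 0 < v -> atan (v / n.+1%:R^-1) @[n --> \oo] --> pi / 2.
  move=> v0.
  have c1 : v / n.+1%:R^-1 @[n --> \oo] --> +oo.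
    apply/cvgryPge => A; near=> n; rewrite invrK mulrC -ler_pdivrMr//.
    rewrite (@le_trans _ _ n%:R)// ?ler_nat//.
    by near: n; exact: nbhs_infty_ger.
  exact: cvg_comp c1 (@cvgy_atan R).
have [u0|u0|->] := ltrgt0P u.
- by rewrite gtr0_sg// mul1r; exact: pos.
- rewrite ltr0_sg// mulN1r.
  have u1 : 0 < - u by rewrite oppr_gt0.
  have -> : (fun n : nat => atan (u / n.+1%:R^-1)) = (fun n : nat => - atan (- u / n.+1%:R^-1)).
    by apply/funext => n; rewrite mulNr atanN opprK.
  exact: cvgN (pos _ u1).
- by rewrite sgr0 mul0r; under eq_cvg do rewrite mul0r atan0; exact: cvg_cst.
Unshelve. all: by end_near. Qed.

End poisson.

Section inversion.
Context {R : realType}.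
Notation mu := (@lebesgue_measure R).
Variable V : {finite_measure set (measurableTypeR R) -> \bar R}.
Variable bnd : R -> R.
Hypothesis ibnd : mu.-integrable `]0, +oo[ (EFin \o bnd).

(** The real part of e^(-i th y) times the characteristic function of [V]. The inversion integral
    over the line is twice the integral of this real part over th > 0, whence the factor [pi^-1] in
    [inv_density]. *)
Definition cos_transform (th y : R) : R := \int[V]_z cos (th * (z - y)).
Notation C := cos_transform.
Hypothesis Cb : forall th y, 0 < th -> `|C th y| <= bnd th.

Definition poisson_avg (e y : R) : R := \int[V]_z poisson_kernel e (z - y).
Definition inv_density (y : R) : R := pi^-1 * \int[mu]_(th in `]0, +oo[) C th y.

Let mcos : measurable_fun setT (@cos R).
Proof. exact: measurable_cos. Qed.

Lemma measurable_cos_transform y : measurable_fun (`]0, +oo[%classic : set R) (fun th : R => C th y).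
Proof.
apply: (@Rfubini_measurable _ _ _ _ _ (\d_(0:R)) V _ setT _ (cst 1) (cst 1)) => //.
- apply: measurable_funTS; apply: measurableT_comp => //; apply: measurable_funM => //.
  exact: measurable_funB.
- exact: finite_measure_integrable_cst.
- exact: finite_measure_integrable_cst.
- by move=> th z _ _; rewrite mulr1 norm_cos_le1.
Qed.

Let ipk e y : 0 < e -> V.-integrable setT (EFin \o (fun z : R => poisson_kernel e (z - y))).
Proof.
move=> e0; apply: (@bounded_integrable _ _ _ _ _ _ (pi * e)^-1) => //.
  by apply: (measurableT_comp (measurable_poisson_kernel e0)); exact: measurable_funB.
by move=> z _; rewrite ger0_norm ?poisson_kernel_ge0// poisson_kernel_le.
Qed.

(** The Poisson kernel is, up to the factor 1/pi, the cosine transform of e^(-e th) on the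
    half-line. By Fubini, smoothing [V] with it amounts to damping the inversion integral. *)
Lemma poisson_avgE e y : 0 < e ->
  poisson_avg e y = pi^-1 * \int[mu]_(th in `]0, +oo[) (expR (- e * th) * C th y).
Proof.
move=> e0.
have ie : mu.-integrable `]0, +oo[ (EFin \o (fun th => expR (- e * th))).
  apply: integrableS (integrable_expR e0) => //.
  by move=> u/=; rewrite !in_itv/= !andbT; exact: ltW.
have icos th y' : V.-integrable setT (EFin \o (fun z : R => cos (th * (z - y')))).
  apply: (@bounded_integrable _ _ _ _ _ _ 1) => // [|z _]; last exact: norm_cos_le1.
  by apply: measurableT_comp => //; apply: measurable_funM => //; exact: measurable_funB.
transitivity (pi^-1 * \int[V]_z (e / (e ^+ 2 + (z - y) ^+ 2))).
  rewrite /poisson_avg /poisson_kernel RintegralZl//.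
  have := integrable_cstM pi measurableT (ipk y e0).
  apply: eq_integrable => // z _ /=; rewrite /poisson_kernel mulrA divff ?mul1r//.
  by rewrite gt_eqF// pi_gt0.
congr (_ * _).
transitivity (\int[V]_z \int[mu]_(th in `]0, +oo[) (expR (- e * th) * cos (th * (z - y)))).
  by apply: eq_Rintegral => z _; rewrite integral_expR_cos0.
rewrite (@Rfubini _ _ _ _ _ V mu setT _ _ (cst 1) (fun th => expR (- e * th)))//.
- by apply: eq_Rintegral => th _; rewrite /C RintegralZl.
- apply: measurable_funTS; apply: measurable_funM.
    by apply: measurableT_comp => //; exact: measurable_funM.
  by apply: measurableT_comp => //; apply: measurable_funM => //; exact: measurable_funB.
- exact: finite_measure_integrable_cst.
- move=> z th _ _; rewrite mul1r normrM ger0_norm ?expR_ge0//.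
  by rewrite ler_piMr ?expR_ge0// norm_cos_le1.
Qed.

Lemma inv_density_cvg y : poisson_avg n.+1%:R^-1 y @[n --> \oo] --> inv_density y.
Proof.
have E n : poisson_avg n.+1%:R^-1 y = pi^-1 * \int[mu]_(th in `]0, +oo[) (expR (- n.+1%:R^-1 * th) * C th y).
  by rewrite poisson_avgE// invr_gt0.
under eq_cvg do rewrite E.
apply: cvgMr; apply: (@Rdominated_cvg _ _ _ mu _ _ _ bnd) => //.
- move=> n; apply: measurable_funM; last exact: measurable_cos_transform.
  by apply: measurable_funTS; apply: measurableT_comp => //; exact: measurable_funM.
- move=> th _; rewrite -[X in _ --> X]mul1r; apply: cvgMl.
  rewrite -[X in _ --> X]expR0; apply: continuous_cvg; first exact: continuous_expR.
  rewrite -[X in _ --> X](mul0r th); apply: cvgMl; rewrite -[X in _ --> X]oppr0; apply: cvgN.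
  exact: cvg_harmonic.
- move=> n th /=; rewrite in_itv/= andbT => th0.
  rewrite normrM ger0_norm ?expR_ge0// -[leRHS]mul1r ler_pM ?expR_ge0 ?Cb//.
  by rewrite expR_le1 mulNr oppr_le0 mulr_ge0 ?invr_ge0// ltW.
Qed.

(** The bound depends neither on e nor on y: it excludes atoms, and it dominates as e tends to 0. *)
Lemma poisson_avg_le e y : 0 < e -> poisson_avg e y <= pi^-1 * \int[mu]_(th in `]0, +oo[) bnd th.
Proof.
move=> e0; rewrite poisson_avgE// ler_pM2l ?invr_gt0 ?pi_gt0//.
apply: le_Rintegral => //.
  apply: (@le_integrableR _ _ _ mu _ _ bnd) => //.
    apply: measurable_funM; last exact: measurable_cos_transform.
    by apply: measurable_funTS; apply: measurableT_comp => //; exact: measurable_funM.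
  move=> th; rewrite /= in_itv/= andbT => th0.
  rewrite normrM ger0_norm ?expR_ge0// -[leRHS]mul1r ler_pM ?expR_ge0 ?Cb//.
  by rewrite expR_le1 mulNr oppr_le0 mulr_ge0// ltW.
move=> th; rewrite /= in_itv/= andbT => th0.
apply: (le_trans (ler_norm _)).
rewrite normrM ger0_norm ?expR_ge0// -[leRHS]mul1r ler_pM ?expR_ge0 ?Cb//.
by rewrite expR_le1 mulNr oppr_le0 mulr_ge0// ltW.
Qed.

Lemma poisson_avg_ge0 e y : 0 < e -> 0 <= poisson_avg e y.
Proof. by move=> e0; apply: Rintegral_ge0 => z _; exact: poisson_kernel_ge0. Qed.

Lemma inv_density_ge0 y : 0 <= inv_density y.
Proof.
apply: (cvgr_to_ge (@inv_density_cvg y)).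
by apply: nearW => n; apply: poisson_avg_ge0; rewrite invr_gt0.
Qed.

Lemma inv_density_le y : inv_density y <= pi^-1 * \int[mu]_(th in `]0, +oo[) bnd th.
Proof.
apply: (cvgr_to_le (@inv_density_cvg y)).
by apply: nearW => n; apply: poisson_avg_le; rewrite invr_gt0.
Qed.

Let mpk2 e : 0 < e -> measurable_fun setT (fun p : measurableTypeR R * measurableTypeR R => poisson_kernel e (p.2 - p.1)).
Proof.
move=> e0; apply: (measurableT_comp (measurable_poisson_kernel e0)).
exact: measurable_funB.
Qed.

Lemma measurable_poisson_avg e : 0 < e -> measurable_fun setT (poisson_avg e).
Proof.
move=> e0.
apply: (@Rfubini_measurable _ _ _ _ _ (\d_(0:R)) V setT setT _ (cst 1) (cst (pi * e)^-1)) => //.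
- by rewrite setXTT; exact: mpk2.
- exact: finite_measure_integrable_cst.
- exact: finite_measure_integrable_cst.
- by move=> y z _ _; rewrite mul1r ger0_norm ?poisson_kernel_ge0// poisson_kernel_le.
Qed.

Lemma measurable_inv_density : measurable_fun setT inv_density.
Proof.
apply: (measurable_fun_cvg (h:=fun n => poisson_avg n.+1%:R^-1)).
  by move=> n; apply: measurable_poisson_avg; rewrite invr_gt0.
by move=> y _; exact: inv_density_cvg.
Qed.

Notation M := (pi^-1 * \int[mu]_(th in `]0, +oo[) bnd th).

(** An atom of mass p at b would force [poisson_avg e b] to be at least p / (pi e), beyond the
    uniform bound for small e. *)
Lemma finite_measure_no_atom b : V [set b] = 0%E.
Proof.
have fV : V [set b] = (fine (V [set b]))%:E by rewrite fineK// fin_num_measure.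
rewrite fV; congr EFin; apply/eqP; rewrite eq_le fine_ge0// andbT.
have H n : fine (V [set b]) <= pi * M * n.+1%:R^-1.
  have e0 : 0 < (n.+1%:R^-1 : R) by rewrite invr_gt0.
  have : (pi * n.+1%:R^-1)^-1 * fine (V [set b]) <= poisson_avg n.+1%:R^-1 b.
    have -> : fine (V [set b]) = \int[V]_z (\1_[set b] z).
      by rewrite /Rintegral integral_indic// setIT.
    rewrite -RintegralZl//; last first.
      by apply: (@bounded_integrable _ _ _ _ _ _ 1) => // z _; rewrite ger0_norm// indicE lern1 leq_b1.
    apply: le_Rintegral => //.
    - apply: integrable_cstM => //.
      by apply: (@bounded_integrable _ _ _ _ _ _ 1) => // z _; rewrite ger0_norm// indicE lern1 leq_b1.
    - exact: ipk.
    - move=> z _; rewrite indicE; have [/[!inE] ->|_] := boolP (z \in [set b]); last first.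
        by rewrite mulr0 poisson_kernel_ge0.
      by rewrite mulr1 subrr poisson_kernel0.
  move=> /le_trans /(_ (poisson_avg_le b e0)).
  rewrite mulrC ler_pdivrMr ?mulr_gt0 ?pi_gt0//.
  by rewrite mulrCA mulrA.
have c : pi * M * n.+1%:R^-1 @[n --> \oo] --> pi * M * 0.
  by apply: cvgMr; exact: cvg_harmonic.
rewrite mulr0 in c.
apply: (cvgr_to_ge c).
by apply: nearW.
Qed.

Let iitv (a b K : R) : mu.-integrable `[a, b] (EFin \o (cst K)).
Proof.
apply: measurable_bounded_integrable => //.
  rewrite -[X in (X < _)%E]/(lebesgue_measure (`[a, b]%classic : set R)) lebesgue_measure_itv /=.
  by case: ifP => // _; rewrite -EFinB ltry.
by exists `|K|; split; [exact: num_real|move=> x xK y _ /=; exact: ltW].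
Qed.

(** The integral of the Poisson average over [a, b] has two limits. One is the integral of
    [inv_density]; the other, after Fubini, is the integral of [g] under [V], where [g] comes from
    arctangents. *)
Lemma inversion_itv (a b : R) : a < b -> V `]a, b]%classic = (\int[mu]_(y in `]a, b]) (inv_density y)%:E)%E.
Proof.
move=> ab.
(* This is 1 between a and b, 0 outside [a, b] and 1/2 at both endpoints, which [V] does not
   charge. *)
pose g (z : R) : R := pi^-1 * (Num.sg (b - z) * (pi / 2) - Num.sg (a - z) * (pi / 2)).
have mid : measurable_fun (`[a, b]%classic : set R) inv_density.
  exact: measurable_funTS measurable_inv_density.
pose h n (z : R) : R := pi^-1 * (atan ((b - z) / n.+1%:R^-1) - atan ((a - z) / n.+1%:R^-1)).
have mh n : measurable_fun setT (h n).
  have matan : measurable_fun setT (@atan R).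
    by apply: continuous_measurable_fun => z; exact: continuous_atan.
  apply: measurable_funM => //; apply: measurable_funB; apply: measurableT_comp => //;
    by apply: measurable_funM => //; exact: measurable_funB.
have ch z : h n z @[n --> \oo] --> g z.
  by rewrite /g; apply: cvgMr; apply: cvgB; exact: atan_scale_cvg.
have mg : measurable_fun setT g by apply: (measurable_fun_cvg (h:=h)).
have c1 : \int[mu]_(y in `[a, b]) poisson_avg n.+1%:R^-1 y @[n --> \oo] -->
    \int[mu]_(y in `[a, b]) inv_density y.
  apply: (@Rdominated_cvg _ _ _ mu _ _ _ (cst M)) => //.
  - by move=> n; apply: measurable_funTS; exact: measurable_poisson_avg.
  - by move=> y _; exact: inv_density_cvg.
  - by move=> n y _; rewrite ger0_norm ?poisson_avg_ge0// poisson_avg_le.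
have c2 : \int[mu]_(y in `[a, b]) poisson_avg n.+1%:R^-1 y @[n --> \oo] --> \int[V]_z g z.
  have E n : \int[mu]_(y in `[a, b]) poisson_avg n.+1%:R^-1 y =
      \int[V]_z h n z.
    rewrite /poisson_avg (@Rfubini _ _ _ _ _ mu V _ setT _ (cst (pi * n.+1%:R^-1)^-1) (cst 1))//.
    - by apply: eq_Rintegral => z _; rewrite integral_poisson_kernel.
    - by apply: measurable_funTS; exact: mpk2.
    - exact: finite_measure_integrable_cst.
    - by move=> y z _ _; rewrite mulr1 ger0_norm ?poisson_kernel_ge0// poisson_kernel_le.
  under eq_cvg do rewrite E.
  apply: (@Rdominated_cvg _ _ _ V _ _ _ (cst (pi^-1 * pi))) => //.
  - exact: finite_measure_integrable_cst.
  - move=> n z _; rewrite normrM ger0_norm ?invr_ge0 ?pi_ge0// ler_pM2l ?invr_gt0 ?pi_gt0//.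
    rewrite (le_trans (ler_normB _ _))// [leRHS](splitr pi) lerD//.
      by rewrite ler_norml !ltW ?atan_gtNpi2 ?atan_ltpi2.
    by rewrite ler_norml !ltW ?atan_gtNpi2 ?atan_ltpi2.
have E : \int[mu]_(y in `[a, b]) inv_density y = \int[V]_z g z.
  exact: (cvg_unique (@Rhausdorff R) c1 c2).
have Vg : \int[V]_z g z = fine (V `]a, b]%classic).
  transitivity (\int[V]_z (\1_(`]a, b]%classic) z)); last by rewrite /Rintegral integral_indic// setIT.
  congr fine; apply: ae_eq_integral => //.
  - exact/measurable_EFinP.
  - exact/measurable_EFinP.
  exists ([set a] `|` [set b]); split.
  - exact: measurableU.
  - apply/eqP; rewrite eq_le measure_ge0 andbT (le_trans (measureU2 _ _ _))//.
    rewrite le_eqVlt; apply/orP; left; apply/eqP; transitivity (0 + 0 : \bar R)%E; last by rewrite adde0.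
    exact: (congr2 (@adde R) (finite_measure_no_atom a) (finite_measure_no_atom b)).
  - move=> z /= H; apply: contrapT => /not_orP[za zb]; apply: H => _.
    congr EFin; rewrite /g indicE.
    have ppi : (pi : R) != 0 by rewrite gt_eqF// pi_gt0.
    have [az|az|/esym //] := ltgtP a z; have [bz|bz|/esym //] := ltgtP z b.
    + rewrite mem_set/= ?in_itv/= ?az ?(ltW bz)//.
      rewrite gtr0_sg ?subr_gt0// ltr0_sg ?subr_lt0//.
      by move: (@pi R) ppi => c ppi; field.
    + rewrite memNset/= ?in_itv/= ?az ?leNgt ?bz//.
      rewrite !ltr0_sg ?subr_lt0//.
      by move: (@pi R) ppi => c ppi; field.
    + rewrite memNset/= ?in_itv/= ?ltNge ?(ltW az)//.
      rewrite !gtr0_sg ?subr_gt0//.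
      by move: (@pi R) ppi => c ppi; field.
    + by have := lt_trans az (lt_trans ab bz); rewrite ltxx.
rewrite -[LHS]fineK ?fin_num_measure// -Vg -E.
rewrite integral_itv_obnd_cbnd; last first.
  by apply/measurable_EFinP; apply: measurable_funTS; exact: measurable_inv_density.
rewrite /Rintegral fineK//; apply: integrable_fin_num => //.
apply: (@le_integrableR _ _ _ mu _ _ (cst M)) => // y _.
by rewrite ger0_norm ?inv_density_ge0// inv_density_le.
Qed.

Lemma inversion A : measurable A -> V A = (\int[mu]_(y in A) (inv_density y)%:E)%E.
Proof.
move=> mA.
rewrite -(@density_measureE _ _ _ mu _ inv_density_ge0 measurable_inv_density).
apply: (@measure_unique _ R (measurableTypeR R) (@ocitv R) (fun n => `]- n%:R, n%:R]%classic)) => //.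
- exact: ocitvI.
- by move=> n; exact: is_ocitv.
- exact: bigcup_itvT.
- move=> _ [[x y] _ <-] /=.
  have [xy|yx] := ltP x y; first by rewrite inversion_itv.
  by rewrite set_itv_ge ?measure0 ?integral_set0// bnd_simp -leNgt.
- by move=> k; rewrite (le_lt_trans _ (fin_num_fun_lty (fin_num_measure V)))// le_measure ?inE.
Qed.

End inversion.

(** * The killed process *)

Section killed.
Context {d} {T : measurableType d} {R : realType}.
Variables (P : probability T R) (X : R -> T -> R).
Hypothesis mX : forall t, measurable_fun setT (X t).
Hypothesis rcX : forall w t, X s w @[s --> t^'+] --> X t w.
Hypothesis X0 : forall t w, t <= 0 -> X t w = X 0 w.
Variable S : T -> \bar R.
Hypothesis mS : measurable_fun setT S.
Variables (q : R) (q0 : 0 < q).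
Notation mu := (@lebesgue_measure R).

Let D := [set p : measurableTypeR R * T | (p.1%:E < S p.2)%E].

Let mD : measurable D.
Proof.
rewrite -[X in measurable X]setTI; apply: measurable_lte => //.
  by apply/measurable_EFinP.
exact: measurableT_comp.
Qed.

Let mJ : measurable_fun setT (fun p : measurableTypeR R * T => X p.1 p.2).
Proof. exact: (measurable_joint mX rcX X0). Qed.

Let ind (p : measurableTypeR R * T) : R := \1_D p.
Let ind_ge0 p : 0 <= ind p. Proof. by rewrite /ind indicE. Qed.
Let mind : measurable_fun setT ind. Proof. exact: measurable_indic. Qed.

(** Killing is encoded as a density: the product of the exponential law and P is weighted by the
    indicator that the exponential time precedes S. The pushforward under X then has mass at most
    1. *)
Let joint : {measure set (measurableTypeR R * T) -> \bar R} :=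
  density_measure (exp_law q0 \x P)%E ind_ge0 mind.

Let kfun : set (measurableTypeR R) -> \bar R :=
  pushforward joint (fun p : measurableTypeR R * T => X p.1 p.2).

Let kfun0 : kfun set0 = 0%E.
Proof. by rewrite /kfun /pushforward preimage_set0 measure0. Qed.

Let kfun_ge0 A : (0 <= kfun A)%E.
Proof. by apply: integral_ge0 => p _; rewrite lee_fin ind_ge0. Qed.

Let kfun_sigma_additive : semi_sigma_additive kfun.
Proof. exact: (@measure_semi_sigma_additive _ _ _ (pushforward joint _)). Qed.

Let kfun_fin : fin_num_fun kfun.
Proof.
move=> A mA; rewrite ge0_fin_numE//.
apply: (@le_lt_trans _ _ ((exp_law q0 \x P)%E setT)); last first.
  by rewrite (@le_lt_trans _ _ 1%E) ?ltry// probability_le1.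
rewrite [leLHS](_ : _ = (\int[(exp_law q0 \x P)%E]_(p in (fun p : measurableTypeR R * T => X p.1 p.2) @^-1` A) (ind p)%:E)%E)//.
rewrite (@le_trans _ _ (\int[(exp_law q0 \x P)%E]_(p in setT) (ind p)%:E)%E)//.
  apply: ge0_subset_integral => //.
    by rewrite -[X in measurable X]setTI; exact: mJ.
  - exact/measurable_EFinP.
  - by move=> p _; rewrite lee_fin ind_ge0.
by rewrite /ind integral_indic// setIT le_measure// inE.
Qed.

Let kmeas : {measure set (measurableTypeR R) -> \bar R} :=
  HB.pack kfun (isMeasure.Build _ _ _ kfun kfun0 kfun_ge0 kfun_sigma_additive).

(* law of X at an independent exponential time of rate q, restricted to the event that this
   time precedes S *)
Definition killed_measure : {finite_measure set (measurableTypeR R) -> \bar R} :=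
  HB.pack_for (FiniteMeasure.type (measurableTypeR R) R) (Measure.sort kmeas)
    (Measure_isFinite.Build _ _ _ kmeas kfun_fin).

Lemma ge0_integral_killed (g : R -> \bar R) : measurable_fun setT g -> (forall x, 0 <= g x)%E ->
  (\int[killed_measure]_x g x =
   \int[mu]_(t in `[0%R, +oo[) ((q * expR (- q * t))%:E * \int[P]_(w in [set w | (t%:E < S w)%E]) g (X t w)))%E.
Proof.
move=> mg g0.
transitivity (\int[joint]_p g (X p.1 p.2))%E.
  have H := @ge0_integral_pushforward _ _ (measurableTypeR R * T)%type (measurableTypeR R) _
    (fun p : measurableTypeR R * T => X p.1 p.2) mJ joint setT g measurableT mg (fun y _ => g0 y).
  rewrite preimage_setT in H.
  exact: H.
have mgJ : measurable_fun setT (fun p : measurableTypeR R * T => g (X p.1 p.2)).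
  exact: (measurableT_comp mg mJ).
rewrite (@ge0_integral_density _ _ _ (exp_law q0 \x P)%E joint ind)//.
rewrite fubini_tonelli1//=; last 2 first.
- by apply: emeasurable_funM => //; exact/measurable_EFinP.
- by move=> p; rewrite mule_ge0// lee_fin.
rewrite ge0_integral_exp_law//.
- apply: eq_integral => t _; rewrite muleC; congr (_ * _)%E.
  rewrite /fubini_F [RHS]integral_mkcond; apply: eq_integral => w _.
  rewrite patchE /ind indicE /=.
  have -> : ((t, w) \in D) = (w \in [set w | (t%:E < S w)%E]) by apply/idP/idP; rewrite !inE.
  by case: ifP => _; rewrite ?mule1 ?mule0.
- apply: measurable_fun_fubini_tonelli_F => //=.
    by apply: emeasurable_funM => //; exact/measurable_EFinP.
  by move=> p; rewrite mule_ge0// lee_fin.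
- by move=> t; apply: integral_ge0 => w _; rewrite mule_ge0// lee_fin.
Qed.

Let mSt t : measurable [set w | (t%:E < S w)%E].
Proof. by rewrite -[X in measurable X]setTI; apply: measurable_lte. Qed.

Lemma measurable_killed_slice (g : R -> R) (K : R) : measurable_fun setT g -> (forall x, `|g x| <= K) ->
  measurable_fun setT (fun t : R => \int[P]_(w in [set w | (t%:E < S w)%E]) g (X t w)).
Proof.
move=> mg gK.
have : measurable_fun setT (fun t : R => \int[P]_w (g (X t w) * ind (t, w))).
  apply: (@Rfubini_measurable _ _ _ _ _ (\d_(0:R)) P setT setT _ (cst K) (cst 1)) => //.
  - rewrite setXTT; apply: measurable_funM; first exact: (measurableT_comp mg mJ).
    by apply: (measurableT_comp mind); exact: measurable_fun_pair.
  - exact: finite_measure_integrable_cst.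
  - exact: finite_measure_integrable_cst.
  - move=> t w _ _; rewrite normrM ler_pM// (ger0_norm (ind_ge0 _)).
    by rewrite /ind indicE lern1 leq_b1.
apply: eq_measurable_fun => t _; rewrite [RHS]Rintegral_mkcond.
apply: eq_Rintegral => w _; rewrite patchE /ind indicE.
have -> : ((t, w) \in D) = (w \in [set w | (t%:E < S w)%E]) by apply/idP/idP; rewrite !inE.
by case: ifP => _; rewrite ?mulr1 ?mulr0.
Qed.

Let isl (g : R -> R) (K : R) t : measurable_fun setT g -> (forall x, `|g x| <= K) ->
  P.-integrable [set w | (t%:E < S w)%E] (EFin \o (fun w => g (X t w))).
Proof.
move=> mg gK; apply: (@bounded_integrable _ _ _ _ _ _ K) => //.
by apply: measurable_funTS; exact: (measurableT_comp mg).
Qed.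

Lemma killed_slice_le (g : R -> R) (K t : R) : measurable_fun setT g -> (forall x, `|g x| <= K) ->
  `|\int[P]_(w in [set w | (t%:E < S w)%E]) g (X t w)| <= K.
Proof.
move=> mg gK.
have K0 : 0 <= K by rewrite (le_trans _ (gK 0)).
have ig := isl t mg gK.
rewrite (le_trans (le_normr_Rintegral _ _))//.
rewrite (@le_trans _ _ (\int[P]_(w in [set w | (t%:E < S w)%E]) K))//.
  apply: le_Rintegral => //; last exact: finite_measure_integrable_cst.
  exact: integrable_norm.
rewrite Rintegral_cst// ler_piMr// -lee_fin fineK ?fin_num_measure//.
exact: probability_le1.
Qed.

Lemma integrable_killed_slice (g : R -> R) (K : R) : measurable_fun setT g -> (forall x, `|g x| <= K) ->
  mu.-integrable `[0, +oo[ (EFin \o (fun t => q * expR (- q * t) *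
    \int[P]_(w in [set w | (t%:E < S w)%E]) g (X t w))).
Proof.
move=> mg gK.
apply: (@le_integrableR _ _ _ mu _ _ (fun t => K * (q * expR (- q * t)))) => //.
- apply: measurable_funTS; apply: measurable_funM; last exact: measurable_killed_slice gK.
  by apply: measurable_funM => //; apply: measurableT_comp.
- move=> t _; rewrite normrM mulrC ler_pM ?killed_slice_le//.
  by rewrite ger0_norm// mulr_ge0 ?expR_ge0// ltW.
- by apply: integrable_cstM => //; apply: integrable_cstM => //; exact: integrable_expR.
Qed.

(** A bounded g is shifted by K to reach the nonnegative case. The killed law is in general not a
    probability, so the contribution of the constant K is itself evaluated by the nonnegative
    case. *)
Lemma Rintegral_killed (g : R -> R) (K : R) : measurable_fun setT g -> (forall x, `|g x| <= K) ->
  \int[killed_measure]_x g x = \int[mu]_(t in `[0, +oo[) (q * expR (- q * t) *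
    \int[P]_(w in [set w | (t%:E < S w)%E]) g (X t w)).
Proof.
move=> mg gK.
have K0 : 0 <= K by rewrite (le_trans _ (gK 0)).
have main (f : R -> R) M : measurable_fun setT f -> (forall x, 0 <= f x) -> (forall x, `|f x| <= M) ->
  \int[killed_measure]_x f x = \int[mu]_(t in `[0, +oo[) (q * expR (- q * t) *
    \int[P]_(w in [set w | (t%:E < S w)%E]) f (X t w)).
  move=> mf f0 fM; rewrite /Rintegral ge0_integral_killed//; last exact/measurable_EFinP.
  congr fine; apply: eq_integral => t _; rewrite [in RHS]EFinM fineK//.
  by apply: integrable_fin_num => //; exact: isl fM.
have gK2 x : `|g x + K| <= K + K by rewrite (le_trans (ler_normD _ _))// lerD// ger0_norm.
have cK x : `|(cst K : R -> R) x| <= K by rewrite /= ger0_norm.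
have iK := finite_measure_integrable_cst killed_measure K.
have E1 : \int[killed_measure]_x (g x + K) = \int[killed_measure]_x g x + \int[killed_measure]_x K.
  have ig : killed_measure.-integrable setT (EFin \o g).
    exact: (@bounded_integrable _ _ _ _ _ _ K).
  by apply: RintegralD => //; exact: iK.
have E2 : \int[mu]_(t in `[0, +oo[) (q * expR (- q * t) *
    \int[P]_(w in [set w | (t%:E < S w)%E]) (g (X t w) + K)) =
  \int[mu]_(t in `[0, +oo[) (q * expR (- q * t) *
    \int[P]_(w in [set w | (t%:E < S w)%E]) g (X t w)) +
  \int[mu]_(t in `[0, +oo[) (q * expR (- q * t) *
    \int[P]_(w in [set w | (t%:E < S w)%E]) K).
  rewrite -RintegralD//; last 2 first.
  - exact: integrable_killed_slice gK.
  - exact: (integrable_killed_slice (g:=cst K) _ cK).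
  apply: eq_Rintegral => t _; rewrite -mulrDr RintegralD//.
  - exact: isl gK.
  - exact: finite_measure_integrable_cst.
apply: (addIr (\int[killed_measure]_x K)).
rewrite -E1 (main (cst K) K)// -E2; apply: (main _ (K + K)) => //.
- exact: measurable_funD.
- by move=> x; rewrite -lerBlDr sub0r lerNl (le_trans (ler_norm _))// normrN.
Qed.

Lemma Rintegral_survival_cos (th b t : R) :
  \int[P]_(w in [set w | (t%:E < S w)%E]) cos (th * X t w + b) =
  \int[P]_w cos (th * X t w + b) - \int[P]_(w in [set w | (S w <= t%:E)%E]) cos (th * X t w + b).
Proof.
rewrite -[X in \int[P]_(w in X) _ - _](setvU [set w | (S w <= t%:E)%E]).
have mC : measurable [set w | (S w <= t%:E)%E].
  by rewrite -[X in measurable X]setTI; apply: measurable_lee.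
rewrite Rintegral_setU//; last 3 first.
- exact: measurableC.
- apply: integrable_cosX => //; apply: measurableU => //; exact: measurableC.
- by apply/disj_set2P; rewrite setIC setICr.
rewrite addrK; congr Rintegral; apply/seteqP; split=> w /=; rewrite ltNge.
  by move/negP.
by move=> /negP.
Qed.

End killed.

(** * The integral of (1 - e^(-zt)) t^(-a) *)

Section power_integrals.
Context {R : realType}.
Notation mu := (@lebesgue_measure R).

Lemma is_derive_continuous (f : R -> R) (x df : R) : is_derive x 1 f df -> {for x, continuous f}.
Proof. by move=> [df' _]; apply: differentiable_continuous; exact/derivable1_diffP. Qed.

Lemma integral_powR_itv (p s t : R) : p != 0 -> 0 < s -> s < t ->
  (\int[mu]_(x in `[s, t]) (x `^ (p - 1))%:E = ((t `^ p - s `^ p) / p)%:E)%E.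
Proof.
move=> p0 s0 st.
pose F (x : R) := p^-1 * x `^ p.
have dF (x : R) : 0 < x -> is_derive x 1 F (x `^ (p - 1)).
  move=> x0; have d1 := is_derive1_powR p x0.
  apply: is_derive_eq; rewrite /GRing.scale /=.
  by rewrite mulrA mulVf ?mul1r.
have cF (x : R) : 0 < x -> {for x, continuous F}.
  by move=> x0; exact: is_derive_continuous (dF _ x0).
have t0 : 0 < t by exact: lt_trans st.
rewrite (@continuous_FTC2 _ _ F)//.
- by rewrite /F -EFinB; congr EFin; ring.
- apply: continuous_in_subspaceT => x; rewrite inE/= in_itv/= => /andP[sx _].
  exact: is_derive_continuous (is_derive1_powR _ (lt_le_trans s0 sx)).
- split=> [x|//|//]; [rewrite in_itv/= => /andP[sx _]| |].
  + by case: (dF x (lt_trans s0 sx)).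
  + by apply: cvg_at_right_filter; exact: cF.
  + by apply: cvg_at_left_filter; exact: cF.
- move=> x; rewrite in_itv/= => /andP[sx _]; rewrite derive1E.
  by case: (dF x (lt_trans s0 sx)).
Qed.

Lemma integrable_nd_union (F : nat -> set R) (f : R -> R) (M : R) :
  (forall n, measurable (F n)) -> {homo F : n k / (n <= k)%N >-> n `<=` k} ->
  measurable_fun setT f -> (forall x, 0 <= f x) ->
  (forall n, (\int[mu]_(x in F n) (f x)%:E <= M%:E)%E) ->
  mu.-integrable (\bigcup_n F n) (EFin \o f).
Proof.
move=> mF ndF mf f0 fM.
have mfE D : measurable_fun D (EFin \o f).
  by apply/measurable_EFinP; exact: measurable_funTS.
apply/integrableP; split; first exact: mfE.
have c := @ge0_nondecreasing_set_cvg_integral _ (measurableTypeR R) _ F (EFin \o f) mu _ mF (fun n => mfE (F n)).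
under eq_integral do rewrite /= ger0_norm//.
apply: (@le_lt_trans _ _ M%:E); last exact: ltry.
have {}c : (\int[mu]_(x in F i) (f x)%:E)%E @[i --> \oo] --> (\int[mu]_(x in \bigcup_i F i) (f x)%:E)%E.
  apply: c => [n k nk|n x _]; last by rewrite lee_fin.
  by apply/subsetPset; exact: ndF.
by apply: (cvge_to_le c); apply: nearW.
Qed.

Lemma integrable_setU_disj (A B : set R) (f : R -> R) :
  measurable A -> measurable B -> measurable_fun setT f -> [disjoint A & B]%classic ->
  mu.-integrable A (EFin \o f) -> mu.-integrable B (EFin \o f) ->
  mu.-integrable (A `|` B) (EFin \o f).
Proof.
move=> mA mB mf AB /integrableP[_ iA] /integrableP[_ iB].
apply/integrableP; split; first by apply/measurable_EFinP; exact: measurable_funTS.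
rewrite ge0_integral_setU//; first exact: lte_add_pinfty.
by apply: measurableT_comp => //; apply/measurable_EFinP; exact: measurable_funTS.
Qed.

Lemma integrable_powR_near0 (p : R) : 0 < p ->
  mu.-integrable `]0, 1] (EFin \o (fun x => x `^ (p - 1))).
Proof.
move=> p0.
have -> : (`]0, 1]%classic : set R) = \bigcup_n `[n.+2%:R^-1, 1]%classic.
  apply/seteqP; split=> x /=; last first.
    move=> [n _ /=]; rewrite !in_itv/= => /andP[nx ->]; rewrite andbT.
    by rewrite (lt_le_trans _ nx)// invr_gt0.
  rewrite in_itv/= => /andP[x0 x1].
  exists (Num.truncn x^-1) => //=; rewrite in_itv/= x1 andbT.
  rewrite invf_ple ?posrE// (le_trans (ltW (truncnS_gt _)))// ler_nat.
  by rewrite leqnSn.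
apply: (@integrable_nd_union _ _ p^-1) => //.
- move=> n k nk x /=; rewrite !in_itv/= => /andP[nx ->]; rewrite andbT.
  by rewrite (le_trans _ nx)// lef_pV2 ?posrE// ler_nat.
- by move=> x; exact: powR_ge0.
- move=> n; have n1 : n.+2%:R^-1 < 1 :> R by rewrite invf_lt1// ltr1n.
  rewrite integral_powR_itv ?gt_eqF//.
  rewrite lee_fin -[leRHS]mul1r ler_pM2r ?invr_gt0// powR1.
  by rewrite lerBlDr lerDl powR_ge0.
Qed.

Lemma integrable_powR_infty (p : R) : p < 0 ->
  mu.-integrable `[1, +oo[ (EFin \o (fun x => x `^ (p - 1))).
Proof.
move=> p0.
have -> : (`[1, +oo[%classic : set R) = \bigcup_n `[1, n.+2%:R]%classic.
  apply/seteqP; split=> x /=; last by move=> [n _ /=]; rewrite !in_itv/= => /andP[->].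
  rewrite in_itv/= andbT => x1.
  exists (Num.truncn x) => //=; rewrite in_itv/= x1 /=.
  by rewrite (le_trans (ltW (truncnS_gt _)))// ler_nat leqnSn.
apply: (@integrable_nd_union _ _ (- p^-1)) => //.
- move=> n k nk x /=; rewrite !in_itv/= => /andP[-> nx] /=.
  by rewrite (le_trans nx)// ler_nat.
- by move=> x; exact: powR_ge0.
- move=> n; have n1 : 1 < n.+2%:R :> R by rewrite ltr1n.
  rewrite integral_powR_itv ?lt_eqF// lee_fin powR1.
  by rewrite -[leRHS]mulN1r ler_nM2r ?invr_lt0// lerDr powR_ge0.
Qed.

(* x^(1-a) near 0 and x^(-a) at infinity, the order of magnitude of (1 - e^(-zx)) x^(-a) *)
Definition stable_dom (a x : R) : R := Num.min x 1 * x `^ (- a).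

Lemma stable_dom_ge0 a x : 0 < x -> 0 <= stable_dom a x.
Proof. by move=> x0; rewrite mulr_ge0 ?powR_ge0// le_min ltW//=. Qed.

Lemma measurable_stable_dom a : measurable_fun setT (stable_dom a).
Proof. by apply: measurable_funM; [exact: measurable_minr|exact: measurable_powR]. Qed.

Lemma mulr_powRN (a x : R) : 0 < x -> x * x `^ (- a) = x `^ (1 - a).
Proof. by move=> x0; rewrite powRD ?powRr1 ?(ltW x0)// (gt_eqF x0) implybT. Qed.

Lemma integrable_stable_dom a : 1 < a -> a < 2 ->
  mu.-integrable `]0, +oo[ (EFin \o stable_dom a).
Proof.
move=> a1 a2.
have -> : (`]0, +oo[%classic : set R) = `]0, 1] `|` `]1, +oo[.
  apply/seteqP; split=> x /=; rewrite !in_itv/= ?andbT.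
    by move=> x0; have [x1|x1] := leP x 1; [left; rewrite x0|right].
  by move=> [/andP[]//|]; exact: lt_trans.
apply: integrable_setU_disj => //.
- exact: measurable_stable_dom.
- by apply/disj_set2P/seteqP; split=> x //=; rewrite !in_itv/= andbT => -[/andP[_ /le_lt_trans h] /h]; rewrite ltxx.
- have H : 0 < 2 - a by rewrite subr_gt0.
  have := integrable_powR_near0 H; apply: eq_integrable => // x.
  rewrite inE/= in_itv/= => /andP[x0 x1]; rewrite /stable_dom (min_idPl x1) mulr_powRN//.
  by congr (_ `^ _)%:E; ring.
- have H : 1 - a < 0 by rewrite subr_lt0.
  have : mu.-integrable `]1, +oo[ (EFin \o (fun x => x `^ (1 - a - 1))).
    apply: integrableS (integrable_powR_infty H) => //.
    by move=> x/=; rewrite !in_itv/= !andbT; exact: ltW.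
  apply: eq_integrable => // x.
  rewrite inE/= in_itv/= andbT => /ltW x1; rewrite /stable_dom (min_idPr x1) mul1r.
  by congr (_ `^ _)%:E; ring.
Qed.

Lemma le_stable_dom (a x C y : R) : 0 < x -> 0 <= C -> y <= C -> y <= C * x -> y * x `^ (- a) <= C * stable_dom a x.
Proof.
move=> x0 C0 y1 y2; rewrite /stable_dom mulrA ler_wpM2r ?powR_ge0//.
by have [x1|x1] := leP x 1; rewrite ?mulr1.
Qed.

End power_integrals.

Section cvg_sets.
Context {d} {T : measurableType d} {R : realType}.
Variable mu : {measure set T -> \bar R}.

Lemma Rintegral_cvg_sets (F : nat -> set T) (D : set T) (f : T -> R) :
  (forall n, measurable (F n)) -> measurable D -> (forall n, F n `<=` D) ->
  (forall x, D x -> \forall n \near \oo, F n x) ->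
  mu.-integrable D (EFin \o f) ->
  \int[mu]_(x in F n) f x @[n --> \oo] --> \int[mu]_(x in D) f x.
Proof.
move=> mF mD FD cF iF.
have E n : \int[mu]_(x in F n) f x = \int[mu]_(x in D) (f \_ (F n)) x.
  by rewrite -[in LHS](setIidr (FD n)) Rintegral_mkcondr.
under eq_cvg do rewrite E.
have mf : measurable_fun D f by apply/measurable_EFinP; case/integrableP : iF.
apply: (@Rdominated_cvg _ _ _ mu _ _ _ (fun x => `|f x|)) => //.
- move=> n; apply/(measurable_restrict _ (mF n) mD).1.
  by apply: measurable_funS mf => //; exact: subIsetl.
- move=> x Dx; apply: cvg_near_cst; near=> n; rewrite patchE mem_set//.
  by near: n; exact: cF.
- exact: integrable_norm.
- by move=> n x _; rewrite patchE; case: ifP => _; rewrite ?normr0.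
Unshelve. all: by end_near. Qed.
End cvg_sets.

(** * The integral for complex z: derivative and integration by parts *)

Section rotation.
Context {R : realType}.
Notation mu := (@lebesgue_measure R).
Implicit Types b x y t : R.

(* with z = x + iy: Re (e^(ib) (1 - e^(-zt))) and its derivative in t, Re (e^(ib) z e^(-zt)) *)
Definition phase b x y t : R := cos b - expR (- x * t) * cos (b - y * t).
Definition dphase b x y t : R := expR (- x * t) * (x * cos (b - y * t) - y * sin (b - y * t)).

Lemma is_derive_phase b x y t : is_derive t 1 (phase b x y) (dphase b x y t).
Proof.
apply: is_derive_eq; rewrite /dphase /GRing.scale /=.
ring.
Qed.

(** Since e^(ib) = cos b + i sin b, the phases 0 and pi/2 determine all others. *)
Lemma phaseD b x y t : phase b x y t = cos b * phase 0 x y t + sin b * phase (pi / 2) x y t.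
Proof.
rewrite /phase sub0r !cosD cos0 cos_pihalf sin_pihalf cosN sinN; ring.
Qed.

Lemma norm_dphase_le b x y t : 0 <= x -> 0 <= t -> `|dphase b x y t| <= (x + `|y|) * expR (- x * t).
Proof.
move=> x0 t0; rewrite /dphase normrM ger0_norm ?expR_ge0// mulrC ler_wpM2r ?expR_ge0//.
rewrite (le_trans (ler_normB _ _))// !normrM (ger0_norm x0) lerD// ler_piMr// ?norm_cos_le1//.
by rewrite ler_norml sin_geN1 sin_le1.
Qed.

Lemma norm_phase_le2 b x y t : 0 <= x -> 0 <= t -> `|phase b x y t| <= 2.
Proof.
move=> x0 t0; rewrite (le_trans (ler_normB _ _))// (_ : 2 = 1 + 1)// lerD ?norm_cos_le1//.
rewrite normrM ger0_norm ?expR_ge0// mulr_ile1 ?expR_ge0 ?norm_cos_le1//.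
by rewrite expR_le1 mulNr oppr_le0 mulr_ge0.
Qed.

Lemma continuous_phase b x y : continuous (phase b x y).
Proof. by move=> t; exact: is_derive_continuous (is_derive_phase b x y t). Qed.

Lemma norm_phase_le b x y t : 0 <= x -> 0 < t -> `|phase b x y t| <= (x + `|y|) * t.
Proof.
move=> x0 t0.
have c : {within `[0, t], continuous (phase b x y)}.
  by apply: continuous_subspaceT; exact: continuous_phase.
have [u + E] := MVT t0 (fun u _ => is_derive_phase b x y u) c.
rewrite in_itv/= => /andP[/ltW u0 _].
have P0 : phase b x y 0 = 0 by rewrite /phase !mulr0 expR0 subr0 mul1r subrr.
move: E; rewrite P0 !subr0 => ->; rewrite normrM (gtr0_norm t0) ler_pM2r//.
rewrite (le_trans (norm_dphase_le _ _ x0 u0))// ler_piMr ?addr_ge0//.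
by rewrite expR_le1 mulNr oppr_le0 mulr_ge0.
Qed.

Lemma measurable_phase b x y : measurable_fun setT (phase b x y).
Proof. by apply: continuous_measurable_fun; exact: continuous_phase. Qed.

Lemma continuous_dphase b x y : continuous (dphase b x y).
Proof.
move=> t.
have d : derivable (dphase b x y) t 1.
  by rewrite /dphase; apply: ex_derive.
by apply: differentiable_continuous; apply/derivable1_diffP.
Qed.

Lemma measurable_dphase b x y : measurable_fun setT (dphase b x y).
Proof. by apply: continuous_measurable_fun; exact: continuous_dphase. Qed.

Variable a : R.
Hypotheses (a1 : 1 < a) (a2 : a < 2).

Definition phase_int b x y : R := \int[mu]_(t in `]0, +oo[) (phase b x y t * t `^ (- a)).
Definition dphase_int b x y : R := \int[mu]_(t in `]0, +oo[) (dphase b x y t * t `^ (1 - a)).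

Lemma phase_dom b x y C t : 0 <= x -> 0 < t -> 2 <= C -> x + `|y| <= C ->
  `|phase b x y t * t `^ (- a)| <= C * stable_dom a t.
Proof.
move=> x0 t0 C2 Cx.
have C0 : 0 <= C by rewrite (le_trans _ C2).
rewrite normrM (ger0_norm (powR_ge0 _ _)); apply: le_stable_dom => //.
  by rewrite (le_trans (norm_phase_le2 _ _ x0 (ltW t0))).
by rewrite (le_trans (norm_phase_le _ _ x0 t0))// ler_wpM2r// ltW.
Qed.

(** For large t the bound rests on t e^(-xt) <= 1/x <= 1/x0. The lower bound x0, common to all x, is
    what differentiation under the integral sign requires. *)
Lemma dphase_dom b x y C x0 t : 0 < x0 -> x0 <= x -> 0 < t -> x + `|y| <= C ->
  `|dphase b x y t * t `^ (1 - a)| <= C * (1 + x0^-1) * stable_dom a t.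
Proof.
move=> x00 x0x t0 Cx.
have xx : 0 < x by exact: lt_le_trans x0x.
have C0 : 0 <= C by rewrite (le_trans _ Cx)// addr_ge0// ltW.
rewrite -mulr_powRN// mulrA normrM (ger0_norm (powR_ge0 _ _)).
have e1 : expR (- x * t) <= 1 by rewrite expR_le1 mulNr oppr_le0 mulr_ge0// ltW.
have d1 : `|dphase b x y t * t| <= C * (expR (- x * t) * t).
  rewrite normrM (gtr0_norm t0) mulrA ler_wpM2r ?(ltW t0)//.
  rewrite (le_trans (norm_dphase_le _ _ (ltW xx) (ltW t0)))// ler_wpM2r ?expR_ge0//.
apply: le_stable_dom => //.
- by rewrite mulr_ge0// addr_ge0// invr_ge0 ltW.
- rewrite (le_trans d1)// ler_wpM2l//.
  have : expR (- x * t) * t <= x^-1.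
    rewrite mulNr expRN mulrC ler_pdivrMr ?expR_gt0// ler_pdivlMl//.
    by rewrite (le_trans _ (expR_ge1Dx _))// lerDr.
  move=> /le_trans; apply.
  by rewrite (@le_trans _ _ x0^-1)// ?lef_pV2 ?posrE// lerDr.
- rewrite (le_trans d1)// mulrA ler_wpM2r ?(ltW t0)// ler_wpM2l//.
  by rewrite (le_trans e1)// lerDl invr_ge0 ltW.
Qed.

Lemma integrable_phase b x y : 0 <= x ->
  mu.-integrable `]0, +oo[ (EFin \o (fun t => phase b x y t * t `^ (- a))).
Proof.
move=> x0.
apply: (@le_integrableR _ _ _ mu _ _ (fun t => (2 + (x + `|y|)) * stable_dom a t)) => //.
- by apply: measurable_funTS; apply: measurable_funM; [exact: measurable_phase|exact: measurable_powR].
- move=> t; rewrite /= in_itv/= andbT => t0; apply: phase_dom => //.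
  by rewrite lerDl addr_ge0.
  by rewrite lerDr.
- by apply: integrable_cstM => //; exact: integrable_stable_dom.
Qed.

Lemma integrable_dphase b x y : 0 < x ->
  mu.-integrable `]0, +oo[ (EFin \o (fun t => dphase b x y t * t `^ (1 - a))).
Proof.
move=> x0.
apply: (@le_integrableR _ _ _ mu _ _ (fun t => (x + `|y|) * (1 + x^-1) * stable_dom a t)) => //.
- by apply: measurable_funTS; apply: measurable_funM; [exact: measurable_dphase|exact: measurable_powR].
- by move=> t; rewrite /= in_itv/= andbT => t0; exact: dphase_dom.
- by apply: integrable_cstM => //; exact: integrable_stable_dom.
Qed.

Lemma phase_intD b x y : 0 <= x ->
  phase_int b x y = cos b * phase_int 0 x y + sin b * phase_int (pi / 2) x y.
Proof.
move=> x0; rewrite /phase_int -!RintegralZl//; [|exact: integrable_phase|exact: integrable_phase].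
rewrite -RintegralD//.
- by apply: eq_Rintegral => t _; rewrite phaseD; ring.
- by apply: integrable_cstM => //; exact: integrable_phase.
- by apply: integrable_cstM => //; exact: integrable_phase.
Qed.

Lemma powR_cvg_pos (p : R) : 0 < p -> (n.+1%:R^-1 : R) `^ p @[n --> \oo] --> 0.
Proof.
move=> p0.
have c : (n.+1%:R^-1 : R) @[n --> \oo] --> 0^'+.
  move=> U [e /= e0 eU].
  have h : (n.+1%:R^-1 : R) @[n --> \oo] --> 0 by exact: cvg_harmonic.
  move/cvgr0_norm_lt : h => /(_ _ e0); apply: filterS => n ne.
  by apply: eU => /=; rewrite ?invr_gt0// sub0r normrN.
exact: cvg_comp c (powR_cvg0 p0).
Qed.

(* integration by parts; the boundary terms vanish at 0 since a < 2 and at infinity since 1 < a *)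
Lemma dphase_intE b x y : 0 < x -> dphase_int b x y = (a - 1) * phase_int b x y.
Proof.
move=> x0; apply/eqP; rewrite -subr_eq0; apply/eqP.
pose h t := dphase b x y t * t `^ (1 - a) - (a - 1) * (phase b x y t * t `^ (- a)).
pose Q t := phase b x y t * t `^ (1 - a).
have dQ t : 0 < t -> is_derive t 1 Q (h t).
  move=> t0; have d1 := is_derive1_powR (1 - a) t0; have d2 := is_derive_phase b x y t.
  apply: is_derive_eq; rewrite /h /GRing.scale /=.
  have -> : 1 - a - 1 = - a by ring.
  by ring.
have cQ t : 0 < t -> {for t, continuous Q} by move=> t0; exact: is_derive_continuous (dQ _ t0).
have ip := integrable_phase b y (ltW x0).
have id := integrable_dphase b y x0.
have ih : mu.-integrable `]0, +oo[ (EFin \o h).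
  have mI : measurable (`]0, +oo[%classic : set (measurableTypeR R)) by exact: measurable_itv.
  have := integrableB mI id (integrable_cstM (a - 1) mI ip).
  by apply: eq_integrable.
have <- : \int[mu]_(t in `]0, +oo[) h t = dphase_int b x y - (a - 1) * phase_int b x y.
  rewrite /h RintegralB//; last exact: integrable_cstM.
  by rewrite RintegralZl.
(* Compact intervals exhausting the half-line; the offset 2 keeps the endpoints 1/(n+2) and n+2
   distinct. *)
pose I n : set R := `[n.+2%:R^-1, n.+2%:R]%classic.
have In n : n.+2%:R^-1 < n.+2%:R :> R.
  by rewrite (@lt_trans _ _ 1) ?invf_lt1 ?ltr1n.
have c1 : \int[mu]_(t in I n) h t @[n --> \oo] --> \int[mu]_(t in `]0, +oo[) h t.
  apply: Rintegral_cvg_sets => //.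
  - by move=> n; exact: measurable_itv.
  - move=> n t; rewrite /I /= !in_itv/= andbT => /andP[nt _].
    by rewrite (lt_le_trans _ nt)// invr_gt0.
  - move=> t; rewrite /= in_itv/= andbT => t0.
    near=> n; rewrite /I /= in_itv/=; apply/andP; split.
      rewrite invf_ple ?posrE// (@le_trans _ _ n%:R) ?ler_nat ?leqW//.
      by near: n; exact: nbhs_infty_ger.
    rewrite (@le_trans _ _ n%:R) ?ler_nat ?leqW//.
    by near: n; exact: nbhs_infty_ger.
have E n : \int[mu]_(t in I n) h t = Q n.+2%:R - Q n.+2%:R^-1.
  have n0 : 0 < n.+2%:R^-1 :> R by rewrite invr_gt0.
  rewrite /Rintegral (@continuous_FTC2 _ _ Q)//.
  - apply: continuous_in_subspaceT => t; rewrite inE/= in_itv/= => /andP[nt _].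
    have t0 : 0 < t by exact: lt_le_trans nt.
    rewrite /h; apply: cvgB; first apply: cvgM; [exact: continuous_dphase| |].
      exact: is_derive_continuous (is_derive1_powR _ t0).
    apply: cvgMr; apply: cvgM; first exact: continuous_phase.
    exact: is_derive_continuous (is_derive1_powR _ t0).
  - split=> [t||]; [rewrite in_itv/= => /andP[nt _]| |].
    + by case: (dQ t (lt_trans n0 nt)).
    + by apply: cvg_at_right_filter; exact: cQ.
    + by apply: cvg_at_left_filter; apply: cQ.
  - move=> t; rewrite in_itv/= => /andP[nt _]; rewrite derive1E.
    by case: (dQ t (lt_trans n0 nt)).
rewrite (funext E) in c1.
apply: (cvg_unique (@Rhausdorff R) c1).
rewrite -(subrr 0); apply: cvgB.
- have p0 : 0 < a - 1 by rewrite subr_gt0.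
  have := powR_cvg_pos p0; rewrite -(cvg_shiftn 1) => c.
  apply/norm_cvg0P.
  apply: (@squeeze_cvgr _ _ _ _ (cst 0) (fun n => 2 * (n + 1).+1%:R^-1 `^ (a - 1))); last 2 first.
  + exact: cvg_cst.
  + by rewrite -[X in _ --> X](mulr0 2); apply: cvgMr.
  apply: nearW => n; rewrite normr_ge0/= /Q normrM (ger0_norm (powR_ge0 _ _)).
  rewrite ler_pM ?norm_phase_le2 ?(ltW x0)//.
  by rewrite addn1 -powR_inv1// -powRrM mulN1r opprB.
- have p0 : 0 < 2 - a by rewrite subr_gt0.
  have := powR_cvg_pos p0; rewrite -(cvg_shiftn 1) => c.
  apply/norm_cvg0P.
  apply: (@squeeze_cvgr _ _ _ _ (cst 0) (fun n => (x + `|y|) * (n + 1).+1%:R^-1 `^ (2 - a))); last 2 first.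
  + exact: cvg_cst.
  + by rewrite -[X in _ --> X](mulr0 (x + `|y|)); apply: cvgMr.
  apply: nearW => n; rewrite normr_ge0/= /Q normrM (ger0_norm (powR_ge0 _ _)).
  have n0 : 0 < n.+2%:R^-1 :> R by rewrite invr_gt0.
  rewrite (@le_trans _ _ ((x + `|y|) * n.+2%:R^-1 * n.+2%:R^-1 `^ (1 - a)))//.
    by rewrite ler_wpM2r ?powR_ge0// norm_phase_le// ltW.
  rewrite addn1 -mulrA ler_wpM2l ?addr_ge0 ?(ltW x0)//.
  have -> : 2 - a = 1 - (a - 1) by ring.
  by rewrite -(mulr_powRN (a - 1) n0) opprB.
Unshelve. all: by end_near. Qed.

End rotation.

(** * Transport along a spiral to the imaginary axis *)

Section rotation_ode.
Context {R : realType}.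
Notation mu := (@lebesgue_measure R).
Variable a : R.
Hypotheses (a1 : 1 < a) (a2 : a < 2).
Variables k om : R.
Implicit Types b s t : R.
Hypotheses (om0 : 0 < om) (ompi : om <= pi / 2).

(* z(s) = exp (s (k + i om)) = spiral_re s + i spiral_im s *)
Definition spiral_re (s : R) : R := expR (k * s) * cos (om * s).
Definition spiral_im (s : R) : R := expR (k * s) * sin (om * s).
Notation X := spiral_re.
Notation Y := spiral_im.

(** The spiral satisfies z' = (k + i om) z, and the factor i is the phase shift by pi/2. *)
Lemma is_derive_phase_spiral b t s :
  is_derive s 1 (fun s => phase b (X s) (Y s) t)
    (t * (k * dphase b (X s) (Y s) t + om * dphase (b + pi / 2) (X s) (Y s) t)).
Proof.
rewrite /X /Y /phase; apply: is_derive_eq.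
rewrite /dphase /GRing.scale /=.
have -> : b + pi / 2 - expR (k * s) * sin (om * s) * t = b - expR (k * s) * sin (om * s) * t + pi / 2 by ring.
rewrite cosDpihalf sinDpihalf.
ring.
Qed.

Let opi s1 : 0 <= s1 -> s1 <= 1 -> 0 <= om * s1 <= pi.
Proof.
move=> s10 s11; rewrite mulr_ge0 ?(ltW om0)//= (@le_trans _ _ (pi / 2))//.
  by rewrite (le_trans _ ompi)// ler_piMr// ltW.
by rewrite ler_pdivrMr// ler_peMr ?pi_ge0// ler1n.
Qed.

(** The angle om s can reach pi/2 only at |s| = 1, so on smaller intervals the real part stays away
    from 0. The witness is a lower bound e^(-|k|) for the modulus times the smallest cosine. *)
Let spiral_bound (s1 : R) : 0 <= s1 -> s1 < 1 -> exists2 x0, 0 < x0 &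
  forall s, - s1 <= s -> s <= s1 -> x0 <= X s.
Proof.
move=> s10 s11.
have o1 : om * s1 < pi / 2 by rewrite (lt_le_trans _ ompi)// gtr_pMr.
have c0 : 0 < cos (om * s1).
  apply: cos_gt0_pihalf; rewrite o1 andbT (@lt_le_trans _ _ 0)//.
    by rewrite oppr_lt0 divr_gt0 ?pi_gt0.
  by rewrite mulr_ge0// ltW.
exists (expR (- `|k|) * cos (om * s1)); first by rewrite mulr_gt0 ?expR_gt0.
move=> s ns sn.
have s_le : `|s| <= s1 by rewrite ler_norml ns.
rewrite /X ler_pM ?expR_ge0 ?(ltW c0)//.
  rewrite ler_expR lerNl (le_trans (ler_norm _))// normrN normrM.
  by rewrite ler_piMr// (le_trans s_le)// ltW.
rewrite -[cos (om * s)]cos_norm normrM (gtr0_norm om0).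
have [s_lt|s_ge] := ltP `|s| s1; last by rewrite (_ : `|s| = s1)//; apply/eqP; rewrite eq_le s_le.
rewrite ltW// ltr_cos ?in_itv/= ?opi ?(ltW s11)// ?ltr_pM2l//.
by rewrite (le_trans s_le)// ltW.
Qed.

Let spiral_norm s : - 1 <= s -> s <= 1 -> `|X s| + `|Y s| <= 2 * expR `|k|.
Proof.
move=> ns sn.
have sk : k * s <= `|k|.
  by rewrite (le_trans (ler_norm _))// normrM ler_piMr// ler_norml ns.
have e1 : expR (k * s) <= expR `|k| by rewrite ler_expR.
rewrite (_ : 2 * expR `|k| = expR `|k| + expR `|k|); last by rewrite mulr_natl.
rewrite /X /Y !normrM (ger0_norm (expR_ge0 _)) lerD//.
  by rewrite (le_trans _ e1)// ler_piMr ?expR_ge0// norm_cos_le1.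
by rewrite (le_trans _ e1)// ler_piMr ?expR_ge0// ler_norml sin_geN1 sin_le1.
Qed.

Let spiral_re_ge0 s : 0 <= s -> s <= 1 -> 0 <= X s.
Proof.
move=> s0 s1; rewrite mulr_ge0 ?expR_ge0// cos_ge0_pihalf//.
rewrite (@le_trans _ _ 0) ?oppr_le0 ?divr_ge0 ?pi_ge0 ?mulr_ge0 ?(ltW om0)//=.
by rewrite (le_trans _ ompi)// ler_piMr// ltW.
Qed.

Lemma is_derive_phase_int b s : -1 < s -> s < 1 ->
  is_derive s 1 (fun s => phase_int a b (X s) (Y s))
    ((a - 1) * (k * phase_int a b (X s) (Y s) + om * phase_int a (b + pi / 2) (X s) (Y s))).
Proof.
move=> ns s1.
(* The midpoint between |s| and 1 gives a neighbourhood of s on which the real part has a positive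
   lower bound. *)
pose s2 := (`|s| + 1) / 2.
have sn : `|s| < 1 by rewrite ltr_norml ns.
have s20 : 0 <= s2 by rewrite divr_ge0// addr_ge0.
have s21 : s2 < 1 by rewrite ltr_pdivrMr// mul1r (_ : 2 = 1 + 1)// ltrD2r.
have ss2 : `|s| < s2 by rewrite ltr_pdivlMr// mulrDr mulr1 ltrD2l.
have [x0 x00 xX] := spiral_bound s20 s21.
pose f s t := phase b (X s) (Y s) t * t `^ (- a).
pose I : set R := `]- s2, s2[%classic.
have Is : I s by rewrite /I /= in_itv/=; rewrite -ltr_norml.
have Ib u : I u -> [/\ - s2 <= u, u <= s2, -1 <= u & u <= 1].
  rewrite /I /= in_itv/= => /andP[/ltW u1 /ltW u2]; split=> //.
    by rewrite (le_trans _ u1)// lerN2 ltW.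
  by rewrite (le_trans u2)// ltW.
have XI u : I u -> x0 <= X u by move=> /Ib[u1 u2 _ _]; exact: xX.
have df (u t : R) : is_derive u 1 (f^~ t)
   (t * (k * dphase b (X u) (Y u) t + om * dphase (b + pi / 2) (X u) (Y u) t) * t `^ (- a)).
  have d1 := is_derive_phase_spiral b t u.
  by rewrite /f; apply: is_derive_eq; rewrite /GRing.scale /=; ring.
(* 2 e^|k| bounds |Re z| + |Im z| on the spiral, and 1 + 1/x0 comes from [dphase_dom]. *)
pose C := 2 * expR `|k| * (1 + x0^-1).
have C0 : 0 <= C by rewrite mulr_ge0// ?mulr_ge0 ?expR_ge0// addr_ge0// invr_ge0 ltW.
pose G t := (`|k| + om) * (C * `|stable_dom a t|).
have mI : measurable (`]0, +oo[%classic : set (measurableTypeR R)) by exact: measurable_itv.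
have e u t : I u -> 0 < t -> (partial1of2 f) u t =
   k * (dphase b (X u) (Y u) t * t `^ (1 - a)) + om * (dphase (b + pi / 2) (X u) (Y u) t * t `^ (1 - a)).
  move=> Iu t0; rewrite partial1of2E; have [_ ->] := df u t.
  by rewrite -mulr_powRN//; ring.
have c := @cvg_differentiation_under_integral R _ _ mu f (`]0, +oo[%classic : set R) mI s (- s2) s2 Is _ _ G _ _ _.
have {}c : h^-1 *: (phase_int a b (X (h + s)) (Y (h + s)) - phase_int a b (X s) (Y s)) @[h --> 0^'] -->
    \int[mu]_(y in `]0, +oo[) (partial1of2 f) s y.
  apply: c.
  - by move=> u /XI xu; apply: integrable_phase => //; rewrite (le_trans _ xu)// ltW.
  - by move=> u t _ _; case: (df u t).
  - by move=> t; rewrite /G mulr_ge0 ?addr_ge0 ?(ltW om0)// mulr_ge0.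
  - apply: integrable_cstM => //; apply: integrable_cstM => //.
    by apply: integrable_norm => //; exact: integrable_stable_dom.
  - move=> u t Iu; rewrite /= in_itv/= andbT => t0.
    rewrite e//.
    have [_ _ u1 u2] := Ib _ Iu.
    have xu := XI _ Iu.
    have B b' : `|dphase b' (X u) (Y u) t * t `^ (1 - a)| <= C * `|stable_dom a t|.
      rewrite (ger0_norm (stable_dom_ge0 a t0)); apply: dphase_dom => //.
      have := spiral_norm u1 u2; apply: le_trans; rewrite lerD2r ler_norm//.
    rewrite (le_trans (ler_normD _ _))// !(normrM k) !(normrM om) (gtr0_norm om0) /G [leRHS]mulrDl.
    by rewrite lerD// ler_wpM2l// ltW.
have xs : 0 < X s by rewrite (lt_le_trans x00)// XI.
have E : \int[mu]_(y in `]0, +oo[) (partial1of2 f) s y =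
   (a - 1) * (k * phase_int a b (X s) (Y s) + om * phase_int a (b + pi / 2) (X s) (Y s)).
  transitivity (\int[mu]_(t in `]0, +oo[) (k * (dphase b (X s) (Y s) t * t `^ (1 - a)) + om * (dphase (b + pi / 2) (X s) (Y s) t * t `^ (1 - a)))).
    by apply: eq_Rintegral => t; rewrite inE/= in_itv/= andbT => t0; rewrite e.
  rewrite RintegralD//; [|by apply: integrable_cstM => //; exact: integrable_dphase..].
  rewrite !RintegralZl//; [|exact: integrable_dphase..].
  by rewrite -/(dphase_int a b _ _) -/(dphase_int a (b + pi / 2) _ _) !dphase_intE//; ring.
rewrite -E; apply: DeriveDef.
  by apply/cvg_ex; eexists; under eq_fun do rewrite scaler1; exact: c.
rewrite -derive1E /derive1.
by apply/cvg_lim => //; exact: c.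
Qed.

(** The real part of e^(ib) z(s)^(1-a) K(z(s)), a constant of motion of the differential
    equation. *)
Let N (b s : R) : R := expR (- ((a - 1) * k) * s) *
  (cos (b - (a - 1) * om * s) * phase_int a 0 (X s) (Y s) +
   sin (b - (a - 1) * om * s) * phase_int a (pi / 2) (X s) (Y s)).

Let derive_N b s : -1 < s -> s < 1 -> is_derive s 1 (N b) 0.
Proof.
move=> ns s1.
have d1 := is_derive_phase_int 0 ns s1.
have d2 := is_derive_phase_int (pi / 2) ns s1.
rewrite add0r in d1; rewrite -splitr in d2.
have sn : `|s| < 1 by rewrite ltr_norml ns.
have [x0 x00 xX] := spiral_bound (normr_ge0 s) sn.
have x0s : 0 <= X s by rewrite (le_trans (ltW x00))// xX ?lerNnormlW ?ler_norm.
(* Two quarter turns make the phase pi, a change of sign; this closes the system for the phases 0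
   and pi/2. *)
have Epi := @phase_intD R a a1 a2 pi (X s) (Y s) x0s.
rewrite cospi sinpi mul0r addr0 mulN1r in Epi.
rewrite Epi in d2.
rewrite /N; apply: is_derive_eq; rewrite /GRing.scale /=.
move: (phase_int _ _ _ _) (phase_int _ _ _ _) => A B.
ring.
Qed.

Let N_cst b s : 0 <= s -> s < 1 -> N b s = N b 0.
Proof.
rewrite le_eqVlt => /predU1P[<-//|s0] s1.
have c : {within `[0, s], continuous (N b)}.
  apply: continuous_in_subspaceT => u; rewrite inE/= in_itv/= => /andP[u0 us].
  apply: is_derive_continuous (derive_N b _ _); first by rewrite (lt_le_trans _ u0).
  exact: le_lt_trans s1.
have d u : u \in `]0, s[ -> is_derive u 1 (N b) (cst 0 u).
  rewrite in_itv/= => /andP[u0 us]; apply: derive_N; last exact: lt_trans s1.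
  exact: lt_trans u0.
have [u _] := MVT s0 d c.
by rewrite mul0r => /eqP; rewrite subr_eq0 => /eqP.
Qed.

(* the solution K (z(1)) = z(1)^(a-1) K (1) of the differential equation K' = (a - 1) (k + i om) K *)
Lemma phase_int_spiral b :
  phase_int a (b - (a - 1) * om) (X 1) (Y 1) = expR ((a - 1) * k) * (cos b * phase_int a 0 1 0).
Proof.
(* At s = 1 the real part of z may vanish and the differential equation is lost. The endpoint is
   reached as a limit, under the domination of [phase_dom], which holds up to the imaginary axis. *)
pose s_ n : R := 1 - n.+1%:R^-1.
have s0 n : 0 <= s_ n by rewrite subr_ge0 invf_le1// ler1n.
have s1 n : s_ n < 1 by rewrite ltrBlDr ltrDl invr_gt0.
have cs : s_ n @[n --> \oo] --> (1 : R).
  by rewrite -[X in _ --> X]subr0; apply: cvgB; [exact: cvg_cst|exact: cvg_harmonic].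
have cX : X (s_ n) @[n --> \oo] --> X 1.
  have d : derivable X 1 1 by rewrite /X; apply: ex_derive.
  have c : {for (1 : R), continuous X}.
    by apply: differentiable_continuous; apply/derivable1_diffP.
  exact: cvg_comp cs c.
have cY : Y (s_ n) @[n --> \oo] --> Y 1.
  have d : derivable Y 1 1 by rewrite /Y; apply: ex_derive.
  have c : {for (1 : R), continuous Y}.
    by apply: differentiable_continuous; apply/derivable1_diffP.
  exact: cvg_comp cs c.
have cI b' : phase_int a b' (X (s_ n)) (Y (s_ n)) @[n --> \oo] --> phase_int a b' (X 1) (Y 1).
  apply: (@Rdominated_cvg _ _ _ mu _ _ _ (fun t => (2 + 2 * expR `|k|) * stable_dom a t)) => //.
  - move=> n; apply: measurable_funTS; apply: measurable_funM; [exact: measurable_phase|exact: measurable_powR].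
  - move=> t _; apply: cvgMl; apply: cvgB; first exact: cvg_cst.
    apply: cvgM.
      apply: continuous_cvg; first exact: continuous_expR.
      by apply: cvgMl; apply: cvgN.
    apply: continuous_cvg; first exact: continuous_cos.
    by apply: cvgB; [exact: cvg_cst|exact: cvgMl].
  - by apply: integrable_cstM => //; exact: integrable_stable_dom.
  - move=> n t; rewrite /= in_itv/= andbT => t0.
    have xn := spiral_re_ge0 (s0 n) (ltW (s1 n)).
    apply: phase_dom => //.
      by rewrite lerDl mulr_ge0 ?expR_ge0.
    have m1 : -1 <= s_ n by rewrite (le_trans _ (s0 n)).
    have := spiral_norm m1 (ltW (s1 n)); rewrite (ger0_norm xn) => /le_trans; apply.
    by rewrite lerDr.
have cN : N b (s_ n) @[n --> \oo] --> N b 1.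
  rewrite /N; apply: cvgM.
    apply: continuous_cvg; first exact: continuous_expR.
    exact: cvgMr.
  have cb : b - (a - 1) * om * s_ n @[n --> \oo] --> b - (a - 1) * om * 1.
    by apply: cvgB; [exact: cvg_cst|exact: cvgMr].
  apply: cvgD; apply: cvgM => //; apply: continuous_cvg => //.
    exact: continuous_cos.
  exact: continuous_sin.
have N10 : N b 1 = N b 0.
  apply/esym/(cvg_unique (@Rhausdorff R) _ cN).
  by apply: cvg_near_cst; apply: nearW => n; exact: N_cst.
rewrite phase_intD//; last exact: spiral_re_ge0.
have -> : cos (b - (a - 1) * om) * phase_int a 0 (X 1) (Y 1) +
   sin (b - (a - 1) * om) * phase_int a (pi / 2) (X 1) (Y 1) = expR ((a - 1) * k) * N b 1.
  by rewrite /N !mulr1 mulrA expRN divff ?mul1r// gt_eqF// expR_gt0.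
rewrite N10 /N /X /Y !mulr0 subr0 expR0 cos0 sin0 !mul1r.
congr (_ * _).
(* K(1) is real, and the phase pi/2 extracts minus its imaginary part. *)
suff -> : phase_int a (pi / 2) 1 0 = 0 by rewrite mulr0 addr0.
transitivity (\int[mu]_(t in `]0, +oo[) (0 : R)); last by rewrite Rintegral_cst ?mul0r.
by apply: eq_Rintegral => t _; rewrite /phase mul0r subr0 cos_pihalf mulr0 subr0 mul0r.
Qed.

End rotation_ode.

(** * Closed form of the kernel h *)

Section stable_kernel.
Context {R : realType}.
Notation mu := (@lebesgue_measure R).
Variables a rho : R.
Hypotheses (a1 : 1 < a) (a2 : a < 2).
Notation c := (stable_c a rho).

(** Integration by parts at z = 1 gives (a - 1) K(1) = Gamma(2 - a), while the continuation defines
    Gamma(1 - a) as Gamma(2 - a) / (1 - a); hence the minus sign. *)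
Lemma phase_int_one : phase_int a 0 1 0 = - Gamma1m a.
Proof.
have al : a - 1 != 0 by rewrite subr_eq0 gt_eqF.
apply: (mulfI al); rewrite -dphase_intE//.
have -> : dphase_int a 0 1 0 = GammaPos (2 - a).
  apply: eq_Rintegral => t _; rewrite /dphase !mul0r !subr0 mulN1r cos0 !mulr1 mulrC.
  by congr (_ `^ _ * _); ring.
rewrite /Gamma1m; move: (GammaPos _) => G; field.
by rewrite -opprB oppr_eq0.
Qed.

Lemma phase_int_imag b (z : R) : 0 < z ->
  phase_int a b 0 z = - Gamma1m a * z `^ (a - 1) * cos (b + (a - 1) * (pi / 2)).
Proof.
move=> z0.
have pi2 : 0 < pi / 2 :> R by rewrite divr_gt0 ?pi_gt0.
(* With k = ln z and om = pi/2 the spiral ends at iz; adding (a - 1) pi/2 to b compensates the turn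
   of the phase along the way. *)
have := @phase_int_spiral R a a1 a2 (ln z) (pi / 2) pi2 (lexx _) (b + (a - 1) * (pi / 2)).
rewrite /spiral_re /spiral_im !mulr1 cos_pihalf sin_pihalf mulr0 mulr1 (lnK z0) addrK => ->.
rewrite phase_int_one.
have -> : expR ((a - 1) * ln z) = z `^ (a - 1) by rewrite /powR gt_eqF.
ring.
Qed.

(* the integrand is Re ((1 - e^(-izt)) / Psi(t)) *)
Definition stable_kernel (z : R) : R :=
  pi^-1 * \int[mu]_(t in `]0, +oo[) ((cos c - cos (c + z * t)) * t `^ (- a)).

Lemma stable_kernelE (z : R) : z != 0 ->
  stable_kernel z = - pi^-1 * Gamma1m a * (`|z| `^ (a - 1) * Defs.sfun a rho z).
Proof.
move=> z0; rewrite /stable_kernel /Defs.sfun.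
have [zp|zn] := ltP 0 z.
- rewrite (gtr0_norm zp) (ltW zp).
  have -> : \int[mu]_(t in `]0, +oo[) ((cos c - cos (c + z * t)) * t `^ (- a)) = phase_int a (- c) 0 z.
    apply: eq_Rintegral => t _; rewrite /phase mulNr mul0r oppr0 expR0 mul1r cosN.
    by rewrite -[in RHS]opprD cosN.
  rewrite phase_int_imag//.
  (* The rotation of the spiral and the angle c of the exponent add up to pi a rho - pi/2, whose
     cosine is sin (pi a rho). For negative z the sign of c flips and rho becomes 1 - rho. *)
  have -> : - c + (a - 1) * (pi / 2) = - (pi / 2 - pi * a * rho) by rewrite /stable_c; field.
  rewrite cosN cosB cos_pihalf sin_pihalf mul0r mul1r add0r.
  ring.
- have {}zn : z < 0 by rewrite lt_neqAle z0.
  rewrite (ltr0_norm zn) leNgt zn/=.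
  have zn' : 0 < - z by rewrite oppr_gt0.
  have -> : \int[mu]_(t in `]0, +oo[) ((cos c - cos (c + z * t)) * t `^ (- a)) = phase_int a c 0 (- z).
    apply: eq_Rintegral => t _; rewrite /phase mulNr mul0r oppr0 expR0 mul1r.
    by rewrite mulNr opprK.
  rewrite phase_int_imag//.
  have -> : c + (a - 1) * (pi / 2) = - (pi / 2 - pi * a * (1 - rho)) by rewrite /stable_c; field.
  rewrite cosN cosB cos_pihalf sin_pihalf mul0r mul1r add0r.
  ring.
Qed.

Lemma stable_kernel0 : stable_kernel 0 = 0.
Proof.
rewrite /stable_kernel.
transitivity (pi^-1 * \int[mu]_(t in `]0, +oo[) (0 : R)); last by rewrite Rintegral_cst ?mul0r ?mulr0.
by congr (_ * _); apply: eq_Rintegral => t _; rewrite mul0r addr0 subrr mul0r.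
Qed.

Lemma u0_stable_kernel (x y : R) : x != 0 ->  y != 0 ->
  u0 a rho x y = stable_kernel (- x) + stable_kernel y - stable_kernel (y - x).
Proof.
move=> x0 y0; rewrite (stable_kernelE y0) stable_kernelE ?oppr_eq0// normrN /u0.
have [->|yx] := eqVneq y x.
  by rewrite subrr stable_kernel0 normr0 powR0 ?subr_eq0 ?gt_eqF//; ring.
by rewrite stable_kernelE ?subr_eq0//; ring.
Qed.

End stable_kernel.

(** * The resolvent density for small rates *)

Section resolvent_density.
Context {R : realType}.
Notation mu := (@lebesgue_measure R).
Variables a rho : R.
Hypotheses (a1 : 1 < a) (a2 : a < 2).
Notation c := (stable_c a rho).
Hypothesis cc : 0 < cos c.
Notation r := (psi_re a rho).
Notation m := (psi_im a rho).
Notation L := (resolvent_cos r m).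

Definition resolvent_density (q z : R) : R :=
  pi^-1 * \int[mu]_(th in `]0, +oo[) L q th (- (th * z)).

Definition resolvent_bound (q th : R) : R :=
  q * (q + r th + `|m th|) / ((q + r th) ^+ 2 + m th ^+ 2).

Let mr : measurable_fun setT r.
Proof.
apply: measurable_funM => //.
apply: (measurableT_comp (f:=fun x : R => x `^ a)); first exact: measurable_powR.
exact: normr_measurable.
Qed.

Let mm : measurable_fun setT m.
Proof.
apply: measurable_funM => //.
apply: (measurableT_comp (f:=fun x : R => x `^ a)); first exact: measurable_powR.
exact: normr_measurable.
Qed.

Let mcos : measurable_fun setT (@cos R).
Proof. exact: measurable_cos. Qed.
Let msin : measurable_fun setT (@sin R).
Proof. exact: measurable_sin. Qed.

Let r_gt0 th : 0 < th -> 0 < r th.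
Proof. by move=> t0; rewrite mulr_gt0// powR_gt0// normr_gt0 gt_eqF. Qed.

Let D_gt0 q th : 0 < q -> 0 < (q + r th) ^+ 2 + m th ^+ 2.
Proof.
move=> q0; rewrite ltr_wpDr ?sqr_ge0// exprn_gt0// ltr_wpDr//.
by rewrite mulr_ge0 ?powR_ge0// ltW.
Qed.

Let m_le th : `|m th| <= (cos c)^-1 * r th.
Proof.
rewrite mulrC /psi_re mulfK ?gt_eqF// /psi_im normrM (ger0_norm (powR_ge0 _ _)).
by rewrite ler_piMr ?powR_ge0// ler_norml sin_geN1 sin_le1.
Qed.

Let measurable_div (f g : R -> R) : measurable_fun setT f -> measurable_fun setT g ->
  (forall x, 0 < g x) -> measurable_fun setT (fun x => f x / g x).
Proof.
move=> mf mg g0; apply: measurable_funM => //.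
rewrite (_ : (fun x => (g x)^-1) = (fun x => (g x) `^ (-1))); last first.
  by apply/funext => x; rewrite powR_inv1// ltW.
by apply: (measurableT_comp (f:=fun x : R => x `^ (-1))); [exact: measurable_powR|].
Qed.

Let mqr q : measurable_fun setT (fun th => q + r th).
Proof. exact: measurable_funD. Qed.

Let mD q : measurable_fun setT (fun th => (q + r th) ^+ 2 + m th ^+ 2).
Proof. by apply: measurable_funD; exact: measurable_funX. Qed.

Let powR_frac q th : 0 < q -> 0 < th -> th `^ a / (q + r th) <= (cos c)^-1.
Proof.
move=> q0 t0; rewrite ler_pdivrMr ?addr_gt0 ?r_gt0// mulrC ler_pdivlMr//.
by rewrite /psi_re (gtr0_norm t0) lerDr ltW.
Qed.

Lemma measurable_resolvent_bound q : 0 < q -> measurable_fun setT (resolvent_bound q).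
Proof.
move=> q0; apply: measurable_div => [||th]; last exact: D_gt0.
- apply: measurable_funM => //; apply: measurable_funD => //.
  exact: measurableT_comp.
- exact: mD.
Qed.

Lemma measurable_resolvent_cos q (f : R -> R) : 0 < q -> measurable_fun setT f ->
  measurable_fun setT (fun th => L q th (f th)).
Proof.
move=> q0 mf; apply: measurable_div => [||th]; last exact: D_gt0.
- apply: measurable_funM => //; apply: measurable_funD; apply: measurable_funM => //.
  + exact: measurableT_comp.
  + exact: measurableT_comp.
- exact: mD.
Qed.

(* 1 / cos c bounds |m| / r *)
Let frac_le q th : 0 < q -> 0 < th ->
  (q + r th + `|m th|) / ((q + r th) ^+ 2 + m th ^+ 2) <= (1 + (cos c)^-1) / (q + r th).
Proof.
move=> q0 t0.
have qr : 0 < q + r th by rewrite addr_gt0// r_gt0.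
rewrite ler_pdivrMr ?D_gt0// mulrAC ler_pdivlMr//.
have h1 : (q + r th + `|m th|) <= (1 + (cos c)^-1) * (q + r th).
  rewrite mulrDl mul1r lerD2l (le_trans (m_le _))// ler_wpM2l ?invr_ge0 ?(ltW cc)//.
  by rewrite lerDr ltW.
rewrite (@le_trans _ _ ((1 + (cos c)^-1) * (q + r th) ^+ 2))//.
  by rewrite expr2 mulrA ler_wpM2r// ltW.
by rewrite ler_wpM2l ?addr_ge0 ?invr_ge0 ?(ltW cc)// lerDl sqr_ge0.
Qed.

(** Up to the factor 1 + 1/cos c the bound is q / (q + r): at most 1 for small th and at most (q /
    cos c) th^(-a) for large th, integrable because a > 1. *)
Lemma integrable_resolvent_bound q : 0 < q -> mu.-integrable `]0, +oo[ (EFin \o resolvent_bound q).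
Proof.
move=> q0.
pose C := (1 + (cos c)^-1) * (1 + q / cos c).
apply: (@le_integrableR _ _ _ mu _ _ (fun th => C * stable_dom a th)) => //.
- by apply: measurable_funTS; exact: measurable_resolvent_bound.
- move=> th; rewrite /= in_itv/= andbT => t0.
  have rt := r_gt0 t0.
  have qr : 0 < q + r th by rewrite addr_gt0.
  rewrite /resolvent_bound -mulrA normrM (gtr0_norm q0) ger0_norm; last first.
    by rewrite divr_ge0 ?(ltW (D_gt0 _ _))// addr_ge0// ltW.
  rewrite (@le_trans _ _ (q * ((1 + (cos c)^-1) / (q + r th))))//.
    by rewrite ler_pM2l// frac_le.
  rewrite mulrCA -mulrA ler_wpM2l ?addr_ge0 ?invr_ge0 ?(ltW cc)//.
  have p0 : 0 < th `^ a by exact: powR_gt0.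
  have -> : q / (q + r th) = (q / (q + r th) * th `^ a) * th `^ (- a).
    by rewrite powRN mulfK// gt_eqF.
  have qc : 0 <= q / cos c by rewrite divr_ge0 ?(ltW q0)// ltW.
  have b : q / (q + r th) * th `^ a <= q / cos c.
    by rewrite -mulrA (mulrC _^-1) ler_wpM2l ?(ltW q0)// powR_frac.
  apply: le_stable_dom => //.
  + by rewrite addr_ge0.
  + by rewrite (le_trans b)// lerDr.
  + have [x1|x1] := leP th 1; last first.
      rewrite (le_trans b)// (@le_trans _ _ (1 + q / cos c))// ?lerDr//.
      by rewrite ler_peMr ?(ltW x1)// addr_ge0.
    have h1 : th `^ a <= th by rewrite ge1r_powR ?t0// ltW.
    rewrite ler_pM ?powR_ge0 ?divr_ge0 ?(ltW q0) ?(ltW qr)//.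
    rewrite ler_pdivrMr// (@le_trans _ _ (1 * (q + r th)))//.
      by rewrite mul1r lerDl ltW.
    by rewrite ler_wpM2r ?(ltW qr)// lerDl.
- by apply: integrable_cstM => //; exact: integrable_stable_dom.
Qed.

Lemma integrable_resolvent_cos q z : 0 < q ->
  mu.-integrable `]0, +oo[ (EFin \o (fun th => L q th (- (th * z)))).
Proof.
move=> q0; apply: (@le_integrableR _ _ _ mu _ _ (resolvent_bound q)) => //.
- apply: measurable_funTS; apply: measurable_resolvent_cos => //.
  by apply: measurableT_comp => //; exact: measurable_funM.
- move=> th _; apply: resolvent_cos_bound => // t.
  by rewrite mulr_ge0 ?powR_ge0// ltW.
- exact: integrable_resolvent_bound.
Qed.

Definition resolvent_gap (q z : R) : R := (resolvent_density q 0 - resolvent_density q z) / q.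

(** The integrand is Re ((1 - e^(-i th z)) / (q + r + im)). At q = 0 the denominator alone would
    leave th^(-a), not integrable at 0; the numerator is of order th there and restores
    integrability, so the gap has a limit although U(0)/q diverges. *)
Lemma resolvent_gapE q z : 0 < q ->
  resolvent_gap q z = pi^-1 * \int[mu]_(th in `]0, +oo[)
    (((q + r th) * phase 0 0 z th - m th * phase (pi / 2) 0 z th) / ((q + r th) ^+ 2 + m th ^+ 2)).
Proof.
move=> q0; rewrite /resolvent_gap /resolvent_density -mulrBr -mulrA; congr (_ * _).
rewrite -RintegralB//; [|exact: integrable_resolvent_cos..].
rewrite mulrC -RintegralZl//; last first.
  have mI : measurable (`]0, +oo[%classic : set (measurableTypeR R)) by exact: measurable_itv.
  have := integrableB mI (integrable_resolvent_cos 0 q0) (integrable_resolvent_cos z q0).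
  by apply: eq_integrable.
apply: eq_Rintegral => th; rewrite inE/= in_itv/= andbT => t0.
rewrite /phase /resolvent_cos oppr0 mulr0 oppr0 mul0r expR0 sub0r !cosN !sinN cos0 sin0 cos_pihalf.
rewrite [pi / 2 - _]addrC cosDpihalf sinN (mulrC z).
have := D_gt0 th q0; set D := _ + _ => D0.
by field; rewrite !gt_eqF.
Qed.

Lemma phase_dom0 b z th : 0 < th -> `|phase b 0 z th| * th `^ (- a) <= (2 + `|z|) * stable_dom a th.
Proof.
move=> t0.
rewrite -[X in _ * X]ger0_norm ?powR_ge0// -normrM; apply: phase_dom => //; first by rewrite lerDl.
by rewrite add0r lerDr.
Qed.

Lemma resolvent_gap_cvg (q_ : nat -> R) z : (forall n, 0 < q_ n) -> q_ @ \oo --> 0 ->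
  resolvent_gap (q_ n) z @[n --> \oo] --> stable_kernel a rho z.
Proof.
move=> q0 cq.
have E n := resolvent_gapE z (q0 n).
rewrite (funext E) /stable_kernel; apply: cvgMr.
(* Independent of q: the fraction is at most (1 + 1/cos c) / (q + r), and th^a / (q + r) is at most
   1/cos c. *)
pose C := (1 + (cos c)^-1) / cos c.
apply: (@Rdominated_cvg _ _ _ mu _ _ _ (fun th => C * ((2 + `|z|) * stable_dom a th))) => //.
- move=> n; apply: measurable_funTS; apply: measurable_div => [||th]; last exact: D_gt0.
  + by apply: measurable_funB; apply: measurable_funM => //; exact: measurable_phase.
  + exact: mD.
- move=> th; rewrite /= in_itv/= andbT => t0.
  have rt := r_gt0 t0.
  have p0 : 0 < th `^ a by exact: powR_gt0.
  have E0 : (cos c - cos (c + z * th)) * th `^ (- a) =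
     ((0 + r th) * phase 0 0 z th - m th * phase (pi / 2) 0 z th) / ((0 + r th) ^+ 2 + m th ^+ 2).
    rewrite add0r /psi_re /psi_im (gtr0_norm t0) !exprMn -mulrDr cos2Dsin2 mulr1 powRN.
    rewrite /phase oppr0 mul0r expR0 cos0 cos_pihalf sub0r cosN [pi / 2 - _]addrC cosDpihalf sinN cosD.
    by field; rewrite gt_eqF.
  rewrite E0; have D0 : (0 + r th) ^+ 2 + m th ^+ 2 != 0.
    by rewrite add0r gt_eqF// ltr_wpDr ?sqr_ge0// exprn_gt0.
  apply: cvgM.
    by apply: cvgB; [apply: cvgMl; apply: cvgD => //; exact: cvg_cst|exact: cvg_cst].
  apply: cvgV => //; apply: cvgD; last exact: cvg_cst.
  by rewrite !expr2; apply: cvgM; apply: cvgD => //; exact: cvg_cst.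
- apply: integrable_cstM => //; apply: integrable_cstM => //; exact: integrable_stable_dom.
- move=> n th; rewrite /= in_itv/= andbT => t0.
  have rt := r_gt0 t0.
  have qr : 0 < q_ n + r th by rewrite addr_gt0.
  set M := (2 + `|z|) * _.
  have p0 : 0 < th `^ a by exact: powR_gt0.
  have Mp b : `|phase b 0 z th| <= M * th `^ a.
    by rewrite -ler_pdivrMr// -powRN phase_dom0.
  have M0 : 0 <= M by rewrite mulr_ge0// ?addr_ge0// stable_dom_ge0.
  rewrite normrM [X in _ * X]gtr0_norm ?invr_gt0 ?D_gt0//.
  have step1 : `|(q_ n + r th) * phase 0 0 z th - m th * phase (pi / 2) 0 z th| <=
     (q_ n + r th + `|m th|) * (M * th `^ a).
    rewrite (le_trans (ler_normB _ _))// !normrM (gtr0_norm qr) [leRHS]mulrDl lerD//.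
      by rewrite ler_wpM2l// ltW.
    by rewrite ler_wpM2l.
  rewrite (@le_trans _ _ ((q_ n + r th + `|m th|) * (M * th `^ a) / ((q_ n + r th) ^+ 2 + m th ^+ 2)))//.
    by rewrite ler_wpM2r// invr_ge0 ltW// D_gt0.
  rewrite mulrAC.
  rewrite (@le_trans _ _ ((1 + (cos c)^-1) / (q_ n + r th) * (M * th `^ a)))//.
    by rewrite ler_wpM2r ?frac_le// mulr_ge0// powR_ge0.
  have -> : (1 + (cos c)^-1) / (q_ n + r th) * (M * th `^ a) =
    (1 + (cos c)^-1) * (th `^ a / (q_ n + r th)) * M by ring.
  by rewrite ler_wpM2r// ler_wpM2l ?powR_frac// addr_ge0// invr_ge0 ltW.
Qed.

(** The rate q = s^a is chosen so that r <= q on all of ]0, s]. There |m| <= (q + r) / cos c and q +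
    r <= 2q, which bounds the integrand below by a constant; elsewhere it is nonnegative. *)
Lemma resolvent_density0_lower (s : R) : 0 < s ->
  pi^-1 * ((1 + (cos c)^-1 ^+ 2)^-1 / 2) * s <= resolvent_density (s `^ a) 0.
Proof.
move=> s0; set k := _^-1 / 2; rewrite -mulrA /resolvent_density ler_pM2l ?invr_gt0 ?pi_gt0//.
pose q := s `^ a.
have q0 : 0 < q by exact: powR_gt0.
have k0 : 0 <= k by rewrite divr_ge0// invr_ge0 addr_ge0// sqr_ge0.
have -> : k * s = \int[mu]_(th in `]0, +oo[) ((cst k) \_ `]0, s]) th.
  rewrite -Rintegral_mkcondr setIidr; last first.
    by move=> x; rewrite /= !in_itv/= andbT => /andP[].
  rewrite Rintegral_cst//.
  by rewrite [X in fine X](@lebesgue_measure_itv R `]0, s]) /= lte_fin s0 sube0.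
apply: le_Rintegral => //.
- rewrite -restrict_EFin; apply/integrable_restrict => //.
  apply: (@integrableS _ _ _ mu `[0, s]) => //.
  + exact: measurableI.
  + by move=> x []; rewrite /= !in_itv/= andbT => _ /andP[/ltW -> ->].
  + apply: continuous_compact_integrable; first exact: segment_compact.
    by apply: continuous_subspaceT; exact: cst_continuous.
- exact: integrable_resolvent_cos.
- move=> th; rewrite /= in_itv/= andbT => t0.
  have rt := r_gt0 t0.
  have qr : 0 < q + r th by rewrite addr_gt0.
  rewrite mulr0 oppr0 /resolvent_cos cos0 sin0 mulr0 addr0 mulr1.
  rewrite patchE; case: ifPn => [|_]; last first.
    by rewrite divr_ge0 ?(ltW (D_gt0 _ _))// mulr_ge0// ltW.
  rewrite inE /= in_itv/= => /andP[_ ts].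
  have rq : r th <= q.
    rewrite /psi_re (gtr0_norm t0) (@le_trans _ _ (th `^ a))//.
      by rewrite ler_piMr ?powR_ge0// cos_le1.
    by rewrite ge0_ler_powR ?nnegrE ?(ltW t0) ?(ltW s0)// ltW// (lt_trans _ a1).
  have K0 : 0 < 1 + (cos c)^-1 ^+ 2 by rewrite ltr_wpDr// sqr_ge0.
  have Dle : (q + r th) ^+ 2 + m th ^+ 2 <= (1 + (cos c)^-1 ^+ 2) * (q + r th) ^+ 2.
    rewrite mulrDl mul1r lerD2l -exprMn -real_normK ?num_real// lerXn2r ?nnegrE//.
      by rewrite mulr_ge0 ?invr_ge0 ?(ltW cc) ?(ltW qr).
    by rewrite (le_trans (m_le _))// ler_wpM2l ?invr_ge0 ?(ltW cc)// lerDr ltW.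
  rewrite ler_pdivlMr ?D_gt0// (le_trans (ler_wpM2l k0 Dle))//.
  have -> : k * ((1 + (cos c)^-1 ^+ 2) * (q + r th) ^+ 2) = (q + r th) / 2 * (q + r th).
    rewrite /k; move: K0; set K := 1 + _ => K0; field; by rewrite gt_eqF.
  rewrite ler_wpM2r ?(ltW qr)// ler_pdivrMr// mulr_natr mulr2n lerD2l.
  by [].
Qed.

Lemma resolvent_density0_gt0 (s : R) : 0 < s -> 0 < resolvent_density (s `^ a) 0.
Proof.
move=> s0; apply: lt_le_trans (resolvent_density0_lower s0).
by rewrite !mulr_gt0 ?invr_gt0 ?pi_gt0// ltr_wpDr// sqr_ge0.
Qed.

(** With q = s^a the lower bound on U(0) is of order s, so the ratio is at most of order s^(a-1),
    which tends to 0 because a > 1. *)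
Lemma resolvent_ratio_cvg :
  (n.+1%:R^-1 : R) `^ a / resolvent_density (n.+1%:R^-1 `^ a) 0 @[n --> \oo] --> 0.
Proof.
have p0 : 0 < a - 1 by rewrite subr_gt0.
set k := pi^-1 * ((1 + (cos c)^-1 ^+ 2)^-1 / 2) : R.
have k0 : 0 < k by rewrite !mulr_gt0 ?invr_gt0 ?pi_gt0// ltr_wpDr// sqr_ge0.
apply: (@squeeze_cvgr _ _ _ _ (cst 0) (fun n => k^-1 * n.+1%:R^-1 `^ (a - 1))); last 2 first.
- exact: cvg_cst.
- by rewrite -[X in _ --> X](mulr0 k^-1); apply: cvgMr; exact: powR_cvg_pos.
apply: nearW => n.
have n0 : 0 < n.+1%:R^-1 :> R by rewrite invr_gt0.
have U0 := resolvent_density0_gt0 n0.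
apply/andP; split; first by rewrite divr_ge0 ?powR_ge0 ?(ltW U0).
rewrite ler_pdivrMr// -mulrA ler_pdivlMl//.
have E : n.+1%:R^-1 `^ a = n.+1%:R^-1 `^ (a - 1) * n.+1%:R^-1 :> R.
  by rewrite mulrC mulr_powRB1// ?ltW// (lt_trans _ a1).
by rewrite [X in k * X]E mulrCA ler_wpM2l ?powR_ge0// resolvent_density0_lower.
Qed.

End resolvent_density.

(** * Density of the killed process *)

Section killed_density.
Context {d} {T : measurableType d} {R : realType}.
Variables (P : probability T R) (a rho : R) (Y : R -> T -> R).
Hypothesis HY : is_stable_process P a rho Y.
Hypotheses (a1 : 1 < a) (a2 : a < 2).
Hypothesis cc : 0 < cos (stable_c a rho).
Variables (x q : R).
Hypothesis q0 : 0 < q.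
Notation X := (shifted Y x).
Notation r := (psi_re a rho).
Notation m := (psi_im a rho).
Notation mu := (@lebesgue_measure R).
Notation L := (resolvent_cos r m).
Notation Tn := (fun n : nat => hit_ball Y x n.+1%:R^-1).
Notation T0 := (hit_zero Y x).
Notation U := (resolvent_density a rho q).
Notation phi := (hit_zero_laplace P Y x q).

Let cosc := ltW cc.
Let r0 := psi_re_ge0 cosc.
Let mX := measurable_shifted HY x.
Let rcX w t : X s w @[s --> t^'+] --> X t w. Proof. exact: (@shifted_rc _ _ _ _ _ _ _ HY). Qed.
Let Xneg t w : t <= 0 -> X t w = X 0 w. Proof. exact: shifted_const. Qed.

Lemma norm_expectation_le (f : T -> R) (K : R) : measurable_fun setT f -> (forall w, `|f w| <= K) ->
  `|\int[P]_w f w| <= K.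
Proof.
move=> mf fK.
have ifP : P.-integrable setT (EFin \o f) by exact: (@bounded_integrable _ _ _ _ _ _ K).
rewrite (le_trans (le_normr_Rintegral _ _))//.
rewrite (@le_trans _ _ (\int[P]_w K))//.
  apply: le_Rintegral => //; last exact: finite_measure_integrable_cst.
  exact: integrable_norm.
by rewrite Rintegral_cst// [X in fine X](@probability_setT _ _ _ P) mulr1.
Qed.

Section optional.
Variable S : T -> \bar R.
Hypothesis S0 : forall w, (0 <= S w)%E.
Hypothesis pS : forall t, 0 <= t -> past_event P X r m t [set w | (S w < t%:E)%E].

Definition killed_law : {finite_measure set (measurableTypeR R) -> \bar R} :=
  killed_measure P mX rcX Xneg (optional_measurable S0 pS) q0.

Let mS := optional_measurable S0 pS.

Let ie : mu.-integrable `[0, +oo[ (EFin \o (fun t => q * expR (- q * t))).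
Proof. by apply: integrable_cstM => //; exact: integrable_expR. Qed.

Let itail (f : R -> R) : measurable_fun setT f -> (forall t, `|f t| <= 1) ->
  mu.-integrable `[0, +oo[ (EFin \o (fun t => q * expR (- q * t) * f t)).
Proof.
move=> mf f1.
apply: (@le_integrableR _ _ _ mu _ _ (fun t => q * expR (- q * t))) => //.
- apply: measurable_funTS; apply: measurable_funM => //.
  by apply: measurable_funM => //; apply: measurableT_comp.
- move=> t _; rewrite normrM ger0_norm ?mulr_ge0 ?expR_ge0 ?(ltW q0)//.
  by rewrite ler_piMr// mulr_ge0 ?expR_ge0 ?(ltW q0).
Qed.

(** The strong Markov formula at the constant time 0, where the path sits at x. That time is
    optional because the event 0 < t is either empty or the whole space. *)
Lemma resolvent_free th b : 0 < th ->
  \int[mu]_(t in `[0, +oo[) (q * expR (- q * t) * \int[P]_w cos (th * X t w + b)) = L q th (th * x + b).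
Proof.
move=> th0.
have p0 t : 0 <= t -> past_event P X r m t [set w : T | ((0 : \bar R) < t%:E)%E].
  rewrite le_eqVlt => /predU1P[<-|t0].
    rewrite (_ : [set _ | _] = set0); first exact: past_event_set0.
    by apply/seteqP; split=> w //=; rewrite ltxx.
  rewrite (_ : [set _ | _] = setT); first exact: (past_event_setT HY _ (ltW t0)).
  by apply/seteqP; split=> w //= _; rewrite lte_fin.
have := @optional_resolvent_discount _ _ _ P a rho Y HY cosc x (cst 0%E) q th b q0 th0 (fun=> lexx _) p0.
rewrite /exp_discount /= ltry mulr0 expR0.
have -> : \int[P]_w (1 * L q th (th * X 0 w + b)) = L q th (th * x + b).
  under eq_Rintegral do rewrite mul1r (shifted0 HY).
  by rewrite Rintegral_cst// [X in fine X](@probability_setT _ _ _ P) mulr1.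
move=> <-; apply: eq_Rintegral => t; rewrite inE/= in_itv/= andbT => t0.
by congr (_ * Rintegral _ _ _); apply/seteqP; split=> w //= _; rewrite lee_fin.
Qed.

Lemma killed_cos_transform0 th y : 0 < th ->
  cos_transform killed_law th y = L q th (th * x - th * y) -
   \int[mu]_(t in `[0, +oo[) (q * expR (- q * t) *
     \int[P]_(w in [set w | (S w <= t%:E)%E]) cos (th * X t w - th * y)).
Proof.
move=> th0; rewrite /cos_transform -resolvent_free//.
transitivity (\int[killed_law]_z cos (th * z - th * y)).
  by apply: eq_Rintegral => z _; rewrite mulrBr.
rewrite /killed_law (@Rintegral_killed _ _ _ _ _ _ _ _ _ _ _ _ _ 1)//; last 2 first.
- apply: measurableT_comp; first exact: measurable_cos.
  by apply: measurable_funB => //; exact: measurable_funM.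
- by move=> z; exact: norm_cos_le1.
rewrite -RintegralB//.
- by apply: eq_Rintegral => t _; rewrite -mulrBr (Rintegral_survival_cos P mX mS).
- apply: itail => [|t].
    (* The constant time -oo turns the event S <= t into the whole space. *)
    have := measurable_optional_slice P mX rcX Xneg (@measurable_cst _ _ T (\bar R) setT (-oo)%E) th (- (th * y)).
    apply: eq_measurable_fun => t _; congr Rintegral.
    by apply/seteqP; split=> w //= _; rewrite leNye.
  apply: norm_expectation_le => [|w]; last exact: norm_cos_le1.
  exact: (measurable_cosX mX).
- apply: itail => [|t]; first exact: (measurable_optional_slice P mX rcX Xneg mS).
  exact: (optional_slice_le1 P mX mS).
Qed.

Lemma killed_cos_transform th y : 0 < th ->
  cos_transform killed_law th y = L q th (th * x - th * y) -
   \int[P]_w (exp_discount q (S w) * L q th (th * X (fine (S w)) w - th * y)).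
Proof.
move=> th0; rewrite killed_cos_transform0//; congr (_ - _).
exact: (optional_resolvent_discount HY cosc _ q0 th0 S0 pS).
Qed.

Lemma killed_cos_transform_le th y : 0 < th ->
  `|cos_transform killed_law th y| <= 2 * resolvent_bound a rho q th.
Proof.
move=> th0; rewrite killed_cos_transform// (le_trans (ler_normB _ _))// mulr_natl mulr2n lerD//.
  exact: (resolvent_cos_bound _ r0 _ _ q0).
apply: norm_expectation_le => [|w].
  exact: (measurable_discount_value HY).
rewrite normrM -[leRHS]mul1r ler_pM//; last exact: (resolvent_cos_bound _ r0 _ _ q0).
by rewrite ger0_norm ?exp_discount_ge0// exp_discount_le1// ltW.
Qed.

Lemma integrable_killed_bound :
  mu.-integrable `]0, +oo[ (EFin \o (fun th => 2 * resolvent_bound a rho q th)).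
Proof. by apply: integrable_cstM => //; exact: integrable_resolvent_bound. Qed.

End optional.

Let Tn0 n w : (0 <= Tn n w)%E. Proof. exact: hit_ball_ge0. Qed.
Let Tn_past n t : 0 <= t -> past_event P X r m t [set w | (Tn n w < t%:E)%E].
Proof. by move=> t0; apply: (hit_ball_past HY) => //; rewrite invr_gt0. Qed.

Definition killed_at_zero := killed_law (hit_zero_ge0 Y x) (hit_zero_past HY x).

Lemma killed_at_zero_cos_transform th y : 0 < th ->
  cos_transform killed_at_zero th y = L q th (- (th * (y - x))) - phi * L q th (- (th * y)).
Proof.
move=> th0; rewrite killed_cos_transform0// (hit_zero_resolvent HY cosc)//.
by congr (L _ _ _ - _); ring.
Qed.

Lemma killed_at_zero_density y : inv_density killed_at_zero y = U (y - x) - phi * U y.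
Proof.
rewrite /inv_density /resolvent_density [phi * _]mulrCA -mulrBr; congr (_ * _).
have iU z := integrable_resolvent_cos a1 a2 cc z q0.
rewrite -RintegralZl// -RintegralB//; last exact: integrable_cstM.
by apply: eq_Rintegral => th; rewrite inE/= in_itv/= andbT; exact: killed_at_zero_cos_transform.
Qed.

(* The killed path stays at distance at least 1/(n+1) from 0, so the Poisson averages at 0
   tend to 0. *)
Lemma killed_at_ball_density0 n : inv_density (killed_law (Tn0 n) (Tn_past n)) 0 = 0.
Proof.
set V := killed_law _ _.
have c := @inv_density_cvg R V _ integrable_killed_bound (killed_cos_transform_le (Tn0 n) (Tn_past n)) 0.
apply: (cvg_unique (@Rhausdorff R) c).
(* Before the ball is hit, |X| >= 1/(n+1), and there the Poisson kernel is at most e (n+1)^2 /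
   pi. *)
pose K : R := pi^-1 * n.+1%:R ^+ 2.
apply: (@squeeze_cvgr _ _ _ _ (cst 0) (fun k => K * k.+1%:R^-1)); last 2 first.
- exact: cvg_cst.
- by rewrite -[X in _ --> X](mulr0 K); apply: cvgMr; exact: cvg_harmonic.
apply: nearW => k; have e0 : 0 < k.+1%:R^-1 :> R by rewrite invr_gt0.
set e := k.+1%:R^-1 in e0 *.
rewrite poisson_avg_ge0//= /poisson_avg.
have mpk : measurable_fun setT (fun z : R => poisson_kernel e (z - 0)).
  by apply: (measurableT_comp (measurable_poisson_kernel e0)); exact: measurable_funB.
have pkb z : `|poisson_kernel e (z - 0)| <= (pi * e)^-1.
  by rewrite ger0_norm ?poisson_kernel_ge0// poisson_kernel_le.
rewrite /V /killed_law (Rintegral_killed _ _ _ _ _ _ mpk pkb).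
rewrite (@le_trans _ _ (\int[mu]_(t in `[0, +oo[) (K * e * (q * expR (- q * t)))))//; last first.
  rewrite RintegralZl//; last by apply: integrable_cstM => //; exact: integrable_expR.
  have := Rintegral_exp_law q0 (@measurable_cst _ _ R R setT 1) (fun=> lexx `|1|).
  rewrite Rintegral_cst// [X in fine X](@probability_setT _ _ _ (exp_law q0)) mulr1.
  by under eq_Rintegral do rewrite mulr1; move=> <-; rewrite mulr1.
apply: le_Rintegral => //.
- exact: (integrable_killed_slice P mX rcX Xneg (measurable_hit_ball HY x n) q0 mpk pkb).
- by apply: integrable_cstM => //; apply: integrable_cstM => //; exact: integrable_expR.
- move=> t; rewrite /= in_itv/= andbT => t0.
  rewrite mulrC ler_wpM2r ?mulr_ge0 ?expR_ge0 ?(ltW q0)//.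
  have mTt : measurable [set w | (t%:E < Tn n w)%E].
    rewrite -[X in measurable X]setTI; apply: measurable_lte => //.
    exact: (measurable_hit_ball HY).
  have Ke0 : 0 <= K * e by rewrite !mulr_ge0 ?invr_ge0 ?pi_ge0 ?exprn_ge0.
  rewrite (@le_trans _ _ (\int[P]_(w in [set w | (t%:E < Tn n w)%E]) (K * e)))//.
    apply: le_Rintegral => //.
    - apply: (@bounded_integrable _ _ _ _ _ _ (pi * e)^-1) => //.
      by apply: measurable_funTS; exact: (measurableT_comp mpk).
    - exact: finite_measure_integrable_cst.
    - move=> w /= tw; have Xt : n.+1%:R^-1 <= `|X t w|.
        rewrite leNgt; apply/negP => /(hit_ball_le t0); by rewrite leNgt tw.
      rewrite subr0 /poisson_kernel /K -mulrA ler_pM2l ?invr_gt0 ?pi_gt0// mulrC ler_wpM2r ?(ltW e0)//.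
      rewrite invf_ple ?posrE ?exprn_gt0//; last by rewrite ltr_pwDl ?exprn_gt0// sqr_ge0.
      rewrite (@le_trans _ _ (X t w ^+ 2))//; last by rewrite lerDr sqr_ge0.
      by rewrite -exprVn -[leRHS]real_normK ?num_real// lerXn2r ?nnegrE.
  rewrite Rintegral_cst// ler_piMr// -lee_fin fineK ?fin_num_measure//.
  exact: probability_le1.
Qed.

(** The density at 0 vanishes for every ball, and dominated convergence in th carries this to the
    limit of the inversion integrals. The argument by support cannot be applied at [hit_zero]
    directly, since paths killed there may come arbitrarily near 0. *)
Lemma hit_zero_laplaceE : U (- x) = phi * U 0.
Proof.
apply/eqP; rewrite -subr_eq0; apply/eqP.
have c0 : inv_density (killed_law (Tn0 n) (Tn_past n)) 0 @[n --> \oo] --> (0 : R).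
  by apply: cvg_near_cst; apply: nearW => n; exact: killed_at_ball_density0.
apply: (cvg_unique (@Rhausdorff R) _ c0).
rewrite /resolvent_density [phi * _]mulrCA -mulrBr.
have iU z := integrable_resolvent_cos a1 a2 cc z q0.
rewrite -RintegralZl// -RintegralB//; last exact: integrable_cstM.
rewrite /inv_density; apply: cvgMr.
apply: (@Rdominated_cvg _ _ _ mu _ _ _ (fun th => 2 * resolvent_bound a rho q th)) => //.
- by move=> n; exact: measurable_cos_transform.
- move=> th; rewrite /= in_itv/= andbT => th0.
  have E n := killed_cos_transform (Tn0 n) (Tn_past n) 0 th0.
  rewrite (funext E) mulr0 subr0 oppr0 mulrN opprK; apply: cvgB; first exact: cvg_cst.
  have := @hit_ball_resolvent_cvg _ _ _ P a rho Y HY cosc x q th 0 q0 th0.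
  by under eq_cvg do under eq_Rintegral do rewrite addr0.
- exact: integrable_killed_bound.
- by move=> n th; rewrite /= in_itv/= andbT; exact: killed_cos_transform_le.
Qed.

Hypothesis U0 : 0 < U 0.

(** After substituting U(z) = U(0) - q g(z), with g the gap, and phi = U(-x) / U(0), the terms in
    U(0) cancel. The one product left over carries the factor q / U(0), which tends to 0. *)
Lemma killed_at_zero_density_gap y : inv_density killed_at_zero y / q =
  resolvent_gap a rho q (- x) + resolvent_gap a rho q y - resolvent_gap a rho q (y - x) -
  q / U 0 * (resolvent_gap a rho q (- x) * resolvent_gap a rho q y).
Proof.
rewrite killed_at_zero_density /resolvent_gap.
have -> : phi = U (- x) / U 0 by rewrite hit_zero_laplaceE mulfK ?gt_eqF.
move: (U (y - x)) (U (- x)) (U y) (U 0) U0 => u1 u2 u3 u4 u40.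
by field; rewrite !gt_eqF.
Qed.

Lemma killed_at_zeroE A : measurable A ->
  killed_at_zero A = (\int[mu]_(y in A) (inv_density killed_at_zero y)%:E)%E.
Proof.
move=> mA; apply: (@inversion _ _ _ integrable_killed_bound) => //.
exact: killed_cos_transform_le.
Qed.

End killed_density.

(** * The potential density *)

Section potential.
Context {d} {T : measurableType d} {R : realType}.
Variables (P : probability T R) (a rho : R) (Y : R -> T -> R).
Hypothesis HY : is_stable_process P a rho Y.
Hypotheses (a1 : 1 < a) (a2 : a < 2).
Hypothesis cc : 0 < cos (stable_c a rho).
Variable x : R.
Hypothesis x0 : x != 0.
Notation X := (shifted Y x).
Notation mu := (@lebesgue_measure R).
Notation T0 := (hit_zero Y x).
Notation V q0 := (killed_at_zero HY x q0).

Let mX := measurable_shifted HY x.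
Let rcX w t : X s w @[s --> t^'+] --> X t w. Proof. exact: (@shifted_rc _ _ _ _ _ _ _ HY). Qed.
Let Xneg t w : t <= 0 -> X t w = X 0 w. Proof. exact: shifted_const. Qed.
Let mT0 := measurable_hit_zero HY x.

Let mTt t : measurable [set w | (t%:E < T0 w)%E].
Proof. by rewrite -[X in measurable X]setTI; exact: measurable_lte. Qed.

Definition survival_prob (A : set R) (t : R) : \bar R := P [set w | A (X t w) /\ (t%:E < T0 w)%E].

Let measurable_survival A t : measurable A -> measurable [set w | A (X t w) /\ (t%:E < T0 w)%E].
Proof.
move=> mA; apply: measurableI; last exact: mTt.
by rewrite -[X in measurable X]setTI; exact: mX.
Qed.

(** Off a null set [hit0] equals [hit_zero], whose event is measurable. The remaining part lies in a
    null set, hence is measurable by completeness and contributes nothing. *)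
Lemma hit0_survival_prob A t : measure_is_complete P -> measurable A -> 0 <= t ->
  P [set w | A (x + Y t w) /\ (t%:E < hit0 Y x w)%E] = survival_prob A t.
Proof.
move=> cP mA t0; rewrite /survival_prob.
have [N [mN PN0 HN]] := hit0_ae HY (ltW cc) x0.
set E1 := [set w | _]; set E2 := [set w | _ /\ _].
have hE w : ~ N w -> hit0 Y x w = T0 w by move=> nN; apply: contrapT => h; apply: nN; exact: HN.
have E12 : E1 `\` N = E2 `\` N.
  have sE w : X t w = x + Y t w by rewrite shifted_ge0.
  apply/seteqP; split=> w [[Aw tw] nN]; split=> //; split.
  - by rewrite sE.
  - by rewrite -(hE _ nN).
  - by rewrite -sE.
  - by rewrite (hE _ nN).
have mE2 : measurable E2 by exact: measurable_survival.
have mE1N : measurable (E1 `&` N) by apply: cP; exists N; split=> // w [].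
have mE1 : measurable E1.
  rewrite -(setUIDK E1 N) E12.
  by apply: measurableU => //; exact: measurableD.
have PE E : measurable E -> P E = P (E `\` N).
  move=> mE; rewrite (measureDI P mE mN) [X in (_ + X)%E](_ : _ = 0%E) ?adde0//.
  apply/eqP; rewrite eq_le measure_ge0 andbT -PN0 le_measure ?inE//; exact: measurableI.
by rewrite (PE _ mE1) (PE _ mE2) E12.
Qed.

Let mind (A : set R) : measurable A -> measurable_fun setT (\1_A : R -> R).
Proof. by move=> mA; exact: measurable_indic. Qed.

Let ind1 (A : set R) (z : R) : `|(\1_A z : R)| <= 1.
Proof. by rewrite ger0_norm// indicE lern1 leq_b1. Qed.

Let survival_probE A t : measurable A ->
  survival_prob A t = (\int[P]_(w in [set w | (t%:E < T0 w)%E]) (\1_A (X t w))%:E)%E.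
Proof.
move=> mA.
have mXA : measurable (X t @^-1` A) by rewrite -[X in measurable X]setTI; exact: mX.
transitivity (\int[P]_(w in [set w | (t%:E < T0 w)%E]) (\1_(X t @^-1` A) w)%:E)%E => //.
by rewrite integral_indic.
Qed.

Lemma measurable_survival_prob A : measurable A -> measurable_fun setT (survival_prob A).
Proof.
move=> mA.
have := measurable_killed_slice P mX rcX Xneg mT0 (mind mA) (ind1 A).
move=> /measurable_EFinP; apply: eq_measurable_fun => t _ /=.
rewrite survival_probE// fineK//; apply: integrable_fin_num => //.
apply: (@bounded_integrable _ _ _ _ _ _ 1) => //.
by apply: measurable_funTS; exact: (measurableT_comp (mind mA)).
Qed.

Lemma killed_at_zero_survival q (q0 : 0 < q) A : measurable A ->
  ((q^-1)%:E * V q0 A = \int[mu]_(t in `[0%R, +oo[) ((expR (- q * t))%:E * survival_prob A t))%E.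
Proof.
move=> mA.
have -> : V q0 A = (\int[V q0]_z (\1_A z)%:E)%E by rewrite integral_indic// setIT.
rewrite [X in (_ * X)%E](ge0_integral_killed P mX rcX Xneg mT0 q0); last 2 first.
- by apply/measurable_EFinP; exact: (mind mA).
- by move=> z; rewrite lee_fin.
rewrite -ge0_integralZl//.
- apply: eq_integral => t _; rewrite -survival_probE// muleA -EFinM; congr (_%:E * _)%E.
  by rewrite mulrA mulVf ?mul1r// gt_eqF.
- apply: emeasurable_funM.
    apply/measurable_EFinP; apply: measurable_funTS; apply: measurable_funM => //.
    by apply: measurableT_comp => //; exact: measurable_funM.
  have := measurable_funTS (measurable_survival_prob mA) : measurable_fun (`[0, +oo[%classic : set R) _.
  by apply: eq_measurable_fun => t _; rewrite survival_probE.
- by move=> t _; rewrite mule_ge0 ?lee_fin ?mulr_ge0 ?expR_ge0 ?(ltW q0)//; apply: integral_ge0 => w _; rewrite lee_fin.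
- by rewrite lee_fin invr_ge0 ltW.
Qed.

(** A Poisson average divided by q is the Laplace transform at q of a nonnegative function of t,
    hence monotone in q. The order persists in the limit and holds at every y. *)
Lemma killed_at_zero_density_nd q q' (q0 : 0 < q) (q0' : 0 < q') y : q' <= q ->
  inv_density (V q0) y / q <= inv_density (V q0') y / q'.
Proof.
move=> qq.
have c (p : R) (p0 : 0 < p) : poisson_avg (V p0) n.+1%:R^-1 y / p @[n --> \oo] --> inv_density (V p0) y / p.
  apply: cvgMl; apply: (@inv_density_cvg R (V p0) _ (integrable_killed_bound a1 a2 cc p0)) => th z th0.
  exact: killed_cos_transform_le.
apply: (ler_cvg_to (c _ q0) (c _ q0')); apply: nearW => n.
have e0 : 0 < n.+1%:R^-1 :> R by rewrite invr_gt0.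
set e := n.+1%:R^-1 in e0 *.
have mpk : measurable_fun setT (fun z : R => poisson_kernel e (z - y)).
  by apply: (measurableT_comp (measurable_poisson_kernel e0)); exact: measurable_funB.
have pkb z : `|poisson_kernel e (z - y)| <= (pi * e)^-1.
  by rewrite ger0_norm ?poisson_kernel_ge0// poisson_kernel_le.
pose s t := \int[P]_(w in [set w | (t%:E < T0 w)%E]) poisson_kernel e (X t w - y).
have isl (p : R) (p0 : 0 < p) : mu.-integrable `[0, +oo[ (EFin \o (fun t => p * expR (- p * t) * s t)).
  exact: (integrable_killed_slice P mX rcX Xneg mT0 p0 mpk pkb).
have isl' (p : R) (p0 : 0 < p) : mu.-integrable `[0, +oo[ (EFin \o (fun t => expR (- p * t) * s t)).
  have mI : measurable (`[0, +oo[%classic : set (measurableTypeR R)) by exact: measurable_itv.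
  have := integrable_cstM p^-1 mI (isl p p0).
  by apply: eq_integrable => // t _ /=; rewrite !mulrA mulVf ?mul1r// gt_eqF.
have E (p : R) (p0 : 0 < p) : poisson_avg (V p0) e y / p = \int[mu]_(t in `[0, +oo[) (expR (- p * t) * s t).
  rewrite /poisson_avg [X in X / _](Rintegral_killed P mX rcX Xneg mT0 p0 mpk pkb).
  rewrite mulrC -RintegralZl//; last exact: isl.
  by apply: eq_Rintegral => t _; rewrite !mulrA mulVf ?mul1r// gt_eqF.
have H : \int[mu]_(t in `[0, +oo[) (expR (- q * t) * s t) <= \int[mu]_(t in `[0, +oo[) (expR (- q' * t) * s t).
  apply: le_Rintegral; [exact: measurable_itv|exact: isl'|exact: isl'|].
  move=> t; rewrite /= in_itv/= andbT => t0; rewrite ler_wpM2r//.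
    by apply: Rintegral_ge0 => w _; exact: poisson_kernel_ge0.
  by rewrite ler_expR !mulNr lerN2 ler_wpM2r.
by rewrite -(E _ q0) -(E _ q0') in H.
Qed.

(** At y = 0 both sides vanish, so the densities converge at every point and no exceptional set has
    to be removed. *)
Lemma u0_kernelE y : u0 a rho x y = stable_kernel a rho (- x) + stable_kernel a rho y - stable_kernel a rho (y - x).
Proof.
have [->|y0] := eqVneq y 0; last exact: u0_stable_kernel.
by rewrite sub0r stable_kernel0 addr0 subrr /u0 normr0 powR0 ?subr_eq0 ?gt_eqF// sub0r normrN; ring.
Qed.

(* this choice makes the lower bound of resolvent_density0_lower explicit *)
Let q_ n : R := n.+1%:R^-1 `^ a.
Let q_gt0 n : 0 < q_ n. Proof. by rewrite powR_gt0// invr_gt0. Qed.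
Let a_gt0 : 0 < a. Proof. exact: lt_trans a1. Qed.
Let q_cvg : q_ @ \oo --> (0 : R). Proof. exact: powR_cvg_pos. Qed.
Let q_ni n k : (n <= k)%N -> q_ k <= q_ n.
Proof.
move=> nk; rewrite ge0_ler_powR ?nnegrE ?(ltW a_gt0)// lef_pV2 ?posrE// ler_nat ltnS.
by [].
Qed.

Let v n y := inv_density (V (q_gt0 n)) y / q_ n.

Lemma density_cvg_u0 y : v n y @[n --> \oo] --> u0 a rho x y.
Proof.
have E n := killed_at_zero_density_gap HY a1 a2 cc x (q_gt0 n) (resolvent_density0_gt0 a1 a2 cc _) y.
have {}E n : v n y = resolvent_gap a rho (q_ n) (- x) + resolvent_gap a rho (q_ n) y - resolvent_gap a rho (q_ n) (y - x) -
  q_ n / resolvent_density a rho (q_ n) 0 *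
  (resolvent_gap a rho (q_ n) (- x) * resolvent_gap a rho (q_ n) y).
  by apply: E => k; rewrite invr_gt0.
rewrite (funext E) u0_kernelE -[X in _ --> X]subr0.
have cg z := @resolvent_gap_cvg R a rho a1 a2 cc q_ z q_gt0 q_cvg.
rewrite -[X in _ --> _ - X](mul0r (stable_kernel a rho (- x) * stable_kernel a rho y)).
apply: cvgB; first by apply: cvgB; [apply: cvgD|]; exact: cg.
by apply: cvgM; [exact: resolvent_ratio_cvg|apply: cvgM; exact: cg].
Qed.

Let v_ge0 n y : 0 <= v n y.
Proof.
rewrite divr_ge0 ?(ltW (q_gt0 n))//.
apply: (@inv_density_ge0 R _ _ (integrable_killed_bound a1 a2 cc (q_gt0 n))) => th z th0.
exact: killed_cos_transform_le.
Qed.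

Let mv n : measurable_fun setT (v n).
Proof.
apply: measurable_funM => //.
apply: (@measurable_inv_density R _ _ (integrable_killed_bound a1 a2 cc (q_gt0 n))) => th z th0.
exact: killed_cos_transform_le.
Qed.

(** Both sides are monotone limits of the same numbers V(A) / q_n, read once as Laplace integrals of
    survival probabilities and once as integrals of densities; the equality thus includes the value
    +oo. *)
Lemma potential_densityE A : measurable A ->
  (\int[mu]_(t in `[0%R, +oo[) survival_prob A t = \int[mu]_(y in A) (u0 a rho x y)%:E)%E.
Proof.
move=> mA.
have c1 : (((q_ n)^-1)%:E * V (q_gt0 n) A)%E @[n --> \oo] --> (\int[mu]_(t in `[0%R, +oo[) survival_prob A t)%E.
  under eq_cvg do rewrite killed_at_zero_survival//.
  have -> : (\int[mu]_(t in `[0%R, +oo[) survival_prob A t =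
     \int[mu]_(t in `[0%R, +oo[) limn (fun n => (expR (- q_ n * t))%:E * survival_prob A t))%E.
    apply: eq_integral => t _; apply/esym/cvg_lim => //.
    rewrite -[X in _ --> X]mul1e; apply: cvgeZr.
      by apply: fin_num_measure; exact: measurable_survival.
    apply: cvg_EFin; first exact: nearW.
    rewrite -expR0 -[X in expR X](mul0r t); apply: continuous_cvg; first exact: continuous_expR.
    by apply: cvgMl; rewrite -oppr0; exact: cvgN.
  apply: cvg_monotone_convergence => //.
  - move=> n; apply: emeasurable_funM.
      by apply/measurable_EFinP; apply: measurable_funTS; apply: measurableT_comp => //; exact: measurable_funM.
    by apply: measurable_funTS; exact: measurable_survival_prob.
  - by move=> n t _; rewrite mule_ge0// lee_fin expR_ge0.
  - move=> t; rewrite /= in_itv/= andbT => t0 n k nk; apply: lee_wpmul2r => //.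
    by rewrite lee_fin ler_expR !mulNr lerN2 ler_wpM2r// q_ni.
have c2 : (((q_ n)^-1)%:E * V (q_gt0 n) A)%E @[n --> \oo] --> (\int[mu]_(y in A) (u0 a rho x y)%:E)%E.
  have E n : (((q_ n)^-1)%:E * V (q_gt0 n) A)%E = (\int[mu]_(y in A) (v n y)%:E)%E.
    rewrite (killed_at_zeroE HY a1 a2 cc x (q_gt0 n) mA) -ge0_integralZl//.
    - by apply: eq_integral => y _; rewrite -EFinM mulrC.
    - apply/measurable_EFinP; apply: measurable_funTS.
      apply: (@measurable_inv_density R _ _ (integrable_killed_bound a1 a2 cc (q_gt0 n))) => th z th0.
      exact: killed_cos_transform_le.
    - move=> y _; rewrite lee_fin.
      apply: (@inv_density_ge0 R _ _ (integrable_killed_bound a1 a2 cc (q_gt0 n))) => th z th0.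
      exact: killed_cos_transform_le.
    - by rewrite lee_fin invr_ge0 ltW.
  rewrite (funext E).
  have -> : (\int[mu]_(y in A) (u0 a rho x y)%:E = \int[mu]_(y in A) limn (fun n => (v n y)%:E))%E.
    apply: eq_integral => y _; apply/esym/cvg_lim => //.
    by apply: cvg_EFin; [exact: nearW|exact: density_cvg_u0].
  apply: cvg_monotone_convergence => //.
  - by move=> n; apply/measurable_EFinP; exact: measurable_funTS (mv n).
  - by move=> n y _; rewrite lee_fin.
  - by move=> y _ n k nk; rewrite lee_fin; apply: killed_at_zero_density_nd; exact: q_ni.
exact: (cvg_unique (@ereal_hausdorff R) c1 c2).
Qed.

End potential.

(** The angle c is pi/2 times the difference of a (1 - rho) and a rho, two numbers of ]0, 1[, so it
    lies strictly between -pi/2 and pi/2. *)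
Lemma cos_stable_c_gt0 {R : realType} (a rho : R) :
  0 < a * rho -> a * rho < 1 -> 0 < a * (1 - rho) -> a * (1 - rho) < 1 -> 0 < cos (stable_c a rho).
Proof.
move=> h1 h2 h3 h4; apply: cos_gt0_pihalf; rewrite /stable_c.
have p0 := @pi_gt0 R.
have -> : pi * a * (2^-1 - rho) = pi / 2 * (a * (1 - rho) - a * rho) by field.
apply/andP; split; first by rewrite -mulrN1 ltr_pM2l//; lra.
by rewrite gtr_pMr//; lra.
Qed.

Theorem theorem4p3 (R : realType) (d : measure_display) (T : measurableType d)
  (P : probability T R) (a rho : R) (Y : R -> T -> R) :
  1 < a -> a < 2 ->
  0 < a * rho -> a * rho < 1 -> 0 < a * (1 - rho) -> a * (1 - rho) < 1 ->
  measure_is_complete P ->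
  is_stable_process P a rho Y ->
  forall x : R, x != 0 ->
    forall A : set R, measurable A ->
      pot0 P Y x A = (\int[@lebesgue_measure R]_(y in A) (u0 a rho x y)%:E)%E.
Proof.
move=> a1 a2 h1 h2 h3 h4 cP HY x x0 A mA.
have cc := cos_stable_c_gt0 h1 h2 h3 h4.
rewrite -(potential_densityE HY a1 a2 cc x0 mA) /pot0.
apply: eq_integral => t; rewrite inE/= in_itv/= andbT => t0.
exact: (hit0_survival_prob HY cc x0 cP mA t0).
Qed.
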